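(* Let $1<p,q<\infty$ with $1/p+1/q=1$, let $M=(m_i)_{i\ge1}$ and $N=(n_i)_{i\ge1}$ satisfy conditions (i) and (ii) below, and let $\mathcal N$ be an $(M,N,q)$-Schreier norming set with associated Banach space $X_{\mathcal N}$. Then: (1) there is a bounded linear operator $T$ on $X_{\mathcal N}$ which is not of the form $\lambda I+K$ with $\lambda$ a scalar and $K$ a compact operator on $X_{\mathcal N}$; (2) if $X_{\mathcal N}$ is hereditarily indecomposable, this operator $T$ is strictly singular (and non-compact); (3) $\ell_\infty$ embeds isomorphically into $\mathcal L(X_{\mathcal N})$, the space of bounded linear operators on $X_{\mathcal N}$.
   Context: Notation. $c_{00}$ is the space of finitely supported real sequences, $(e_i)_{i\ge1}$ its unit vector basis and $(e_i^* )_{i\ge1}$ the biorthogonal functionals. For $x=\sum_i a_ie_i$ (or a functional $x^*=\sum_i a_ie_i^*$), ${\rm supp}\,x=\{i:a_i\neq0\}$. For finite $E,F\subset\mathbb N$, $E<F$ means $\max E<\min F$; for $n\in\mathbb N$, ''$F\ge n$'' (resp. ''${\rm supp}\,x\ge n$'') means $\min F\ge n$ (resp. $\min{\rm supp}\,x\ge n$). $Ba(\ell_q)$ is the closed unit ball of $\ell_q$ (applied to finite scalar sequences). For an interval $E\subset\mathbb N$ and a functional $x^*$, $Ex^*$ is the restriction of $x^*$ to the coordinates in $E$. Schreier families: $S_0=\{\{n\}:n\in\mathbb N\}\cup\{\emptyset\}$ and $S_{n+1}=\{\bigcup_{i=1}^mF_i: m\in\mathbb N,\ F_i\in S_n,\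 m\le\min F_1,\ F_1<\dots<F_m\}\cup\{\emptyset\}$. Successive finite sets $E_1<\dots<E_k$ are $S_n$-admissible if $\{\min E_1,\dots,\min E_k\}\in S_n$; a finite block sequence $x_1,\dots,x_k$ of vectors or functionals (${\rm supp}\,x_1<\dots<{\rm supp}\,x_k$) is $S_n$-admissible if $({\rm supp}\,x_i)_{i=1}^k$ is. Sequences. $M=(m_i)$, $N=(n_i)$ are increasing sequences of positive integers such that (i) $m_1>3$, $m_2=m_1^5$, $m_{2j+1}=m_{2j}^5$ for $j\ge1$, and there is an increasing sequence $(s_i)$ of positive integers with $m_{2j}=\prod_{i=1}^{j-1}m_{2i}^{s_i}$ for $j\ge2$; (ii) defining for $j\ge2$ $f_j=\max\{\rho n_1+\sum_{1\le i<j}\rho_in_{2i}:\ \rho,\rho_i\in\mathbb N\cup\{0\},\ m_1^{\rho}\prod_{1\le i<j}m_{2i}^{\rho_i}<m_{2j}\}$, one has $4f_j<n_{2j}$ for all $j\ge2$, and $5n_1<n_2$. Norming sets. A set $\mathcal N\subset{\rm span}\{e_i^*\}$ is norming if it contains every $e_n^*$, satisfies $|x^*(e_n)|\le1$ for all $x^*\in\mathcal N$, $n\in\mathbb N$, is symmetric ($x^*\in\mathcal N\Rightarrow -x^*\in\mathcal N$), and $Ex^*\in\mathcal N$ for all $x^*\in\mathcal N$ and intervals $E\subset\mathbb N$. Then $\|x\|_{\mathcal N}=\sup\{x^*(x):x^*\in\mathcal N\}$ is a norm on $c_{00}$ and $X_{\mathcal N}$ is its completion; $(e_i)$ is a normalized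 bimonotone basis of $X_{\mathcal N}$, and elements of ${\rm span}\{e_i^*\}$ are regarded as elements of $X_{\mathcal N}^*$. $(M,N,q)$-Schreier. Let $1<p,q<\infty$, $1/p+1/q=1$. For $k\ge1$ let $\mathcal N_k$ be the set of all $\frac1{m_{2k}}\sum_{i=1}^d\gamma_ix_i^*$ where $d\in\mathbb N$, $(\gamma_i)_{i=1}^d\in Ba(\ell_q)$, and $x_1^*,\dots,x_d^*\in\mathcal N$ is an $S_{n_{2k}}$-admissible block sequence. Let $\mathcal N^q_\infty$ be the union over $k\ge0$ of the sets of all $\frac1{m_{2k+1}}\sum_{i=1}^d\gamma_iEx_i^*$ where $(\gamma_i)\in 2^{1/p}Ba(\ell_q)$, $E$ is an interval of $\mathbb N$, $x_1^*,\dots,x_d^*$ is an $S_{n_{2k+1}}$-admissible block sequence with $x_i^*\in\mathcal N_{j_i}$ and $j_1,\dots,j_d$ pairwise distinct. A norming set $\mathcal N$ is $(M,N,q)$-Schreier if $\mathcal N_j\subset\mathcal N$ for all $j\ge1$ and $\mathcal N\subset\bigcup_{j\ge1}\mathcal N_j\cup\mathcal N^q_\infty\cup\{\pm e_n^*:n\in\mathbb N\}$. A Banach space is hereditarily indecomposable (HI) if no closed infinite-dimensional subspace is a direct sum of two closed infinite-dimensional subspaces. An operator is strictly singular if its restriction to no infinite-dimensional subspace is an isomorphism. *)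

(* Defs.v *)
From Stdlib Require Import Reals Lra Lia List Arith.
Import ListNotations.
Open Scope R_scope.

(* Real sequences indexed by nat; coordinate 0 is unused (the basis is e_1, e_2, ...). *)
Definition vec := nat -> R.

Definition vadd (a b : vec) : vec := fun i => a i + b i.
Definition vscale (c : R) (a : vec) : vec := fun i => c * a i.
Definition vsub (a b : vec) : vec := fun i => a i - b i.
Definition vzero : vec := fun _ => 0.

Definition unitv (n : nat) : vec := fun i => if Nat.eqb i n then 1 else 0.

Definition restrict (a b : nat) (f : vec) : vec :=
  fun i => if (Nat.leb a i && Nat.leb i b)%bool then f i else 0.

Definition supp_le (f : vec) (K : nat) : Prop := forall i, (K < i)%nat -> f i = 0.
Definition fin_supp (f : vec) : Prop := exists K, supp_le f K.

Definition pair (K : nat) (f x : vec) : R := sum_f_R0 (fun i => f i * x i) K.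

Fixpoint lc (gs : list R) (xs : list vec) : vec :=
  match gs, xs with
  | g :: gs', x :: xs' => fun i => g * x i + lc gs' xs' i
  | _, _ => fun _ => 0
  end.

(* ---------- Schreier families (finite sets = strictly increasing lists) ---------- *)
Fixpoint succ_lists (Fs : list (list nat)) : Prop :=
  match Fs with
  | G1 :: ((G2 :: _) as rest) => (last G1 0 < hd 0 G2)%nat /\ succ_lists rest
  | _ => True
  end.

Fixpoint Schreier (k : nat) (F : list nat) : Prop :=
  match k with
  | O => F = [] \/ exists j, (1 <= j)%nat /\ F = [j]
  | S k' => F = [] \/
      exists Fs : list (list nat),
        Fs <> [] /\ Forall (fun G => G <> [] /\ Schreier k' G) Fs /\
        succ_lists Fs /\ (length Fs <= hd 0%nat (hd [] Fs))%nat /\ F = concat Fs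
  end.

Definition supp_before (f g : vec) : Prop :=
  exists k, (forall i, (k < i)%nat -> f i = 0) /\ (forall i, (i <= k)%nat -> g i = 0).

Fixpoint is_block (xs : list vec) : Prop :=
  match xs with
  | x1 :: ((x2 :: _) as rest) => supp_before x1 x2 /\ is_block rest
  | _ => True
  end.

Definition min_supp (f : vec) (j : nat) : Prop :=
  f j <> 0 /\ forall i, (i < j)%nat -> f i = 0.

Definition admissible (k : nat) (xs : list vec) : Prop :=
  xs <> [] /\ is_block xs /\
  exists ms : list nat, Forall2 min_supp xs ms /\ Schreier k ms.

Definition rpow_abs (g q : R) : R :=
  if Req_EM_T g 0 then 0 else Rpower (Rabs g) q.
Definition lq_sum (q : R) (gs : list R) : R :=
  fold_right (fun g acc => rpow_abs g q + acc) 0 gs.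

Definition norming (Nn : vec -> Prop) : Prop :=
  (forall f, Nn f -> f 0%nat = 0 /\ fin_supp f) /\
  (forall k, (1 <= k)%nat -> Nn (unitv k)) /\
  (forall f k, Nn f -> Rabs (f k) <= 1) /\
  (forall f, Nn f -> Nn (vscale (-1) f)) /\
  (forall f a b, Nn f -> Nn (restrict a b f)).

Definition NK (q : R) (m n : nat -> nat) (Nn : vec -> Prop) (k : nat) (f : vec) : Prop :=
  exists (gs : list R) (xs : list vec),
    length gs = length xs /\ lq_sum q gs <= 1 /\ Forall Nn xs /\
    admissible (n (2 * k)%nat) xs /\
    forall i, f i = / INR (m (2 * k)%nat) * lc gs xs i.

Definition Ninf (p q : R) (m n : nat -> nat) (Nn : vec -> Prop) (f : vec) : Prop :=
  exists (k : nat) (ds : list R) (xs : list vec) (js : list nat) (a b : nat),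
    length ds = length xs /\ lq_sum q ds <= 1 /\
    admissible (n (2 * k + 1)%nat) xs /\
    Forall2 (fun x j => (1 <= j)%nat /\ NK q m n Nn j x) xs js /\ NoDup js /\
    forall i, f i = / INR (m (2 * k + 1)%nat) *
                    lc (map (fun d => Rpower 2 (1 / p) * d) ds) (map (restrict a b) xs) i.

Definition MNq_Schreier (p q : R) (m n : nat -> nat) (Nn : vec -> Prop) : Prop :=
  norming Nn /\
  (forall j f, (1 <= j)%nat -> NK q m n Nn j f -> Nn f) /\
  (forall f, Nn f ->
     (exists j, (1 <= j)%nat /\ NK q m n Nn j f) \/ Ninf p q m n Nn f \/
     exists k, (1 <= k)%nat /\
       ((forall i, f i = unitv k i) \/ (forall i, f i = - unitv k i))).

Fixpoint prodn (g : nat -> nat) (k : nat) : nat :=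
  match k with O => 1%nat | S k' => (prodn g k' * g k)%nat end.
Fixpoint sumn_to (g : nat -> nat) (k : nat) : nat :=
  match k with O => 0%nat | S k' => (sumn_to g k' + g k)%nat end.

Definition incr_pos (m : nat -> nat) : Prop :=
  (forall i, (1 <= i)%nat -> (1 <= m i)%nat) /\
  (forall i, (1 <= i)%nat -> (m i < m (S i))%nat).

Definition cond_i (m : nat -> nat) : Prop :=
  incr_pos m /\ (3 < m 1%nat)%nat /\ m 2%nat = (m 1%nat ^ 5)%nat /\
  (forall j, (1 <= j)%nat -> m (2 * j + 1)%nat = (m (2 * j)%nat ^ 5)%nat) /\
  exists s : nat -> nat, incr_pos s /\
    forall j, (2 <= j)%nat ->
      m (2 * j)%nat = prodn (fun i => (m (2 * i)%nat ^ s i)%nat) (j - 1).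

(* 4 f_j < n_{2j} written out: f_j is the max of a finite nonempty set *)
Definition cond_ii (m n : nat -> nat) : Prop :=
  incr_pos n /\
  (forall j, (2 <= j)%nat ->
     forall (rho : nat) (rhos : nat -> nat),
       (m 1%nat ^ rho * prodn (fun i => (m (2 * i)%nat ^ rhos i)%nat) (j - 1) < m (2 * j)%nat)%nat ->
       (4 * (rho * n 1%nat + sumn_to (fun i => (rhos i * n (2 * i)%nat)%nat) (j - 1)) < n (2 * j)%nat)%nat) /\
  (5 * n 1%nat < n 2%nat)%nat.

(* ||x||_N <= c  (sup over the norming set; finitely supported functionals) *)
Definition nbound (Nn : vec -> Prop) (x : vec) (c : R) : Prop :=
  forall f K, Nn f -> supp_le f K -> pair K f x <= c.

Definition seg (n k : nat) (a : vec) : vec :=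
  fun i => if (Nat.ltb n i && Nat.leb i k)%bool then a i else 0.

(* X_N = coefficient sequences whose partial sums sum_{i<=k} a_i e_i are Cauchy *)
Definition inX (Nn : vec -> Prop) (a : vec) : Prop :=
  a 0%nat = 0 /\
  forall eps, 0 < eps -> exists n0, forall n k, (n0 <= n)%nat -> (n <= k)%nat ->
    nbound Nn (seg n k a) eps.

Definition op_norm_le (Nn : vec -> Prop) (T : vec -> vec) (C : R) : Prop :=
  forall a c, inX Nn a -> nbound Nn a c -> nbound Nn (T a) (C * c).

Definition is_op (Nn : vec -> Prop) (T : vec -> vec) : Prop :=
  (forall a, inX Nn a -> inX Nn (T a)) /\
  (forall a b, inX Nn a -> inX Nn b -> forall i, T (vadd a b) i = T a i + T b i) /\
  (forall c a, inX Nn a -> forall i, T (vscale c a) i = c * T a i) /\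
  exists C, op_norm_le Nn T C.

Definition compact_op (Nn : vec -> Prop) (K : vec -> vec) : Prop :=
  is_op Nn K /\
  forall eps, 0 < eps -> exists ys : list vec, Forall (inX Nn) ys /\
    forall a, inX Nn a -> nbound Nn a 1 -> exists y, In y ys /\ nbound Nn (vsub (K a) y) eps.

Definition subspace (Nn : vec -> Prop) (Y : vec -> Prop) : Prop :=
  (forall a, Y a -> inX Nn a) /\ Y vzero /\
  (forall a b, Y a -> Y b -> Y (vadd a b)) /\
  (forall c a, Y a -> Y (vscale c a)).

Definition closed_sub (Nn : vec -> Prop) (Y : vec -> Prop) : Prop :=
  subspace Nn Y /\
  forall a, inX Nn a -> (forall eps, 0 < eps -> exists y, Y y /\ nbound Nn (vsub a y) eps) -> Y a.

Definition lin_indep (vs : list vec) : Prop :=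
  forall cs : list R, length cs = length vs -> (forall i, lc cs vs i = 0) ->
    Forall (fun c => c = 0) cs.

Definition inf_dim (Y : vec -> Prop) : Prop :=
  forall d : nat, exists vs : list vec, length vs = d /\ Forall Y vs /\ lin_indep vs.

Definition HI (Nn : vec -> Prop) : Prop :=
  forall Z Y W : vec -> Prop,
    closed_sub Nn Z -> closed_sub Nn Y -> closed_sub Nn W ->
    inf_dim Z -> inf_dim Y -> inf_dim W ->
    (forall a, Y a -> Z a) -> (forall a, W a -> Z a) ->
    (forall a, Y a -> W a -> forall i, a i = 0) ->
    (forall z, Z z -> exists y w, Y y /\ W w /\ forall i, z i = y i + w i) ->
    False.

Definition strictly_singular (Nn : vec -> Prop) (T : vec -> vec) : Prop :=
  forall Y, subspace Nn Y -> inf_dim Y ->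
    ~ (exists d, 0 < d /\ forall a c, Y a -> nbound Nn (T a) c -> nbound Nn a (c / d)).

Definition bounded_seq (s : nat -> R) : Prop := exists M, forall k, Rabs (s k) <= M.

Definition linf_embeds (Nn : vec -> Prop) : Prop :=
  exists (J : (nat -> R) -> vec -> vec) (c1 c2 : R), 0 < c1 /\ 0 < c2 /\
    (forall s, bounded_seq s -> is_op Nn (J s)) /\
    (forall s t a, bounded_seq s -> bounded_seq t -> inX Nn a ->
       forall i, J (fun k => s k + t k) a i = J s a i + J t a i) /\
    (forall r s a, bounded_seq s -> inX Nn a ->
       forall i, J (fun k => r * s k) a i = r * J s a i) /\
    (forall s M, (forall k, Rabs (s k) <= M) -> op_norm_le Nn (J s) (c2 * M)) /\
    (forall s M, bounded_seq s -> op_norm_le Nn (J s) M -> forall k, c1 * Rabs (s k) <= M).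

(* Main.v *)
(* The operators have the form [a |-> sum_k s_k x*_k(a) e_{t_k}] for a block sequence of functionals
   [x*_k = (1 / m_{2k}) sum_{i in F_k} u_i^{1/q} e*_i], where [t_k = min F_k] and [u] is a probability
   vector on a set [F_k] of Schreier complexity [c_k = sum_{i<k} s_i n_{2i}] whose mass on every set of
   complexity [c_k - 1] is tiny (a repeated average).

   Upper estimates.  Since [m_{2k} = prod_{i<k} m_{2i}^{s_i} = m_{2j} * (...)] for every [j <= k], each
   [x*_k] can be read as a functional of weight [m_{2j}] that uses only complexity [c_j] of the
   available [n_{2j}].  Hence a combination of the [x*_k], [k >= j], with coefficients in [Ba(l_q)] and
   [{t_k}] of complexity at most [n_{2j} - c_j] is again in the norming set.  For [y] in the norming set,
   sort the [k] by the size of [y(e_{t_k})], relative to an [l_q]-vector: those of relative size at least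
   [1 / m_{2j+2}] form a set of small complexity by condition (ii), so the group of relative size about
   [1 / m_{2j}] contributes [O(j / m_{2j})], which is summable.  This bounds the operator by
   [4 sup |s_k|].

   Lower estimates.  The vectors [x_k = m_{2k} sum u_i^{1/p} e_i] satisfy [x*_k(x_k) = 1] and
   [||x_k|| <= 5], because a functional is larger than [1 / m_{2k}] only on a set of complexity below
   [c_k] (a mixed radix computation with the exponents of the [m_{2i}]).  So the operator maps the
   bounded block sequence [x_k] to [s_k e_{t_k}].

   Taking [s = 1] gives [T].  It annihilates infinitely many basis vectors, hence is not of the form
   [lambda I + compact]; and if [T] were bounded below on [Y], then [closure Y + ker T] would be a closed
   direct sum, contradicting hereditary indecomposability. *)
Require Import Defs.
From Stdlib Require Import Reals Lra Lia List Arith Sorting.Sorted ClassicalEpsilon FunctionalExtensionality.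
Import ListNotations.
Open Scope R_scope.

(** * Schreier families *)

(** The norming set is constrained by an inclusion and not generated: a member decomposes one level
    at a time, with no well-founded tree beneath it. Estimates are therefore proved to depth [h]
    with an error [(/2) ^ h]. Finite support then removes the error at the price of a factor 2,
    whence the constants 4 = 2 + 1 + 1 and 5 = 2 + 2 + 1.

    The large coordinates of a functional are controlled in two ways. The lower estimate must stay
    strictly below [cap], so its complexity has to be sharp; but a union of many sets is harmless,
    as the averages can be made flat enough. The upper estimate needs one single Schreier set, for
    admissibility, but can lose a factor 2 in complexity, which the factor 4 of condition (ii) pays
    for. Odd functionals are the obstacle to both, since no budget affords their Schreier index.

    Block [k] has weight [m (2 * (k + 2))] because condition (ii) starts at index 2. Placing [t_k]
    at the minimum of its block makes tails of the image depend on tails of the argument only. *)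

Local Notation inc := (StronglySorted lt).

Lemma inc_app (l1 l2 : list nat) :
  inc (l1 ++ l2) <-> inc l1 /\ inc l2 /\ forall x y, In x l1 -> In y l2 -> (x < y)%nat.
Proof.
  induction l1 as [|a l1 IH]; simpl.
  - split; [intros H; repeat split; auto; [constructor | tauto] | tauto].
  - split.
    + intros H. apply StronglySorted_inv in H as [H Ha].
      apply IH in H as (H1 & H2 & H3). rewrite Forall_app in Ha. destruct Ha as [Ha1 Ha2].
      repeat split; auto; [constructor; auto|].
      intros x y [<-|Hx] Hy; auto. rewrite Forall_forall in Ha2; auto.
    + intros (H1 & H2 & H3). apply StronglySorted_inv in H1 as [H1 Ha].
      constructor; [apply IH; auto|].
      rewrite Forall_app; split; auto. apply Forall_forall; intros; auto.
Qed.

Lemma inc_NoDup (l : list nat) : inc l -> NoDup l.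
Proof.
  induction 1 as [|a l Hl IH Ha]; constructor; auto.
  intros Hin. rewrite Forall_forall in Ha. specialize (Ha _ Hin). lia.
Qed.

Lemma inc_ext (l l' : list nat) :
  inc l -> inc l' -> (forall x, In x l <-> In x l') -> l = l'.
Proof.
  intros H. revert l'. induction H as [|a l Hl IH Ha]; intros l' H' E.
  - destruct l' as [|b l']; auto. destruct (E b) as [_ F]. destruct F; simpl; auto.
  - destruct l' as [|b l'].
    + destruct (E a) as [F _]. destruct F; simpl; auto.
    + apply StronglySorted_inv in H' as [H' Hb].
      rewrite Forall_forall in Ha, Hb.
      assert (a = b).
      { destruct (proj1 (E a) (or_introl eq_refl)) as [|F]; auto.
        destruct (proj2 (E b) (or_introl eq_refl)) as [|F']; auto.
        apply Hb in F. apply Ha in F'. lia. }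
      subst b. f_equal. apply IH; auto. intros x. split; intros Hx.
      * destruct (proj1 (E x) (or_intror Hx)) as [<-|]; auto. apply Ha in Hx; lia.
      * destruct (proj2 (E x) (or_intror Hx)) as [<-|]; auto. apply Hb in Hx; lia.
Qed.

Lemma inc_hd_le (l : list nat) i : inc l -> In i l -> (hd 0 l <= i)%nat.
Proof.
  intros H Hi. destruct H as [|a l Hl Ha]; simpl in *; [tauto|].
  rewrite Forall_forall in Ha. destruct Hi as [<-|Hi]; [lia|apply Ha in Hi; lia].
Qed.

Lemma inc_le_last (l : list nat) i : inc l -> In i l -> (i <= last l 0)%nat.
Proof.
  intros H. revert i. induction H as [|a l Hl IH Ha]; intros i; [simpl; tauto|].
  intros Hi. destruct l as [|b l]; [simpl in *; lia|].
  change (last (a :: b :: l) 0%nat) with (last (b :: l) 0%nat).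
  destruct Hi as [<-|Hi]; auto.
  apply Forall_inv in Ha. assert (b <= last (b :: l) 0)%nat by (apply IH; simpl; auto). lia.
Qed.

Lemma hd_In (l : list nat) : l <> [] -> In (hd 0%nat l) l.
Proof. destruct l; simpl; [congruence|auto]. Qed.

Lemma last_In (l : list nat) : l <> [] -> In (last l 0%nat) l.
Proof.
  intros H. rewrite (app_removelast_last 0%nat H) at 2. apply in_or_app; simpl; auto.
Qed.

Lemma inc_concat_piece (Fs : list (list nat)) F : inc (concat Fs) -> In F Fs -> inc F.
Proof.
  induction Fs as [|G Fs IH]; simpl; [tauto|].
  intros H [<-|HF]; apply inc_app in H as (H1 & H2 & _); auto.
Qed.

(** Comparing [last] with the next [hd] is faithful only for nonempty lists, since both return the
    default 0 on an empty one. *)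
Lemma succ_lists_inc (Fs : list (list nat)) :
  Forall (fun G => G <> [] /\ inc G) Fs -> (succ_lists Fs <-> inc (concat Fs)).
Proof.
  induction Fs as [|G1 Fs IH]; intros H.
  - simpl. split; auto. constructor.
  - apply Forall_cons_iff in H as [[Hn1 Hi1] H]. specialize (IH H).
    destruct Fs as [|G2 Fs].
    + simpl. rewrite app_nil_r. tauto.
    + change (succ_lists (G1 :: G2 :: Fs)) with ((last G1 0 < hd 0 G2)%nat /\ succ_lists (G2 :: Fs)).
      change (concat (G1 :: G2 :: Fs)) with (G1 ++ concat (G2 :: Fs)).
      rewrite inc_app, IH. apply Forall_cons_iff in H as [[Hn2 Hi2] H].
      split.
      * intros [Hl Hc]. repeat split; auto.
        intros x y Hx Hy. apply inc_le_last in Hx; auto.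
        apply (inc_hd_le _ y) in Hc; auto.
        destruct G2; [congruence|]. simpl in *. lia.
      * intros (_ & Hc & Hlt). split; auto. apply Hlt; [apply last_In; auto|].
        simpl. apply in_or_app. left. apply hd_In; auto.
Qed.

Lemma hd_concat (Fs : list (list nat)) :
  hd [] Fs <> [] -> hd 0%nat (concat Fs) = hd 0%nat (hd [] Fs).
Proof. destruct Fs as [|[|a F] Fs]; simpl; congruence. Qed.

Lemma Schreier_inc k F : Schreier k F -> inc F.
Proof.
  revert F. induction k as [|k IH]; simpl; intros F.
  - intros [->|(j & _ & ->)]; repeat constructor.
  - intros [->|(Fs & _ & H & Hs & _ & ->)]; [constructor|].
    apply succ_lists_inc; auto. eapply Forall_impl; [|exact H]. simpl. firstorder.
Qed.

Lemma Schreier_ge1 k F i : Schreier k F -> In i F -> (1 <= i)%nat.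
Proof.
  revert F. induction k as [|k IH]; simpl; intros F.
  - intros [->|(j & Hj & ->)]; simpl; [tauto|]. intros [<-|[]]; auto.
  - intros [->|(Fs & _ & H & Hs & _ & ->)]; [simpl; tauto|].
    rewrite in_concat. intros (G & HG & Hi). rewrite Forall_forall in H. 
    apply H in HG as [_ HG]. eauto.
Qed.

Lemma Schreier_nil k : Schreier k [].
Proof. destruct k; simpl; auto. Qed.

Lemma Schreier_S k Fs :
  Forall (fun G => G <> [] /\ Schreier k G) Fs -> inc (concat Fs) ->
  (length Fs <= hd 0%nat (concat Fs))%nat -> Schreier (S k) (concat Fs).
Proof.
  intros H Hi Hl. destruct Fs as [|F Fs]; [left; auto|]. right.
  exists (F :: Fs). repeat split; auto; try congruence.
  - apply succ_lists_inc; auto. eapply Forall_impl; [|exact H].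
    intros G [HG HS]; split; auto. eapply Schreier_inc; eauto.
  - apply Forall_inv in H as [H _]. destruct F; simpl in *; congruence.
Qed.

Lemma Schreier_S_inv k F :
  Schreier (S k) F -> F <> [] -> exists Fs, Fs <> [] /\ F = concat Fs /\
    Forall (fun G => G <> [] /\ Schreier k G) Fs /\ inc (concat Fs) /\
    (length Fs <= hd 0%nat (concat Fs))%nat.
Proof.
  intros [->|(Fs & Hn & H & Hs & Hl & ->)] Hne; [congruence|].
  exists Fs. repeat split; auto.
  - apply succ_lists_inc; auto. eapply Forall_impl; [|exact H].
    intros G [HG HS]; split; auto. eapply Schreier_inc; eauto.
  - destruct Fs as [|G Fs]; [congruence|]. apply Forall_inv in H as [H _].
    rewrite hd_concat; auto.
Qed.

Lemma map_eq_concat {A B} (f : A -> B) (As : list (list B)) (l : list A) :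
  map f l = concat As -> exists ls, l = concat ls /\ As = map (map f) ls.
Proof.
  revert l. induction As as [|a As IH]; simpl; intros l H.
  - exists []. destruct l; simpl in *; [auto|discriminate].
  - apply map_eq_app in H as (l1 & l2 & -> & <- & H2).
    apply IH in H2 as (ls & -> & ->). exists (l1 :: ls). auto.
Qed.

Lemma Forall_concat {A} (Q : A -> Prop) (ls : list (list A)) :
  Forall Q (concat ls) <-> Forall (Forall Q) ls.
Proof.
  induction ls as [|l ls IH]; simpl.
  - split; constructor.
  - rewrite Forall_app, Forall_cons_iff, IH. tauto.
Qed.

Lemma concat_concat {A} (l : list (list (list A))) : concat (concat l) = concat (map (@concat A) l).
Proof. induction l; simpl; auto. rewrite concat_app. congruence. Qed.

Lemma concat_nonempty {A} (Gs : list (list A)) :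
  Gs <> [] -> Forall (fun G => G <> []) Gs -> concat Gs <> [].
Proof. destruct Gs as [|G Gs]; [congruence|]. intros _ H. apply Forall_inv in H. destruct G; simpl; congruence. Qed.

Lemma inc_heads (Gs : list (list nat)) :
  Forall (fun G => G <> []) Gs -> inc (concat Gs) -> inc (map (hd 0%nat) Gs).
Proof.
  induction Gs as [|G Gs IH]; simpl; intros H Hi; [constructor|].
  apply Forall_cons_iff in H as [Hn H]. apply inc_app in Hi as (_ & H2 & H3).
  constructor; auto. apply Forall_forall. intros x Hx. apply in_map_iff in Hx as (G' & <- & HG').
  apply H3; [apply hd_In; auto|]. apply in_concat. exists G'. split; auto.
  apply hd_In. rewrite Forall_forall in H; auto.
Qed.

Lemma hd_map_hd (Gs : list (list nat)) :
  Forall (fun G => G <> []) Gs -> hd 0%nat (map (hd 0%nat) Gs) = hd 0%nat (concat Gs).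
Proof.
  destruct Gs as [|G Gs]; simpl; auto. intros H; apply Forall_inv in H.
  destruct G; simpl; congruence.
Qed.

(** This is S_a[S_b] inside S_{a+b}. The top-level splitting of the list of minima lifts to a
    splitting of the blocks. Each group is treated by induction, and the bound on the number of
    groups persists because the first minimum is the head of the whole concatenation. *)
Lemma Schreier_compose a b (Hs : list (list nat)) :
  Schreier a (map (hd 0%nat) Hs) -> Forall (fun G => G <> [] /\ Schreier b G) Hs ->
  inc (concat Hs) -> Schreier (a + b) (concat Hs).
Proof.
  revert Hs. induction a as [|a IH]; intros Hs HS HF Hi.
  - destruct HS as [E|(j & _ & E)].
    + apply map_eq_nil in E. subst. apply Schreier_nil.
    + destruct Hs as [|H [|H' Hs]]; try discriminate. simpl. rewrite app_nil_r.
      apply Forall_inv in HF. tauto.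
  - assert (HF0 : Forall (fun G => G <> []) Hs) by (eapply Forall_impl; [|exact HF]; simpl; tauto).
    destruct Hs as [|H Hs]; [apply Schreier_nil|].
    apply Schreier_S_inv in HS as (As & Hne & E & HA & HAi & Hl); [|simpl; congruence].
    assert (E' := E). apply map_eq_concat in E as (ls & E & ->).
    rewrite E, concat_concat in *. apply Schreier_S; auto.
    + apply Forall_forall. intros G HG. apply in_map_iff in HG as (l & <- & Hl').
      rewrite Forall_map, Forall_forall in HA. destruct (HA _ Hl') as [Hn HS].
      rewrite Forall_concat in HF, HF0. rewrite Forall_forall in HF, HF0.
      split.
      * apply concat_nonempty; auto. intros ->. apply Hn; auto.
      * apply IH; auto. apply (inc_concat_piece _ _ Hi). apply in_map; auto.
    + rewrite <- concat_concat, <- E. rewrite <- E', length_map in *.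
      rewrite hd_map_hd in Hl; auto. congruence.
Qed.

Lemma Forall_ex_list {A B} (R : A -> B -> Prop) (l : list A) :
  Forall (fun x => exists y, R x y) l -> exists ys, Forall2 R l ys.
Proof.
  induction 1 as [|x l [y Hy] _ [ys IH]]; [exists []; auto|]. exists (y :: ys). auto.
Qed.

(** The converse of [Schreier_compose]: opening the top [a] layers leaves S_b pieces, and their
    minima remember these layers. *)
Lemma Schreier_decompose a b F :
  Schreier (a + b) F -> F <> [] -> exists Hs, Hs <> [] /\ F = concat Hs /\
    Forall (fun G => G <> [] /\ Schreier b G) Hs /\ Schreier a (map (hd 0%nat) Hs).
Proof.
  revert F. induction a as [|a IH]; intros F HS Hne.
  - exists [F]. simpl. rewrite app_nil_r. repeat split; auto; try congruence.
    right. exists (hd 0%nat F). split; auto. eapply Schreier_ge1; eauto. apply hd_In; auto.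
  - change (S a + b)%nat with (S (a + b)) in HS.
    apply Schreier_S_inv in HS as (Fs & HFs & -> & HF & Hi & Hl); auto.
    assert (HX : Forall (fun F => exists Hs, Hs <> [] /\ F = concat Hs /\
       Forall (fun G => G <> [] /\ Schreier b G) Hs /\ Schreier a (map (hd 0%nat) Hs)) Fs).
    { eapply Forall_impl; [|exact HF]. intros G [HG HG']. apply IH; auto. }
    apply Forall_ex_list in HX as (Hss & HX).
    assert (E : Fs = map (@concat nat) Hss).
    { clear - HX. induction HX as [|F Hs Fs Hss (_ & -> & _) _ IH]; simpl; congruence. }
    assert (Hall : Forall (fun Hs => Hs <> [] /\ Forall (fun G => G <> [] /\ Schreier b G) Hs 
              /\ Schreier a (map (hd 0%nat) Hs)) Hss).
    { clear - HX. induction HX; constructor; tauto. }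
    assert (Hall2 : Forall (fun G => G <> [] /\ Schreier b G) (concat Hss)).
    { apply Forall_concat. eapply Forall_impl; [|exact Hall]. simpl; tauto. }
    assert (Hall3 : Forall (fun G : list nat => G <> []) (concat Hss)).
    { eapply Forall_impl; [|exact Hall2]. simpl; tauto. }
    exists (concat Hss). rewrite E, <- concat_concat in *. repeat split; auto.
    + intros E0. rewrite E0 in Hne. simpl in Hne. congruence.
    + rewrite concat_map. apply Schreier_S.
      * apply Forall_map. eapply Forall_impl; [|exact Hall]. simpl. intros Hs (H1 & _ & H2); split; auto.
        intros E0. apply map_eq_nil in E0. auto.
      * rewrite <- concat_map. apply inc_heads; auto.
      * rewrite <- concat_map, hd_map_hd; auto. rewrite length_map in *. auto.
Qed.

(** * Schreier complexity of arbitrary sets *)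

Fixpoint succU (C : (nat -> Prop) -> Prop) (d : nat) (P : nat -> Prop) : Prop :=
  match d with
  | O => forall i, ~ P i
  | S d' => exists cut, C (fun i => P i /\ (i < cut)%nat) /\ succU C d' (fun i => P i /\ (cut <= i)%nat)
  end.

(** Sets are split by cut points instead of being listed, and pieces may be empty. Passing to
    subsets and padding the number of pieces then need no rearrangement; [cov_Schreier] returns to
    lists where admissibility is required. *)
Fixpoint cov (k : nat) (P : nat -> Prop) : Prop :=
  match k with
  | O => exists j, forall i, P i -> i = j
  | S k' => exists d, (forall i, P i -> (d <= i)%nat) /\ succU (cov k') d P
  end.

Lemma succU_sub (C : (nat -> Prop) -> Prop) d :
  (forall P Q : nat -> Prop, (forall i, P i -> Q i) -> C Q -> C P) ->
  forall P Q : nat -> Prop, (forall i, P i -> Q i) -> succU C d Q -> succU C d P.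
Proof.
  intros HC. induction d as [|d IH]; simpl; intros P Q HPQ.
  - intros H i Hi. apply (H i); auto.
  - intros (cut & H1 & H2). exists cut. split.
    + eapply HC; [|exact H1]. firstorder.
    + eapply IH; [|exact H2]. firstorder.
Qed.

Lemma cov_sub k (P Q : nat -> Prop) : (forall i, P i -> Q i) -> cov k Q -> cov k P.
Proof.
  revert P Q. induction k as [|k IH]; simpl; intros P Q HPQ.
  - intros (j & H). exists j. auto.
  - intros (d & Hd & H). exists d. split; auto. eapply succU_sub; eauto.
Qed.

Lemma cov_empty k (P : nat -> Prop) : (forall i, ~ P i) -> cov k P.
Proof.
  intros H. destruct k; simpl.
  - exists 0%nat. firstorder.
  - exists 0%nat. simpl. firstorder.
Qed.

Lemma succU_pad k d d' P : (d <= d')%nat -> succU (cov k) d P -> succU (cov k) d' P.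
Proof.
  intros Hd. revert P. induction Hd as [|d' Hd IH]; intros P H; auto.
  exists 0%nat. split.
  - apply cov_empty. intros i [_ Hi]. lia.
  - eapply succU_sub; [apply cov_sub| |apply IH; exact H]. tauto.
Qed.

Lemma cov_S k (P : nat -> Prop) B : (forall i, P i -> (1 <= i <= B)%nat) -> cov k P -> cov (S k) P.
Proof.
  intros H1 H. exists 1%nat. split; [firstorder|]. exists (S B). split.
  - eapply cov_sub; [|exact H]. tauto.
  - intros i [Hi HB]. apply H1 in Hi. lia.
Qed.

Lemma cov_le k k' (P : nat -> Prop) B :
  (k <= k')%nat -> (forall i, P i -> (1 <= i <= B)%nat) -> cov k P -> cov k' P.
Proof. intros Hk HP H. induction Hk; auto. eapply cov_S; eauto. Qed.

Lemma inc_filter f (l : list nat) : inc l -> inc (filter f l).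
Proof.
  induction 1 as [|a l Hl IH Ha]; simpl; [constructor|].
  destruct (f a); auto. constructor; auto. rewrite Forall_forall in *.
  intros x Hx. apply filter_In in Hx. apply Ha; tauto.
Qed.

Lemma cov_Schreier k F : inc F -> (forall i, In i F -> (1 <= i)%nat) ->
  cov k (fun i => In i F) -> Schreier k F.
Proof.
  revert F. induction k as [|k IH]; intros F Hi H1 H.
  - destruct H as (j & Hj). destruct F as [|a F]; [left; auto|]. right.
    exists j. assert (a = j) by (apply Hj; simpl; auto). subst a.
    split; [apply H1; simpl; auto|]. destruct F as [|b F]; auto.
    assert (b = j) by (apply Hj; simpl; auto). subst b.
    apply inc_NoDup in Hi. inversion Hi; subst. simpl in *; tauto.
  - destruct H as (d & Hd & H).
    (* The cuts become filtered sublists; dropping the empty ones only lowers their number. *)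
    assert (HF : exists Fs, F = concat Fs /\ (length Fs <= d)%nat /\
              Forall (fun G => G <> [] /\ Schreier k G) Fs).
    { clear Hd. revert F Hi H1 H. induction d as [|d IHd]; intros F Hi H1 H.
      - exists []. simpl. repeat split; auto. destruct F as [|a F]; auto.
        exfalso. apply (H a); simpl; auto.
      - destruct H as (cut & Hc & Hr).
        destruct (IHd (filter (fun i => cut <=? i)%nat F)) as (Fs & E & Hl & HFs).
        + apply inc_filter; auto.
        + intros i HiF. apply filter_In in HiF. apply H1; tauto.
        + eapply succU_sub; [apply cov_sub| |exact Hr]. simpl. intros i HiF.
          apply filter_In in HiF as [? ?]. rewrite Nat.leb_le in *. auto.
        + set (G := filter (fun i => i <? cut)%nat F).
          assert (HG : Schreier k G).
          { apply IH.
            - apply inc_filter; auto.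
            - intros i HiF. apply filter_In in HiF. apply H1; tauto.
            - eapply cov_sub; [|exact Hc]. simpl. intros i HiF.
              apply filter_In in HiF as [? ?]. rewrite Nat.ltb_lt in *. auto. }
          assert (EF : F = G ++ concat Fs).
          { rewrite <- E. apply inc_ext; auto.
            - apply inc_app. repeat split; try (apply inc_filter; auto).
              intros x y Hx Hy. apply filter_In in Hx as [_ Hx], Hy as [_ Hy].
              rewrite Nat.ltb_lt in Hx. rewrite Nat.leb_le in Hy. lia.
            - intros x. unfold G. rewrite in_app_iff, !filter_In, Nat.ltb_lt, Nat.leb_le.
              destruct (Nat.lt_ge_cases x cut); tauto. }
          destruct G as [|g G].
          * exists Fs. repeat split; auto.
          * exists ((g :: G) :: Fs). simpl length. repeat split; auto; try lia.
            constructor; auto. split; [congruence|auto]. }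
    destruct HF as (Fs & -> & Hl & HFs). destruct Fs as [|G Fs]; [left; auto|].
    apply Schreier_S; auto. etransitivity; [exact Hl|]. apply Hd. apply hd_In.
    apply concat_nonempty; [congruence|]. eapply Forall_impl; [|exact HFs]. simpl; tauto.
Qed.

(** The counterpart of [Schreier_compose] for [cov]: a point of [P] belongs to the cell of the
    largest element of [ms] not above it, and every cell has complexity [g]. Cutting at the head of
    the next group of [ms] separates the groups. *)
Lemma cov_compose n g ms (P : nat -> Prop) B :
  Schreier n ms -> ms <> [] -> (forall i, P i -> (hd 0 ms <= i <= B)%nat) ->
  (forall mu, In mu ms -> cov g (fun i => P i /\ (mu <= i)%nat /\
      forall mu', In mu' ms -> (mu' <= i)%nat -> (mu' <= mu)%nat)) ->
  cov (n + g) P.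
Proof.
  revert ms P. induction n as [|n IH]; intros ms P HS Hne HP H.
  - destruct HS as [->|(j & _ & ->)]; [congruence|]. simpl.
    eapply cov_sub; [|apply (H j); simpl; auto]. simpl. intros i Hi.
    specialize (HP i Hi). simpl in HP. split; [auto|]. split; [tauto|]. intros mu' [<-|[]]; lia.
  - apply Schreier_S_inv in HS as (Fs & HFs & -> & HF & Hi & Hl); auto.
    exists (length Fs). split; [intros i HPi; apply HP in HPi; lia|].
    clear Hl Hne. revert P HP H.
    induction Fs as [|F1 Fs IHF]; [congruence|]. intros P HP H.
    apply Forall_cons_iff in HF as [[HF1 HS1] HF]. simpl in Hi.
    apply inc_app in Hi as (Hi1 & Hi2 & Hlt).
    destruct Fs as [|F2 Fs].
    + exists (S B). split.
      * apply (IH F1); auto.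
        -- intros i [HPi _]. specialize (HP i HPi). simpl in HP. rewrite app_nil_r in HP. auto.
        -- intros mu Hmu. eapply cov_sub; [|apply (H mu)]; simpl; rewrite app_nil_r; auto. tauto.
      * simpl. intros i [HPi Hb]. apply HP in HPi. lia.
    + assert (Hn2 : F2 <> []) by (apply Forall_inv in HF; tauto).
      assert (Hh2 : hd 0%nat (concat (F2 :: Fs)) = hd 0%nat F2) by (apply hd_concat; auto).
      assert (Hin2 : In (hd 0%nat F2) (concat (F2 :: Fs))).
      { rewrite <- Hh2. apply hd_In. simpl. destruct F2; simpl; congruence. }
      exists (hd 0%nat F2). split.
      * apply (IH F1); auto.
        -- intros i [HPi _]. specialize (HP i HPi). rewrite hd_concat in HP; auto.
        (* Below the head of the next group no later minimum competes, so the cell formed within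
           [F1] is the cell formed within the whole list. *)
        -- intros mu Hmu. eapply cov_sub; [|apply (H mu)]; [|simpl; apply in_or_app; auto].
           intros i ((HPi & Hlt2) & Hmi & Hlast). repeat split; auto.
           intros mu' Hmu' Hle. change (In mu' (F1 ++ concat (F2 :: Fs))) in Hmu'.
           apply in_app_or in Hmu' as [Hmu'|Hmu']; auto.
           apply inc_hd_le in Hmu'; auto. rewrite Hh2 in Hmu'. lia.
      * apply IHF; auto; [congruence| |].
        -- intros i [HPi Hc]. rewrite Hh2. split; auto. apply HP in HPi. lia.
        -- intros mu Hmu. eapply cov_sub; [|apply (H mu)]; [|simpl; apply in_or_app; auto].
           intros i ((HPi & Hlt2) & Hmi & Hlast). repeat split; auto.
           intros mu' Hmu' Hle. change (In mu' (F1 ++ concat (F2 :: Fs))) in Hmu'.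
           apply in_app_or in Hmu' as [Hmu'|Hmu']; auto.
           specialize (Hlt mu' mu Hmu' Hmu). lia.
Qed.

Lemma Schreier_le k k' F : (k <= k')%nat -> Schreier k F -> Schreier k' F.
Proof.
  intros Hk HS. induction Hk as [|k' _ IH]; auto.
  destruct F as [|a F]; [apply Schreier_nil|].
  assert (E : a :: F = concat [a :: F]) by (simpl; rewrite app_nil_r; auto).
  rewrite E. apply Schreier_S.
  - constructor; auto. split; [congruence|auto].
  - rewrite <- E. eapply Schreier_inc; eauto.
  - rewrite <- E. simpl. eapply Schreier_ge1; eauto. simpl; auto.
Qed.

(** * Sums and repeated averages *)

Lemma rpow_abs_0 e : rpow_abs 0 e = 0.
Proof. unfold rpow_abs. destruct (Req_EM_T 0 0); [auto|lra]. Qed.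

Lemma rpow_abs_pos x e : x <> 0 -> 0 < rpow_abs x e.
Proof. intros H. unfold rpow_abs. destruct (Req_EM_T x 0); [lra|]. apply exp_pos. Qed.

Lemma rpow_abs_ge0 x e : 0 <= rpow_abs x e.
Proof. unfold rpow_abs. destruct (Req_EM_T x 0); [lra|]. left; apply exp_pos. Qed.

Lemma rpow_abs_Rabs x e : rpow_abs (Rabs x) e = rpow_abs x e.
Proof.
  unfold rpow_abs. destruct (Req_EM_T x 0) as [->|H].
  - rewrite Rabs_R0. destruct (Req_EM_T 0 0); lra.
  - destruct (Req_EM_T (Rabs x) 0) as [H'|H']; [apply Rabs_no_R0 in H; lra|].
    rewrite Rabs_Rabsolu. auto.
Qed.

Lemma rpow_abs_mult x y e : rpow_abs (x * y) e = rpow_abs x e * rpow_abs y e.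
Proof.
  destruct (Req_dec x 0) as [->|Hx]; [rewrite Rmult_0_l, rpow_abs_0; ring|].
  destruct (Req_dec y 0) as [->|Hy]; [rewrite Rmult_0_r, rpow_abs_0; ring|].
  unfold rpow_abs. destruct (Req_EM_T x 0), (Req_EM_T y 0), (Req_EM_T (x*y) 0) as [H|H]; try lra.
  - apply Rmult_integral in H; lra.
  - rewrite Rabs_mult. symmetry. apply Rpower_mult_distr; apply Rabs_pos_lt; auto.
Qed.

Lemma rpow_abs_le x y e : 0 <= e -> Rabs x <= Rabs y -> rpow_abs x e <= rpow_abs y e.
Proof.
  intros He H. destruct (Req_dec x 0) as [->|Hx]; [rewrite rpow_abs_0; apply rpow_abs_ge0|].
  assert (Hy : y <> 0).
  { intros ->. rewrite Rabs_R0 in H. apply Rabs_pos_lt in Hx. lra. }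
  unfold rpow_abs. destruct (Req_EM_T x 0), (Req_EM_T y 0); try lra.
  apply Rle_Rpower_l; auto. split; auto. apply Rabs_pos_lt; auto.
Qed.

Lemma rpow_abs_rpow_abs x a b : rpow_abs (rpow_abs x a) b = rpow_abs x (a * b).
Proof.
  destruct (Req_dec x 0) as [->|Hx]; [rewrite !rpow_abs_0; auto|].
  assert (Hp := rpow_abs_pos x a Hx). unfold rpow_abs at 1.
  destruct (Req_EM_T (rpow_abs x a) 0); [lra|]. rewrite Rabs_pos_eq; [|lra].
  unfold rpow_abs. destruct (Req_EM_T x 0); [lra|]. apply Rpower_mult.
Qed.

Lemma rpow_abs_plus x a b : rpow_abs x a * rpow_abs x b = rpow_abs x (a + b).
Proof.
  unfold rpow_abs. destruct (Req_EM_T x 0); [ring|]. symmetry. apply Rpower_plus.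
Qed.

Lemma rpow_abs_1 x : rpow_abs x 1 = Rabs x.
Proof.
  unfold rpow_abs. destruct (Req_EM_T x 0) as [->|H]; [rewrite Rabs_R0; auto|].
  apply Rpower_1. apply Rabs_pos_lt; auto.
Qed.

Lemma rpow_abs_one e : rpow_abs 1 e = 1.
Proof.
  unfold rpow_abs. destruct (Req_EM_T 1 0); [lra|]. rewrite Rabs_R1.
  unfold Rpower. rewrite ln_1, Rmult_0_r, exp_0. auto.
Qed.

(** The factors 1/q and 1/p are given up: with [A] and [B] the two terms on the right, [x] and [y]
    are bounded by powers of [A + B] whose exponents add up to 1, so monotonicity of powers is
    enough. *)
Lemma young p q x y : 1 < p -> 1 < q -> 1 / p + 1 / q = 1 -> 0 <= x -> 0 <= y ->
  x * y <= rpow_abs x q + rpow_abs y p.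
Proof.
  intros Hp Hq Hpq Hx Hy.
  assert (HA := rpow_abs_ge0 x q). assert (HB := rpow_abs_ge0 y p).
  set (A := rpow_abs x q) in *. set (B := rpow_abs y p) in *.
  assert (EA : rpow_abs A (1 / q) = x).
  { unfold A. rewrite rpow_abs_rpow_abs. replace (q * (1 / q)) with 1 by (field; lra).
    rewrite rpow_abs_1, Rabs_pos_eq; auto. }
  assert (EB : rpow_abs B (1 / p) = y).
  { unfold B. rewrite rpow_abs_rpow_abs. replace (p * (1 / p)) with 1 by (field; lra).
    rewrite rpow_abs_1, Rabs_pos_eq; auto. }
  assert (Hip : 0 <= 1 / p) by (apply Rlt_le, Rdiv_lt_0_compat; lra).
  assert (Hiq : 0 <= 1 / q) by (apply Rlt_le, Rdiv_lt_0_compat; lra).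
  assert (H1 : x <= rpow_abs (A + B) (1 / q)).
  { rewrite <- EA at 1. apply rpow_abs_le; auto. rewrite !Rabs_pos_eq; lra. }
  assert (H2 : y <= rpow_abs (A + B) (1 / p)).
  { rewrite <- EB at 1. apply rpow_abs_le; auto. rewrite !Rabs_pos_eq; lra. }
  assert (E : rpow_abs (A + B) (1 / q) * rpow_abs (A + B) (1 / p) = A + B).
  { rewrite rpow_abs_plus. replace (1 / q + 1 / p) with 1 by lra. rewrite rpow_abs_1, Rabs_pos_eq; lra. }
  rewrite <- E. apply Rmult_le_compat; auto.
Qed.

(** * Finite sums over lists *)

Definition sumL {A} (f : A -> R) (l : list A) : R := fold_right (fun k acc => f k + acc) 0 l.

Lemma sumL_1 {A} (f : A -> R) k : sumL f [k] = f k.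
Proof. unfold sumL; simpl; ring. Qed.

Lemma sumL_app {A} (f : A -> R) l l' : sumL f (l ++ l') = sumL f l + sumL f l'.
Proof. induction l; simpl; lra. Qed.

Lemma sumL_le {A} (f g : A -> R) l : (forall k, In k l -> f k <= g k) -> sumL f l <= sumL g l.
Proof.
  induction l as [|a l IH]; simpl; intros H; [lra|].
  assert (f a <= g a) by auto. assert (sumL f l <= sumL g l) by auto. lra.
Qed.

Lemma sumL_ext {A} (f g : A -> R) l : (forall k, In k l -> f k = g k) -> sumL f l = sumL g l.
Proof. induction l as [|a l IH]; simpl; intros H; auto. rewrite H, IH; auto. Qed.

Lemma sumL_scal {A} c (f : A -> R) l : sumL (fun k => c * f k) l = c * sumL f l.
Proof. induction l; simpl; [ring|]. rewrite IHl. ring. Qed.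

Lemma sumL_plus {A} (f g : A -> R) l : sumL (fun k => f k + g k) l = sumL f l + sumL g l.
Proof. induction l; simpl; [ring|]. rewrite IHl. ring. Qed.

Lemma sumL_ge0 {A} (f : A -> R) l : (forall k, In k l -> 0 <= f k) -> 0 <= sumL f l.
Proof.
  induction l as [|a l IH]; simpl; intros H; [lra|].
  assert (0 <= f a) by auto. assert (0 <= sumL f l) by auto. lra.
Qed.

Lemma sumL_const {A} (f : A -> R) c l : (forall k, In k l -> f k <= c) ->
  sumL f l <= INR (length l) * c.
Proof.
  induction l as [|a l IH]; [simpl; lra|]. intros H. change (length (a :: l)) with (S (length l)).
  rewrite S_INR. simpl sumL. assert (f a <= c) by (apply H; simpl; auto).
  assert (sumL f l <= INR (length l) * c) by (apply IH; intros; apply H; simpl; auto). lra.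
Qed.

Lemma sumL_filter {A} (b : A -> bool) (f : A -> R) l :
  sumL f l = sumL f (filter b l) + sumL f (filter (fun k => negb (b k)) l).
Proof. induction l as [|a l IH]; simpl; [ring|]. destruct (b a); simpl; rewrite IH; ring. Qed.

Lemma sumL_swap {A B} (f : A -> B -> R) l l' :
  sumL (fun a => sumL (f a) l') l = sumL (fun b => sumL (fun a => f a b) l) l'.
Proof.
  induction l as [|a l IH]; simpl.
  - induction l'; simpl; lra.
  - rewrite IH, <- sumL_plus. auto.
Qed.

Lemma sumL_zero {A} (f : A -> R) l : (forall k, In k l -> f k = 0) -> sumL f l = 0.
Proof. induction l as [|a l IH]; simpl; intros H; auto. rewrite H, IH; auto; lra. Qed.

Lemma sumL_subset (u : nat -> R) G F :
  NoDup G -> (forall i, 0 <= u i) -> (forall i, In i G -> u i <> 0 -> In i F) ->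
  sumL u G <= sumL u F.
Proof.
  revert F. induction G as [|a G IH]; intros F HG Hu Hs.
  - apply sumL_ge0; auto.
  - apply NoDup_cons_iff in HG as [Ha HG]. simpl.
    destruct (Req_dec (u a) 0) as [E|E].
    + rewrite E, Rplus_0_l. apply IH; auto. intros; apply Hs; simpl; auto.
    + assert (HaF : In a F) by (apply Hs; simpl; auto).
      apply in_split in HaF as (F1 & F2 & ->).
      assert (sumL u G <= sumL u (F1 ++ F2)).
      { apply IH; auto. intros i Hi Hui. assert (HiF : In i (F1 ++ a :: F2)) by (apply Hs; simpl; auto).
        apply in_app_or in HiF. apply in_or_app. simpl in HiF.
        destruct HiF as [|[<-|]]; tauto. }
      rewrite sumL_app in *. simpl. lra.
Qed.

Lemma sum_f_R0_sumL f N : sum_f_R0 f N = sumL f (seq 0 (S N)).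
Proof.
  induction N as [|N IH]; [simpl; ring|].
  rewrite seq_S, sumL_app, <- IH. simpl. ring.
Qed.

(** * Mass of sets and repeated averages *)

Lemma meets_dec (F G : list nat) :
  (exists i, In i G /\ In i F) \/ (forall i, In i G -> ~ In i F).
Proof.
  induction G as [|a G IH]; [right; simpl; tauto|].
  destruct (in_dec Nat.eq_dec a F) as [H|H]; [left; exists a; simpl; auto|].
  destruct IH as [(i & Hi)|IH]; [left; exists i; simpl; tauto|].
  right. intros i [<-|Hi]; auto.
Qed.

(** Mass is tested on finite lists without repetition, as [P] may be infinite. *)
Definition mass_le (u : nat -> R) (P : nat -> Prop) (b : R) : Prop :=
  forall G, NoDup G -> (forall i, In i G -> P i) -> sumL u G <= b.

Lemma mass_succU k u b d P :
  (forall P', cov k P' -> mass_le u P' b) -> succU (cov k) d P -> mass_le u P (INR d * b).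
Proof.
  intros H. revert P. induction d as [|d IH]; intros P HP G HG HGP.
  - destruct G as [|i G]; [simpl; lra|]. exfalso. apply (HP i), HGP; simpl; auto.
  - destruct HP as (cut & H1 & H2).
    rewrite (sumL_filter (fun i => i <? cut)%nat), S_INR.
    assert (sumL u (filter (fun i => i <? cut)%nat G) <= b).
    { apply (H _ H1); [apply NoDup_filter; auto|]. intros i Hi. apply filter_In in Hi as [Hi Hc].
      apply Nat.ltb_lt in Hc. auto. }
    assert (sumL u (filter (fun k0 => negb (k0 <? cut)%nat) G) <= INR d * b).
    { apply (IH _ H2); [apply NoDup_filter; auto|]. intros i Hi. apply filter_In in Hi as [Hi Hc].
      apply Bool.negb_true_iff, Nat.ltb_ge in Hc. auto. }
    lra.
Qed.

Definition small_on_lower (k : nat) (eps : R) (u : nat -> R) : Prop :=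
  match k with O => True | S k' => forall P, cov k' P -> mass_le u P eps end.

Lemma NoDup_const (G : list nat) j : NoDup G -> (forall i, In i G -> i = j) -> G = [] \/ G = [j].
Proof.
  intros H Hj. destruct G as [|a [|b G]]; auto.
  - right. rewrite (Hj a); simpl; auto.
  - exfalso. apply NoDup_cons_iff in H as [H _]. apply H.
    rewrite (Hj a), (Hj b); simpl; auto.
Qed.

(* Each block is chosen after the previous one, with smallness relative to the maximum of its
   predecessor: a set of cov (S k) meeting an earlier block has at most that many pieces. *)
Lemma averages_blocks k :
  (forall N0 eps, 0 < eps -> exists F u, Schreier k F /\ F <> [] /\
     (forall i, In i F -> (N0 <= i)%nat) /\ (forall i, 0 <= u i) /\
     (forall i, u i <> 0 <-> In i F) /\ sumL u F = 1 /\ small_on_lower k eps u) ->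
  forall N N0 delta, 0 < delta -> exists Fs U,
     length Fs = N /\ Forall (fun F => F <> [] /\ Schreier k F) Fs /\ inc (concat Fs) /\
     (forall i, In i (concat Fs) -> (N0 <= i)%nat) /\ (forall i, 0 <= U i) /\
     (forall i, U i <> 0 <-> In i (concat Fs)) /\ sumL U (concat Fs) = INR N /\
     small_on_lower k (INR N * delta) U /\ (forall P, cov k P -> mass_le U P 2).
Proof.
  intros Hk. induction N as [|N IH]; intros N0 delta Hd.
  - exists [], (fun _ => 0). simpl.
    assert (Z : forall P b, 0 <= b -> mass_le (fun _ => 0) P b).
    { intros P b Hb G _ _. rewrite sumL_zero; auto. }
    split; auto. split; [constructor|]. split; [constructor|]. split; [tauto|].
    split; [intros; lra|]. split; [intros; lra|]. split; auto. split.
    + destruct k; simpl; auto. intros. apply Z; lra.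
    + intros. apply Z. lra.
  - destruct (Hk N0 delta Hd) as (F & u & HF & HFn & HF0 & Hu0 & Hus & Hu1 & Husm).
    set (M := last F 0%nat).
    assert (HFM : forall i, In i F -> (i <= M)%nat).
    { intros; apply inc_le_last; auto. eapply Schreier_inc; eauto. }
    assert (HN1 : 0 < INR (S N)) by (apply lt_0_INR; lia).
    assert (HM1 : 0 < INR (S M)) by (apply lt_0_INR; lia).
    (* A set of complexity [k] meeting the current block has at most [M] pieces of lower complexity,
       each taking at most [INR N * d'] from the later blocks. The second term of the minimum keeps
       the total at most 1. *)
    set (d' := Rmin delta (1 / (INR (S M) * INR (S N)))).
    assert (Hd'0 : 0 < d').
    { apply Rmin_glb_lt; auto. apply Rdiv_lt_0_compat; [lra|nra]. }
    assert (Hd'1 : d' <= delta) by apply Rmin_l.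
    assert (Hd'2 : d' * (INR (S M) * INR (S N)) <= 1).
    { assert (d' <= 1 / (INR (S M) * INR (S N))) by apply Rmin_r.
      assert (0 < INR (S M) * INR (S N)) by nra.
      replace 1 with (1 / (INR (S M) * INR (S N)) * (INR (S M) * INR (S N))) by (field; lra).
      apply Rmult_le_compat_r; lra. }
    destruct (IH (S (M + N0)) d' Hd'0) as (Fs & U & Hl & HFs & Hi & Hge & HU0 & HUs & HUsum & HUsm & HU2).
    assert (Hu1' : forall G, NoDup G -> sumL u G <= 1).
    { intros G HG. rewrite <- Hu1. apply sumL_subset; auto. intros i _. apply Hus. }
    assert (HUoff : forall i, In i F -> U i = 0).
    { intros i HiF. destruct (Req_dec (U i) 0) as [|E]; auto. apply HUs, Hge in E.
      apply HFM in HiF. lia. }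
    assert (Huoff : forall i, In i (concat Fs) -> u i = 0).
    { intros i HiF. destruct (Req_dec (u i) 0) as [|E]; auto. apply Hus, HFM in E.
      apply Hge in HiF. lia. }
    exists (F :: Fs), (fun i => u i + U i). cbn [length concat].
    split; [auto|]. split; [constructor; auto|]. split; [|split; [|split; [|split; [|split; [|split]]]]].
    + apply inc_app. repeat split; auto; [eapply Schreier_inc; eauto|].
      intros x y Hx Hy. apply HFM in Hx. apply Hge in Hy. lia.
    + intros i Hi'. apply in_app_or in Hi' as [Hi'|Hi']; auto. apply Hge in Hi'. lia.
    + intros i. specialize (Hu0 i). specialize (HU0 i). lra.
    + intros i. rewrite in_app_iff, <- Hus, <- HUs. specialize (Hu0 i). specialize (HU0 i). 
      destruct (Req_dec (u i) 0), (Req_dec (U i) 0); split; intros; try tauto; lra.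
    + rewrite sumL_app, !sumL_plus, HUsum, Hu1.
      rewrite (sumL_zero U F), (sumL_zero u (concat Fs)); auto.
      rewrite S_INR. lra.
    + destruct k as [|k]; cbn [small_on_lower]; auto. intros P HP G HG HGP. rewrite sumL_plus, S_INR.
      assert (sumL u G <= delta) by (apply (Husm P); auto).
      assert (sumL U G <= INR N * d') by (apply (HUsm P); auto).
      assert (INR N * d' <= INR N * delta) by (apply Rmult_le_compat_l; auto; apply pos_INR). lra.
    + intros P HP G HG HGP. rewrite sumL_plus.
      (* If [G] meets the current block, that block gives at most 1 and the later ones together at
         most 1; otherwise the induction hypothesis applies unchanged. *)
      destruct (meets_dec F G) as [(i & HiG & HiF)|Hno].
      * assert (sumL u G <= 1) by auto.
        assert (sumL U G <= 1); [|lra].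
        destruct k as [|k].
        -- destruct HP as (j & Hj). assert (HGj : G = [] \/ G = [j]) by (apply NoDup_const; auto).
           destruct HGj as [-> | ->]; simpl; [lra|].
           destruct HiG as [<-|[]]. rewrite (HUoff j); auto; lra.
        -- destruct HP as (d & Hd2 & HP).
           assert (Hx : sumL U G <= INR d * (INR N * d')).
           { apply (mass_succU k U (INR N * d') d P); auto. }
           assert (INR d <= INR (S M)).
           { apply le_INR. specialize (Hd2 i (HGP i HiG)). apply HFM in HiF. lia. }
           assert (INR N <= INR (S N)) by (apply le_INR; lia).
           assert (0 <= INR N) by apply pos_INR. assert (0 <= INR d) by apply pos_INR.
           assert (INR d * (INR N * d') <= INR (S M) * (INR (S N) * d')).
           { apply Rmult_le_compat; auto; try nra. }
           lra.
      * rewrite (sumL_zero u G).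
        -- specialize (HU2 P HP G HG HGP). lra.
        -- intros i HiG. destruct (Req_dec (u i) 0) as [|E]; auto. apply Hus in E. exfalso; eapply Hno; eauto.
Qed.

(** At level [S k], average [N] successive averages of level [k]: a set of complexity [k] carries
    mass at most 2 out of [N], a share below [eps] once [N > 2 / eps]. *)
Lemma averages k N0 eps : 0 < eps -> exists F u, Schreier k F /\ F <> [] /\
     (forall i, In i F -> (N0 <= i)%nat) /\ (forall i, 0 <= u i) /\
     (forall i, u i <> 0 <-> In i F) /\ sumL u F = 1 /\ small_on_lower k eps u.
Proof.
  revert N0 eps. induction k as [|k IH]; intros N0 eps He.
  - exists [S N0], (unitv (S N0)). unfold unitv. simpl.
    assert (E : forall i, (i =? S N0)%nat = true <-> i = S N0) by (intros; apply Nat.eqb_eq).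
    repeat split; auto; try congruence.
    + right. exists (S N0). split; auto. lia.
    + intros i [<-|[]]; lia.
    + intros i. destruct (i =? S N0)%nat; lra.
    + intros H. destruct (i =? S N0)%nat eqn:Ei; [apply E in Ei; auto|lra].
    + intros [<-|[]]. rewrite Nat.eqb_refl. lra.
    + rewrite Nat.eqb_refl. lra.
  - destruct (INR_unbounded (2 / eps)) as [N HN].
    assert (HN0 : 0 < INR N). { assert (0 < 2 / eps) by (apply Rdiv_lt_0_compat; lra). lra. }
    (* Starting beyond [N] as well as [N0] lets the [N] blocks form one set of the next Schreier
       family. *)
    destruct (averages_blocks k IH N (N + N0) 1) as (Fs & U & Hl & HFs & Hi & Hge & HU0 & HUs & HUsum & HUsm & HU2); [lra|].
    assert (HiN : 0 < / INR N) by (apply Rinv_0_lt_compat; auto).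
    assert (Hne : concat Fs <> []).
    { destruct Fs as [|G Fs]; [simpl in Hl; subst N; simpl in HN0; lra|].
      apply concat_nonempty; [congruence|]. eapply Forall_impl; [|exact HFs]. simpl; tauto. }
    exists (concat Fs), (fun i => / INR N * U i).
    repeat split; auto.
    + apply Schreier_S; auto. rewrite Hl. apply hd_In, Hge in Hne. lia.
    + intros i Hi'. apply Hge in Hi'. lia.
    + intros i. specialize (HU0 i). nra.
    + intros H. apply HUs. intros E. rewrite E in H. lra.
    + intros H. apply HUs in H. intros E. apply Rmult_integral in E. lra.
    + rewrite sumL_scal, HUsum. field. lra.
    + simpl. intros P HP G HG HGP. rewrite sumL_scal. specialize (HU2 P HP G HG HGP).
      apply Rle_trans with (/ INR N * 2); [nra|].
      apply Rmult_le_reg_l with (INR N); auto. rewrite <- Rmult_assoc, Rinv_r; [|lra].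
      assert (2 / eps * eps = 2) by (field; lra). nra.
Qed.

(** * The space, its operators, and strict singularity *)

Lemma choice_fun {A B} (R0 : A -> B -> Prop) : (forall x, exists y, R0 x y) -> exists f, forall x, R0 x (f x).
Proof.
  intros H. exists (fun x => proj1_sig (constructive_indefinite_description _ (H x))).
  intros x. destruct (constructive_indefinite_description _ (H x)). auto.
Qed.

Lemma list_bound (f : nat -> nat) ks : exists L, forall k, In k ks -> (f k <= L)%nat.
Proof.
  induction ks as [|k ks [L IH]]; [exists 0%nat; simpl; tauto|]. exists (Nat.max (f k) L).
  intros k' [<-|Hk']; [lia|]. apply IH in Hk'. lia.
Qed.

Lemma pair_sumL K f x : pair K f x = sumL (fun i => f i * x i) (seq 0 (S K)).
Proof. apply sum_f_R0_sumL. Qed.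

Lemma pair_supp K K' f x : supp_le f K -> (K <= K')%nat -> pair K' f x = pair K f x.
Proof.
  intros Hf HK. induction HK as [|K' HK IH]; auto. unfold pair in *. simpl. rewrite IH, Hf; [ring|lia].
Qed.

(* As a class, the norming hypothesis of the next section is filled in by instance resolution
   wherever its lemmas are applied. *)
Existing Class norming.

Section Norm.
Context {Nn : vec -> Prop} {HNn : norming Nn}.

Lemma nbound_ext v w c : (forall i, v i = w i) -> nbound Nn v c -> nbound Nn w c.
Proof.
  intros E H f L Hf HL. rewrite pair_sumL. rewrite (sumL_ext _ (fun i => f i * v i)).
  - rewrite <- pair_sumL. apply H; auto.
  - intros. rewrite E. auto.
Qed.

Lemma nbound_add v w c d : nbound Nn v c -> nbound Nn w d -> nbound Nn (vadd v w) (c + d).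
Proof.
  intros Hv Hw f L Hf HL. specialize (Hv f L Hf HL). specialize (Hw f L Hf HL).
  rewrite pair_sumL in *. rewrite (sumL_ext _ (fun i => f i * v i + f i * w i)); [|intros; unfold vadd; ring].
  rewrite sumL_plus. lra.
Qed.

Lemma pair_scale r L f v : pair L f (vscale r v) = r * pair L f v.
Proof.
  rewrite !pair_sumL, <- sumL_scal. apply sumL_ext. intros; unfold vscale; ring.
Qed.

Lemma pair_opp L f v : pair L (vscale (-1) f) v = - pair L f v.
Proof.
  rewrite !pair_sumL. rewrite (sumL_ext _ (fun i => -1 * (f i * v i))); [rewrite sumL_scal; ring|].
  intros; unfold vscale; ring.
Qed.

Lemma pair_abs_le L f v c : Nn f -> supp_le f L -> nbound Nn v c -> Rabs (pair L f v) <= c.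
Proof.
  intros Hf HL Hv. apply Rabs_le. split; [|apply Hv; auto].
  assert (H : pair L (vscale (-1) f) v <= c).
  { apply Hv; [apply HNn; auto|]. intros i Hi. unfold vscale. rewrite HL; auto. ring. }
  rewrite pair_opp in H. lra.
Qed.

Lemma nbound_scale r v c : nbound Nn v c -> nbound Nn (vscale r v) (Rabs r * c).
Proof.
  intros Hv f L Hf HL. rewrite pair_scale. eapply Rle_trans; [apply Rle_abs|]. rewrite Rabs_mult.
  apply Rmult_le_compat_l; [apply Rabs_pos|]. apply pair_abs_le; auto.
Qed.

Lemma nbound_le v c d : c <= d -> nbound Nn v c -> nbound Nn v d.
Proof. intros Hcd H f L Hf HL. specialize (H f L Hf HL). lra. Qed.

Lemma nbound_sub v w c d : nbound Nn v c -> nbound Nn w d -> nbound Nn (vsub v w) (c + d).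
Proof.
  intros Hv Hw. apply (nbound_scale (-1)) in Hw. replace (Rabs (-1) * d) with d in Hw
    by (rewrite Rabs_left; lra).
  eapply nbound_ext; [|apply (nbound_add _ _ _ _ Hv Hw)]. intros i. unfold vadd, vscale, vsub. ring.
Qed.

Lemma nbound_seg v c a b : nbound Nn v c -> nbound Nn (seg a b v) c.
Proof.
  (* [seg a b] keeps the coordinates in [(a, b]], so the matching restriction of the functional
     starts at [S a]. *)
  intros H f L Hf HL. assert (H' := H (restrict (S a) b f) L).
  rewrite pair_sumL in *. rewrite (sumL_ext _ (fun i => restrict (S a) b f i * v i)).
  - apply H'; [apply HNn; auto|]. intros i Hi. unfold restrict.
    destruct (_ && _)%bool; auto.
  - intros i _. unfold seg, restrict. change (a <? i)%nat with (S a <=? i)%nat.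
    destruct (_ && _)%bool; ring.
Qed.

Lemma unitv_same i : unitv i i = 1.
Proof. unfold unitv. rewrite Nat.eqb_refl. auto. Qed.

Lemma unitv_other i j : i <> j -> unitv j i = 0.
Proof. intros H. unfold unitv. replace (i =? j)%nat with false; auto. symmetry; apply Nat.eqb_neq; auto. Qed.

Lemma pair_unitv L f j : (supp_le f L \/ (j <= L)%nat) -> pair L f (unitv j) = f j.
Proof.
  intros H. rewrite pair_sumL. destruct (Nat.le_gt_cases j L) as [Hj|Hj].
  - assert (Hin : In j (seq 0 (S L))) by (apply in_seq; lia).
    apply in_split in Hin as (l1 & l2 & E). assert (Hnd := seq_NoDup (S L) 0). rewrite E in Hnd.
    apply NoDup_remove_2 in Hnd. rewrite E, sumL_app. simpl. rewrite unitv_same, !sumL_zero; [ring| |];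
      intros i Hi; rewrite unitv_other; try ring; intros ->; apply Hnd, in_or_app; auto.
  - destruct H as [H|H]; [|lia]. rewrite (H j) by lia. apply sumL_zero. intros i Hi. apply in_seq in Hi.
    rewrite unitv_other; [ring|lia].
Qed.

Lemma pair_comm L f v : pair L f v = pair L v f.
Proof. rewrite !pair_sumL. apply sumL_ext. intros; ring. Qed.

Lemma nbound_coord v c i : (1 <= i)%nat -> nbound Nn v c -> Rabs (v i) <= c.
Proof.
  intros Hi H. rewrite <- (pair_unitv i v i) by auto. rewrite pair_comm. apply pair_abs_le; auto.
  - apply HNn; auto.
  - intros j Hj. apply unitv_other. lia.
Qed.

Lemma nbound_zero v c : 0 <= c -> (forall i, v i = 0) -> nbound Nn v c.
Proof. intros Hc E f L _ _. rewrite pair_sumL, sumL_zero; auto. intros. rewrite E. ring. Qed.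

Lemma nbound_unitv i : nbound Nn (unitv i) 1.
Proof.
  intros f L Hf HL. rewrite pair_unitv by auto. eapply Rle_trans; [apply Rle_abs|].
  apply HNn; auto.
Qed.

Lemma inX_fin v : v 0%nat = 0 -> fin_supp v -> inX Nn v.
Proof.
  intros H0 [B HBv]. split; auto. intros eps He. exists B. intros a b Ha _.
  apply nbound_zero; [lra|]. intros i. unfold seg. destruct (a <? i)%nat eqn:E; simpl; auto.
  apply Nat.ltb_lt in E. destruct (i <=? b)%nat; auto. apply HBv. lia.
Qed.

Lemma inX_add v w : inX Nn v -> inX Nn w -> inX Nn (vadd v w).
Proof.
  intros [Hv0 Hv] [Hw0 Hw]. split; [unfold vadd; rewrite Hv0, Hw0; ring|].
  intros eps He. destruct (Hv (eps / 2) ltac:(lra)) as (n1 & H1). destruct (Hw (eps / 2) ltac:(lra)) as (n2 & H2).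
  exists (Nat.max n1 n2). intros a b Ha Hb.
  replace eps with (eps / 2 + eps / 2) by lra.
  eapply nbound_ext; [|apply nbound_add; [apply (H1 a b); lia|apply (H2 a b); lia]].
  intros i. unfold vadd, seg. destruct (_ && _)%bool; ring.
Qed.

Lemma inX_scale r v : inX Nn v -> inX Nn (vscale r v).
Proof.
  intros [Hv0 Hv]. split; [unfold vscale; rewrite Hv0; ring|].
  intros eps He. assert (Hr := Rabs_pos r). assert (Hpos : 0 < eps / (Rabs r + 1)) by (apply Rdiv_lt_0_compat; lra).
  destruct (Hv _ Hpos) as (n1 & H1). exists n1. intros a b Ha Hb.
  apply (nbound_le _ (Rabs r * (eps / (Rabs r + 1)))).
  - apply Rmult_le_reg_r with (Rabs r + 1); [lra|]. 
    replace (Rabs r * (eps / (Rabs r + 1)) * (Rabs r + 1)) with (Rabs r * eps) by (field; lra). nra.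
  - eapply nbound_ext; [|apply nbound_scale, (H1 a b); auto].
    intros i. unfold vscale, seg. destruct (_ && _)%bool; ring.
Qed.

Lemma inX_coord_small v d : inX Nn v -> 0 < d -> exists n0, forall i, (n0 <= i)%nat -> Rabs (v i) <= d.
Proof.
  intros [_ H] Hd. destruct (H d Hd) as (n0 & Hn). exists (S n0). intros i Hi.
  assert (Hb := Hn (i - 1)%nat i ltac:(lia) ltac:(lia)). apply (nbound_coord _ _ i) in Hb; [|lia].
  unfold seg in Hb. replace (i - 1 <? i)%nat with true in Hb by (symmetry; apply Nat.ltb_lt; lia).
  rewrite Nat.leb_refl in Hb. auto.
Qed.

(** The images are [c] times basis vectors running off to infinity, while the members of a finite
    net have small coordinates far out. At coordinate [idx k] the net error and the net vector each
    account for at most a quarter of [|c|]. *)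
Lemma compact_diagonal K (v : nat -> vec) (idx : nat -> nat) c : compact_op Nn K ->
  (forall k, inX Nn (v k) /\ nbound Nn (v k) 1) -> (forall k, (k + 1 <= idx k)%nat) ->
  (forall k i, K (v k) i = c * unitv (idx k) i) -> c = 0.
Proof.
  intros [_ HK] Hv Hidx HKv. destruct (Req_dec c 0) as [|Hc]; auto. exfalso.
  apply Rabs_pos_lt in Hc. destruct (HK (Rabs c / 4) ltac:(lra)) as (ys & Hys & Hnet).
  assert (Hsmall : exists n0, forall y, In y ys -> forall i, (n0 <= i)%nat -> Rabs (y i) <= Rabs c / 4).
  { clear Hnet. induction Hys as [|y ys Hy _ (n1 & IH)]; [exists 0%nat; simpl; tauto|].
    destruct (inX_coord_small y (Rabs c / 4) Hy ltac:(lra)) as (n2 & Hn2).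
    exists (Nat.max n1 n2). intros y' [<-|Hy'] i Hi; [apply Hn2; lia|apply IH; auto; lia]. }
  destruct Hsmall as (n0 & Hn0). destruct (Hv n0) as [Hv1 Hv2]. destruct (Hnet (v n0) Hv1 Hv2) as (y & Hy & Hb).
  specialize (Hidx n0). apply (nbound_coord _ _ (idx n0)) in Hb; [|lia].
  unfold vsub in Hb. rewrite HKv, unitv_same, Rmult_1_r in Hb.
  specialize (Hn0 y Hy (idx n0) ltac:(lia)).
  assert (H := Rabs_triang (c - y (idx n0)) (y (idx n0))). replace (c - y (idx n0) + y (idx n0)) with c in H by ring.
  lra.
Qed.

Lemma nbound_ge0 v c : nbound Nn v c -> 0 <= c.
Proof. intros H. apply (nbound_coord _ _ 1) in H; [|lia]. assert (H0 := Rabs_pos (v 1%nat)). lra. Qed.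

Lemma nbound_vzero c : 0 <= c -> nbound Nn vzero c.
Proof. intros Hc. apply nbound_zero; auto. Qed.

Lemma vsub_add_scale v w : vsub v w = vadd v (vscale (-1) w).
Proof. apply functional_extensionality. intros i. unfold vsub, vadd, vscale. ring. Qed.

Lemma inX_sub v w : inX Nn v -> inX Nn w -> inX Nn (vsub v w).
Proof. intros Hv Hw. rewrite vsub_add_scale. apply inX_add; auto. apply inX_scale; auto. Qed.

Lemma nbound_sub_comm v w c : nbound Nn (vsub v w) c -> nbound Nn (vsub w v) c.
Proof.
  intros H. apply (nbound_scale (-1)) in H. replace (Rabs (-1) * c) with c in H by (rewrite Rabs_left; lra).
  eapply nbound_ext; [|exact H]. intros i. unfold vscale, vsub. ring.
Qed.

Lemma nbound_sub_trans u v w c d : nbound Nn (vsub u v) c -> nbound Nn (vsub v w) d -> nbound Nn (vsub u w) (c + d).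
Proof.
  intros H1 H2. eapply nbound_ext; [|apply (nbound_add _ _ _ _ H1 H2)]. intros i. unfold vadd, vsub. ring.
Qed.

(** A functional sees finitely many coordinates, each with a coefficient of modulus at most 1, so
    coordinatewise convergence carries norm bounds to the limit. *)
Lemma nbound_limit (a : nat -> vec) z w c : (forall i, Un_cv (fun k => a k i) (z i)) ->
  (exists n0, forall k, (n0 <= k)%nat -> nbound Nn (vsub (a k) w) c) -> nbound Nn (vsub z w) c.
Proof.
  intros Hz (n0 & Hn0) f L Hf HL. apply Rnot_lt_le. intros Hlt.
  set (eta := (pair L f (vsub z w) - c) / 2). assert (Heta : 0 < eta) by (unfold eta; lra).
  assert (Hd : 0 < eta / INR (S L)) by (apply Rdiv_lt_0_compat; auto; apply lt_0_INR; lia).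
  assert (HX : forall i, exists r, forall k, (r <= k)%nat -> Rabs (a k i - z i) < eta / INR (S L)).
  { intros i. destruct (Hz i _ Hd) as (r & Hr). exists r. intros k Hk. apply Hr. lia. }
  apply choice_fun in HX as (r & Hr). destruct (list_bound r (seq 0 (S L))) as (R0 & HR0).
  set (k := Nat.max n0 R0). specialize (Hn0 k ltac:(lia) f L Hf HL).
  assert (Hle : pair L f (vsub z (a k)) <= eta).
  { rewrite pair_sumL. replace eta with (INR (length (seq 0 (S L))) * (eta / INR (S L))).
    - apply sumL_const. intros i Hi. specialize (Hr i k). specialize (HR0 i Hi).
      assert (Hfi : Rabs (f i) <= 1) by (apply HNn; auto).
      assert (Rabs (a k i - z i) < eta / INR (S L)) by (apply Hr; lia).
      eapply Rle_trans; [apply Rle_abs|]. rewrite Rabs_mult. unfold vsub. rewrite Rabs_minus_sym.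
      assert (H0 := Rabs_pos (a k i - z i)). assert (H1 := Rabs_pos (f i)). nra.
    - rewrite length_seq. field. apply not_0_INR. lia. }
  assert (E : pair L f (vsub z w) = pair L f (vsub z (a k)) + pair L f (vsub (a k) w)).
  { rewrite !pair_sumL, <- sumL_plus. apply sumL_ext. intros i _. unfold vsub. ring. }
  unfold eta in *. lra.
Qed.

(** The coordinatewise limit is a norm limit by [nbound_limit]. Its own tails are small because
    those of one close [a k] are, and passing to a segment does not increase the norm. *)
Lemma inX_complete (a : nat -> vec) : (forall k, inX Nn (a k)) ->
  (forall eps, 0 < eps -> exists n0, forall k l, (n0 <= k)%nat -> (n0 <= l)%nat -> nbound Nn (vsub (a k) (a l)) eps) ->
  exists z, inX Nn z /\ forall eps, 0 < eps -> exists n0, forall k, (n0 <= k)%nat -> nbound Nn (vsub z (a k)) eps.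
Proof.
  intros Ha HC.
  assert (Hlim : forall i, exists l, Un_cv (fun k => a k i) l).
  { intros i. destruct i as [|i].
    - exists 0. intros eps He. exists 0%nat. intros k _. destruct (Ha k) as [E _]. rewrite E.
      unfold Rdist. rewrite Rminus_0_r, Rabs_R0. auto.
    - assert (Hcc : Cauchy_crit (fun k => a k (S i))).
      { intros eps He. destruct (HC (eps / 2) ltac:(lra)) as (n0 & Hn0). exists n0. intros k l Hk Hl.
        specialize (Hn0 k l Hk Hl). apply (nbound_coord _ _ (S i)) in Hn0; [|lia].
        unfold Rdist. unfold vsub in Hn0. lra. }
      destruct (R_complete _ Hcc) as (l & Hl). exists l. auto. }
  apply choice_fun in Hlim as (z & Hz). 
  assert (Hconv : forall eps, 0 < eps -> exists n0, forall k, (n0 <= k)%nat -> nbound Nn (vsub z (a k)) eps).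
  { intros eps He. destruct (HC eps He) as (n0 & Hn0). exists n0. intros k Hk.
    apply (nbound_limit a); auto. exists n0. intros l Hl. apply Hn0; auto. }
  exists z. split; auto. split.
  - apply (UL_sequence (fun k => a k 0%nat)); auto. intros eps He. exists 0%nat. intros k _.
    destruct (Ha k) as [E _]. rewrite E. unfold Rdist. rewrite Rminus_0_r, Rabs_R0. auto.
  - intros eps He. destruct (Hconv (eps / 2) ltac:(lra)) as (k & Hk). specialize (Hk k (Nat.le_refl k)).
    destruct (Ha k) as [_ Hak]. destruct (Hak (eps / 2) ltac:(lra)) as (n0 & Hn0). exists n0. intros l r Hl Hr.
    replace eps with (eps / 2 + eps / 2) by lra.
    eapply nbound_ext; [|apply nbound_add; [apply (nbound_seg _ _ l r Hk)|apply (Hn0 l r); auto]].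
    intros i. unfold vadd, seg, vsub. destruct (_ && _)%bool; ring.
Qed.

(** * Infinite-dimensional subspaces, closures, kernels and direct sums *)

Lemma inf_dim_mono (Y Y' : vec -> Prop) : (forall a, Y a -> Y' a) -> inf_dim Y -> inf_dim Y'.
Proof.
  intros H HY d. destruct (HY d) as (vs & Hl & HF & Hi). exists vs. split; auto. split; auto.
  eapply Forall_impl; [|exact HF]. auto.
Qed.

Lemma inf_dim_unitv (Y : vec -> Prop) (idx : nat -> nat) : (forall k l, idx k = idx l -> k = l) ->
  (forall k, Y (unitv (idx k))) -> inf_dim Y.
Proof.
  intros Hinj HY d. exists (map (fun k => unitv (idx k)) (seq 0 d)).
  split; [rewrite length_map, length_seq; auto|]. split.
  - apply Forall_forall. intros v Hv. apply in_map_iff in Hv as (k & <- & _). auto.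
  - intros cs Hl H0. rewrite length_map in Hl.
    assert (Hnd := seq_NoDup d 0). revert cs Hl H0. 
    generalize dependent (seq 0 d). intros ks Hnd. 
    assert (Z : forall k ls cs, ~ In k ls -> lc cs (map (fun k => unitv (idx k)) ls) (idx k) = 0).
    { intros k ls. induction ls as [|l ls IH]; intros [|c cs] Hk; simpl; auto.
      rewrite IH by (intros H; apply Hk; simpl; auto).
      rewrite unitv_other; [ring|]. intros E. apply Hinj in E. apply Hk. simpl; auto. }
    intros cs Hl H0. assert (H1 : forall k, In k ks -> lc cs (map (fun k => unitv (idx k)) ks) (idx k) = 0) by auto.
    clear H0. revert cs Hl H1. induction ks as [|k ks IH]; intros [|c cs] Hl H1; try discriminate; constructor.
    + specialize (H1 k (or_introl eq_refl)). apply NoDup_cons_iff in Hnd as [Hk _].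
      simpl in H1. rewrite Z, unitv_same in H1; auto. lra.
    + apply NoDup_cons_iff in Hnd as [Hk Hnd]. apply IH; auto.
      intros l Hl'. specialize (H1 l (or_intror Hl')). simpl in H1.
      rewrite unitv_other in H1; [lra|]. intros E. apply Hinj in E. subst. auto.
Qed.

(** Hereditary indecomposability concerns closed subspaces and strict singularity arbitrary ones;
    the closure mediates between them. *)
Definition closure_of (Y : vec -> Prop) (a : vec) : Prop :=
  inX Nn a /\ forall eps, 0 < eps -> exists y, Y y /\ nbound Nn (vsub a y) eps.

Lemma subset_closure_of Y a : subspace Nn Y -> Y a -> closure_of Y a.
Proof.
  intros HY Ha. split; [apply HY; auto|]. intros eps He. exists a. split; auto.
  apply nbound_zero; [lra|]. intros i. unfold vsub. ring.
Qed.

Lemma closure_of_closed Y : subspace Nn Y -> closed_sub Nn (closure_of Y).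
Proof.
  intros (HX & H0 & Hadd & Hsc). split; [split; [|split; [|split]]|].
  - intros a [Ha _]. auto.
  - apply subset_closure_of; auto. exact (conj HX (conj H0 (conj Hadd Hsc))).
  - intros a b [Ha Ha'] [Hb Hb']. split; [apply inX_add; auto|]. intros eps He.
    destruct (Ha' (eps / 2) ltac:(lra)) as (y1 & Hy1 & H1). destruct (Hb' (eps / 2) ltac:(lra)) as (y2 & Hy2 & H2).
    exists (vadd y1 y2). split; auto. replace eps with (eps / 2 + eps / 2) by lra.
    eapply nbound_ext; [|apply (nbound_add _ _ _ _ H1 H2)]. intros i. unfold vadd, vsub. ring.
  - intros r a [Ha Ha']. split; [apply inX_scale; auto|]. intros eps He. assert (Hr := Rabs_pos r).
    destruct (Ha' (eps / (Rabs r + 1)) ltac:(apply Rdiv_lt_0_compat; lra)) as (y & Hy & H1).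
    exists (vscale r y). split; auto. apply (nbound_le _ (Rabs r * (eps / (Rabs r + 1)))).
    + apply Rmult_le_reg_r with (Rabs r + 1); [lra|].
      replace (Rabs r * (eps / (Rabs r + 1)) * (Rabs r + 1)) with (Rabs r * eps) by (field; lra). nra.
    + eapply nbound_ext; [|apply (nbound_scale r _ _ H1)]. intros i. unfold vscale, vsub. ring.
  - intros a Ha Hc. split; auto. intros eps He.
    destruct (Hc (eps / 2) ltac:(lra)) as (b & [_ Hb] & H1). destruct (Hb (eps / 2) ltac:(lra)) as (y & Hy & H2).
    exists y. split; auto. replace eps with (eps / 2 + eps / 2) by lra. eapply nbound_sub_trans; eauto.
Qed.

Section Operator.
Context (T : vec -> vec) (HT : is_op Nn T).

Definition kernel (a : vec) : Prop := inX Nn a /\ forall i, T a i = 0.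

Lemma op_bounded : exists C, 0 < C /\ forall a c, inX Nn a -> nbound Nn a c -> nbound Nn (T a) (C * c).
Proof.
  destruct HT as (_ & _ & _ & C & HC). exists (Rabs C + 1). assert (H0 := Rabs_pos C). split; [lra|].
  intros a c Ha Hc. apply (nbound_le _ (C * c)); [|apply HC; auto].
  assert (Hc0 := nbound_ge0 _ _ Hc). assert (H1 := Rle_abs C). nra.
Qed.

Lemma op_sub a b i : inX Nn a -> inX Nn b -> T (vsub a b) i = T a i - T b i.
Proof.
  intros Ha Hb. destruct HT as (_ & Hadd & Hsc & _). rewrite vsub_add_scale, Hadd, Hsc; auto; [ring|].
  apply inX_scale; auto.
Qed.

Lemma op_zero_of_small a : inX Nn a -> (forall eps, 0 < eps -> nbound Nn (T a) eps) -> forall i, T a i = 0.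
Proof.
  intros Ha H i. destruct i as [|i]; [apply HT in Ha; apply Ha|].
  destruct (Req_dec (T a (S i)) 0) as [|E]; auto. apply Rabs_pos_lt in E.
  specialize (H (Rabs (T a (S i)) / 2) ltac:(lra)). apply (nbound_coord _ _ (S i)) in H; [lra|lia].
Qed.

Lemma kernel_closed : closed_sub Nn kernel.
Proof.
  assert (HT' := HT). destruct HT' as (HX & Hadd & Hsc & _). destruct op_bounded as (C & HC & Hb).
  split; [split; [|split; [|split]]|].
  - intros a [Ha _]; auto.
  - assert (H0 : inX Nn vzero) by (apply inX_fin; auto; exists 0%nat; intros i _; auto). split; auto.
    apply op_zero_of_small; auto. intros eps He. replace eps with (C * (eps / C)) by (field; lra).
    apply Hb; auto. apply nbound_vzero. apply Rlt_le, Rdiv_lt_0_compat; auto.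
  - intros a b [Ha Ea] [Hbb Eb]. split; [apply inX_add; auto|]. intros i. rewrite Hadd, Ea, Eb; auto. ring.
  - intros r a [Ha Ea]. split; [apply inX_scale; auto|]. intros i. rewrite Hsc, Ea; auto. ring.
  - intros a Ha H. split; auto. apply op_zero_of_small; auto. intros eps He.
    destruct (H (eps / C) ltac:(apply Rdiv_lt_0_compat; auto)) as (y & [Hy Ey] & H1).
    replace eps with (C * (eps / C)) by (field; lra).
    eapply nbound_ext; [|apply Hb; [|exact H1]; apply inX_sub; auto].
    intros i. rewrite op_sub, Ey; auto. ring.
Qed.

Lemma bounded_below_closure (Y : vec -> Prop) d : subspace Nn Y -> 0 < d ->
  (forall a c, Y a -> nbound Nn (T a) c -> nbound Nn a (c / d)) ->
  forall a c, closure_of Y a -> nbound Nn (T a) c -> nbound Nn a (c / d).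
Proof.
  intros (HX & _) Hd H a c [Ha Hcl] Hc f L Hf HL. destruct op_bounded as (C & HC & Hb).
  apply Rnot_lt_le. intros Hlt. set (g := pair L f a - c / d). assert (Hg : 0 < g) by (unfold g; lra).
  (* Solves [eps + C * eps / d = g / 2], the error made by replacing [a] with a nearby element of
     [Y]. *)
  set (eps := g / 2 / (C / d + 1)).
  assert (HCd : 0 < C / d) by (apply Rdiv_lt_0_compat; auto).
  assert (Heps : 0 < eps) by (unfold eps; apply Rdiv_lt_0_compat; lra).
  destruct (Hcl eps Heps) as (y & Hy & Hay).
  assert (HTy : nbound Nn (T y) (c + C * eps)).
  { eapply nbound_ext; [|apply (nbound_sub _ _ _ _ Hc (Hb _ _ (inX_sub _ _ Ha (HX _ Hy)) Hay))].
    intros i. unfold vsub at 1. rewrite op_sub; auto. ring. }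
  apply H in HTy; auto. 
  assert (Hf' := nbound_add _ _ _ _ Hay HTy f L Hf HL).
  assert (E : pair L f (vadd (vsub a y) y) = pair L f a).
  { rewrite !pair_sumL. apply sumL_ext. intros i _. unfold vadd, vsub. ring. }
  rewrite E in Hf'.
  assert (E2 : eps + (c + C * eps) / d = c / d + g / 2) by (unfold eps; field; lra).
  unfold g in *. lra.
Qed.

(** Let [y k + w k] converge to [a]. Since [T] kills [w k], the vectors [T (y k)] are Cauchy, and
    the lower bound makes [y k] Cauchy too. Its limit [y0] lies in the closure of [Y], and
    [T a = T y0] puts [a - y0] in the kernel. *)
Lemma closure_plus_kernel_closed (Y : vec -> Prop) d : subspace Nn Y -> 0 < d ->
  (forall a c, Y a -> nbound Nn (T a) c -> nbound Nn a (c / d)) ->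
  closed_sub Nn (fun a => inX Nn a /\ exists y w, closure_of Y y /\ kernel w /\ forall i, a i = y i + w i).
Proof.
  intros HY Hd HYd. assert (Hlow := bounded_below_closure Y d HY Hd HYd).
  destruct (closure_of_closed Y HY) as [(_ & Hc0 & Hcadd & Hcsc) Hcc].
  destruct kernel_closed as [(_ & Hk0 & Hkadd & Hksc) _]. destruct op_bounded as (C & HC & Hb).
  split; [split; [|split; [|split]]|].
  - tauto.
  - split; [apply Hc0|]. exists vzero, vzero. split; [apply Hc0|]. split; [apply Hk0|]. unfold vzero; intros; ring.
  - intros a b [Ha (y1 & w1 & Hy1 & Hw1 & E1)] [Hbb (y2 & w2 & Hy2 & Hw2 & E2)].
    split; [apply inX_add; auto|]. exists (vadd y1 y2), (vadd w1 w2). split; auto. split; auto.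
    intros i. unfold vadd. rewrite E1, E2. ring.
  - intros r a [Ha (y1 & w1 & Hy1 & Hw1 & E1)]. split; [apply inX_scale; auto|].
    exists (vscale r y1), (vscale r w1). split; auto. split; auto. intros i. unfold vscale. rewrite E1. ring.
  - intros a Ha Hcl. split; auto.
    assert (HX : forall k : nat, exists zyw : vec * (vec * vec),
      let z := fst zyw in let y := fst (snd zyw) in let w := snd (snd zyw) in
      inX Nn z /\ closure_of Y y /\ kernel w /\ (forall i, z i = y i + w i) /\ nbound Nn (vsub a z) (/ INR (S k))).
    { intros k. destruct (Hcl (/ INR (S k))) as (z & [Hz (y & w & Hy & Hw & E)] & Hz').
      - apply Rinv_0_lt_compat, lt_0_INR. lia.
      - exists (z, (y, w)). simpl. auto. }
    apply choice_fun in HX as (zyw & HX).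
    set (z := fun k => fst (zyw k)). set (y := fun k => fst (snd (zyw k))). set (w := fun k => snd (snd (zyw k))).
    assert (Hz : forall k, inX Nn (z k)) by apply HX. assert (Hy : forall k, closure_of Y (y k)) by apply HX.
    assert (Hw : forall k, kernel (w k)) by apply HX. assert (Ez : forall k i, z k i = y k i + w k i) by apply HX.
    assert (Hza : forall k, nbound Nn (vsub a (z k)) (/ INR (S k))) by apply HX.
    assert (HyX : forall k, inX Nn (y k)) by apply Hy.
    assert (HTz : forall k i, T (z k) i = T (y k) i).
    { intros k i. assert (E : z k = vadd (y k) (w k)) by (apply functional_extensionality; intros; apply Ez).
      rewrite E. destruct HT as (_ & Hadd & _). rewrite Hadd; auto; [|apply Hw]. destruct (Hw k) as [_ Hwk]. rewrite Hwk. ring. }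
    assert (Hinv : forall eps, 0 < eps -> exists n0, forall k, (n0 <= k)%nat -> / INR (S k) <= eps).
    { intros eps He. destruct (archimed_cor1 eps He) as (n0 & H1 & H2). exists n0. intros k Hk.
      left. eapply Rle_lt_trans; [|exact H1]. apply Rinv_le_contravar; [apply lt_0_INR; auto|]. apply le_INR. lia. }
    destruct (inX_complete y HyX) as (y0 & Hy0 & Hconv).
    (* Two such errors, multiplied by the norm bound [C] and divided by the lower bound [d], give
       [eps]. *)
    { intros eps He. assert (He' : 0 < eps * d / C / 2) by (repeat apply Rdiv_lt_0_compat; try lra; apply Rmult_lt_0_compat; auto).
      destruct (Hinv _ He') as (n0 & Hn0). exists n0. intros k l Hk Hl.
      replace eps with (C * (eps * d / C / 2 + eps * d / C / 2) / d) by (field; lra).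
      apply Hlow.
      - rewrite vsub_add_scale. apply Hcadd; auto.
      - eapply nbound_ext; [|apply (Hb (vsub (z k) (z l)))].
        + intros i. rewrite !op_sub, !HTz; auto.
        + apply inX_sub; auto.
        + eapply nbound_sub_trans; [apply nbound_sub_comm|]; eapply nbound_le; [| apply Hza | | apply Hza]; auto. }
    exists y0, (vsub a y0). split; [|split; [|intros i; unfold vsub; ring]].
    + apply Hcc; auto. intros eps He. destruct (Hconv eps He) as (k & Hk). exists (y k). split; auto.
    + split; [apply inX_sub; auto|]. apply op_zero_of_small; [apply inX_sub; auto|]. intros eps He.
      assert (He' : 0 < eps / C / 2) by (repeat apply Rdiv_lt_0_compat; lra).
      destruct (Hinv _ He') as (n1 & Hn1). destruct (Hconv _ He') as (n2 & Hn2).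
      set (k := Nat.max n1 n2). specialize (Hn1 k ltac:(lia)). specialize (Hn2 k ltac:(lia)).
      replace eps with (C * (eps / C / 2) + C * (eps / C / 2)) by (field; lra).
      eapply nbound_ext; [|apply nbound_sub; [apply (Hb (vsub a (z k)))|apply (Hb (vsub y0 (y k)))]]; auto using inX_sub.
      * intros i. unfold vsub at 1. rewrite !op_sub, HTz; auto. ring.
      * eapply nbound_le; eauto.
Qed.

Lemma HI_strictly_singular : inf_dim kernel -> HI Nn -> strictly_singular Nn T.
Proof.
  intros Hker HHI Y HY HYinf (d & Hd & HYd).
  assert (Hlow := bounded_below_closure Y d HY Hd HYd).
  assert (Hcl := closure_of_closed Y HY).
  assert (Hcl0 : closure_of Y vzero) by (destruct Hcl as [(_ & H0 & _) _]; auto).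
  assert (Hk0 : kernel vzero) by (destruct kernel_closed as [(_ & H0 & _) _]; auto).
  apply (HHI (fun a => inX Nn a /\ exists y w, closure_of Y y /\ kernel w /\ forall i, a i = y i + w i)
    (closure_of Y) kernel); auto.
  - apply (closure_plus_kernel_closed Y d); auto.
  - apply kernel_closed.
  - eapply inf_dim_mono; [|exact Hker]. intros a Ha. split; [apply Ha|]. exists vzero, a.
    split; auto. split; auto. intros; unfold vzero; ring.
  - eapply inf_dim_mono; [|exact HYinf]. intros a Ha. apply subset_closure_of; auto.
  - intros a Ha. split; [apply Ha|]. exists a, vzero. split; auto. split; auto.
    intros; unfold vzero; ring.
  - intros a Ha. split; [apply Ha|]. exists vzero, a. split; auto. split; auto. intros; unfold vzero; ring.
  (* On the intersection [T a] vanishes, so the lower bound gives [a] norm at most [0 / d]. *)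
  - intros a Ha [_ HTa] i. assert (H0 : nbound Nn a (0 / d)).
    { apply Hlow; auto. apply nbound_zero; auto. lra. }
    destruct i as [|i]; [apply Ha|]. apply (nbound_coord _ _ (S i)) in H0; [|lia].
    unfold Rdiv in H0. rewrite Rmult_0_l in H0. destruct (Req_dec (a (S i)) 0) as [|E]; auto.
    apply Rabs_pos_lt in E. lra.
  - intros z [_ (y & w & Hyw)]. exists y, w. auto.
Qed.

End Operator.
End Norm.

(** * Functionals of prescribed weight *)

Lemma lc_app gs xs gs' xs' i : length gs = length xs ->
  lc (gs ++ gs') (xs ++ xs') i = lc gs xs i + lc gs' xs' i.
Proof.
  revert xs. induction gs as [|g gs IH]; intros [|x xs] H; try discriminate; simpl; [ring|].
  rewrite IH; auto. ring.
Qed.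

Lemma lc_scale b gs xs i : lc (map (Rmult b) gs) xs i = b * lc gs xs i.
Proof.
  revert xs. induction gs as [|g gs IH]; intros [|x xs]; simpl; try ring. rewrite IH. ring.
Qed.

Lemma lq_sum_app q gs gs' : lq_sum q (gs ++ gs') = lq_sum q gs + lq_sum q gs'.
Proof. unfold lq_sum. induction gs; simpl; [ring|]. rewrite IHgs. ring. Qed.

Lemma lq_sum_scale q b gs : lq_sum q (map (Rmult b) gs) = rpow_abs b q * lq_sum q gs.
Proof. unfold lq_sum. induction gs; simpl; [ring|]. rewrite IHgs, rpow_abs_mult. ring. Qed.

(** Admissibility sees only the least support element, so [G] may be larger than the support
    provided that its head is attained. *)
Definition suppon (z : vec) (G : list nat) : Prop :=
  (forall i, z i <> 0 -> In i G) /\ z (hd 0%nat G) <> 0.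

Lemma admissible_of_suppon k zs Gs :
  Forall2 suppon zs Gs -> Forall (fun G => G <> []) Gs -> inc (concat Gs) -> Gs <> [] ->
  Schreier k (map (hd 0%nat) Gs) -> admissible k zs.
Proof.
  intros H HG Hi Hne HS. split; [|split].
  - intros ->. inversion H; subst. congruence.
  - clear HS Hne. revert HG Hi. induction H as [|z G zs Gs Hz HF IH]; intros HG Hi; simpl; auto.
    apply Forall_cons_iff in HG as [HGn HG]. simpl in Hi. apply inc_app in Hi as (Hi1 & Hi2 & Hlt).
    specialize (IH HG Hi2). destruct HF as [|z2 G2 zs Gs Hz2 HF]; auto.
    split; auto. exists (last G 0%nat). destruct Hz as [Hz _], Hz2 as [Hz2 _]. split; intros i Hle.
    + destruct (Req_dec (z i) 0) as [|E]; auto. apply Hz, inc_le_last in E; auto. lia.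
    + destruct (Req_dec (z2 i) 0) as [|E]; auto. apply Hz2 in E.
      assert (last G 0 < i)%nat; [|lia]. apply Hlt; [apply last_In; auto|].
      simpl. apply in_or_app; auto.
  - exists (map (hd 0%nat) Gs). split; auto. clear HS Hne.
    induction H as [|z G zs Gs Hz HF IH]; simpl; constructor.
    + destruct Hz as [Hz Hz0]. split; auto. intros i Hlt.
      destruct (Req_dec (z i) 0) as [|E]; auto. apply Hz, inc_hd_le in E; [lia|].
      simpl in Hi; apply inc_app in Hi; tauto.
    + apply Forall_cons_iff in HG as [_ HG]. simpl in Hi; apply inc_app in Hi. apply IH; tauto.
Qed.

(** When [u] is a probability vector, the powers [u_i^{1/q}] form a vector of norm one in l_q, and
    [wvec] is the functional of weight [W] built on it. *)
Definition wvec (q : R) (W : nat) (u : nat -> R) : vec :=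
  fun i => / INR W * rpow_abs (u i) (1 / q).

Definition realized (Nn : vec -> Prop) (q : R) (W C : nat) : Prop :=
  forall F u, Schreier C F -> F <> [] -> (forall i, 0 <= u i) ->
    (forall i, u i <> 0 <-> In i F) -> sumL u F = 1 -> Nn (wvec q W u).

(** On a piece of mass [sg], [u / sg] is a probability vector and [sg^{1/q}] becomes the coefficient
    of the piece; the q-th powers of these coefficients add up to the total mass. *)
Lemma realized_pieces Nn q W C : 1 < q -> (1 <= W)%nat -> realized Nn q W C ->
  forall Fs u, Forall (fun G => G <> [] /\ Schreier C G) Fs -> inc (concat Fs) ->
    (forall i, In i (concat Fs) -> 0 < u i) ->
    exists gs zs, length gs = length zs /\ Forall Nn zs /\ Forall2 suppon zs Fs /\
      lq_sum q gs = sumL u (concat Fs) /\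
      forall i, lc gs zs i = if in_dec Nat.eq_dec i (concat Fs) then wvec q W u i else 0.
Proof.
  intros Hq HW HR Fs u HF Hi Hu.
  assert (HW0 : 0 < INR W) by (apply lt_0_INR; lia).
  assert (HiW : 0 < / INR W) by (apply Rinv_0_lt_compat; auto).
  induction Fs as [|F Fs IH].
  - exists [], []. simpl. repeat split; auto.
  - apply Forall_cons_iff in HF as [[HFn HFS] HF]. simpl in Hi. apply inc_app in Hi as (Hi1 & Hi2 & Hlt).
    destruct IH as (gs & zs & Hl & HN & H2 & Hs & Hlc); auto.
    { intros i Hi'. apply Hu. simpl. apply in_or_app; auto. }
    assert (HuF : forall i, In i F -> 0 < u i) by (intros; apply Hu; simpl; apply in_or_app; auto).
    set (sg := sumL u F).
    assert (Hsg : 0 < sg).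
    { unfold sg. destruct F as [|a F]; [congruence|]. simpl.
      assert (0 < u a) by (apply HuF; simpl; auto).
      assert (0 <= sumL u F) by (apply sumL_ge0; intros; left; apply HuF; simpl; auto). lra. }
    set (v := fun i => if in_dec Nat.eq_dec i F then u i / sg else 0).
    assert (Hv : forall i, In i F -> v i = u i / sg).
    { intros i HiF. unfold v. destruct (in_dec Nat.eq_dec i F); tauto. }
    assert (Hvp : forall i, In i F -> 0 < v i).
    { intros i HiF. rewrite Hv; auto. apply Rdiv_lt_0_compat; auto. }
    assert (Hv0 : forall i, ~ In i F -> v i = 0).
    { intros i HiF. unfold v. destruct (in_dec Nat.eq_dec i F); tauto. }
    assert (HNz : Nn (wvec q W v)).
    { apply (HR F); auto.
      - intros i. destruct (in_dec Nat.eq_dec i F) as [h|h]; [left; auto|rewrite Hv0; auto; lra].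
      - intros i. destruct (in_dec Nat.eq_dec i F) as [h|h].
        + specialize (Hvp i h). split; auto; lra.
        + rewrite Hv0; auto. split; [congruence|tauto].
      - rewrite (sumL_ext v (fun i => / sg * u i)); [|intros; rewrite Hv; auto; unfold Rdiv; ring].
        rewrite sumL_scal. fold sg. field. lra. }
    exists (rpow_abs sg (1 / q) :: gs), (wvec q W v :: zs).
    split; [simpl; auto|]. split; [auto|]. split; [constructor; auto|split].
    + split.
      * intros i Hne. unfold wvec in Hne. destruct (in_dec Nat.eq_dec i F) as [|h]; auto.
        rewrite Hv0, rpow_abs_0 in Hne; auto. lra.
      * unfold wvec. assert (h : In (hd 0%nat F) F) by (apply hd_In; auto).
        specialize (Hvp _ h). assert (0 < rpow_abs (v (hd 0%nat F)) (1 / q)) by (apply rpow_abs_pos; lra).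
        nra.
    + simpl. rewrite sumL_app. fold sg. unfold lq_sum in *. simpl. rewrite Hs, rpow_abs_rpow_abs.
      replace (1 / q * q) with 1 by (field; lra). rewrite rpow_abs_1, Rabs_pos_eq; lra.
    + intros i. change (concat (F :: Fs)) with (F ++ concat Fs).
      change (lc (rpow_abs sg (1 / q) :: gs) (wvec q W v :: zs) i)
        with (rpow_abs sg (1 / q) * wvec q W v i + lc gs zs i).
      rewrite Hlc.
      destruct (in_dec Nat.eq_dec i (F ++ concat Fs)) as [h|h],
               (in_dec Nat.eq_dec i (concat Fs)) as [h'|h'].
      * assert (~ In i F) by (intros h1; specialize (Hlt i i h1 h'); lia).
        unfold wvec at 1. rewrite Hv0, rpow_abs_0; auto. ring.
      * apply in_app_or in h as [h|h]; [|tauto].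
        unfold wvec. rewrite Hv; auto.
        replace (rpow_abs (u i) (1 / q)) with (rpow_abs (sg * (u i / sg)) (1 / q)).
        -- rewrite rpow_abs_mult. ring.
        -- f_equal. field. lra.
      * exfalso. apply h, in_or_app; auto.
      * assert (~ In i F) by (intros h1; apply h, in_or_app; auto).
        unfold wvec at 1. rewrite Hv0, rpow_abs_0; auto. ring.
Qed.

(** The factor [m (2 * j)] of each weight stays outside. Block [F k] opens into S_{C k} pieces whose
    minima form an S_c set, and over all [k] these minima form an S_{f+c} set, which [n (2 * j)]
    admits. One functional of weight [m (2 * j)] thus absorbs the whole sum. *)
Lemma wvec_group q m n Nn j c f (ks : list nat) (F : nat -> list nat) (u : nat -> nat -> R)
  (V C : nat -> nat) (b : nat -> R) :
  1 < q -> ks <> [] ->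
  (forall k, In k ks -> (1 <= V k)%nat /\ realized Nn q (V k) (C k) /\
     Schreier (c + C k) (F k) /\ F k <> [] /\ (forall i, 0 <= u k i) /\
     (forall i, u k i <> 0 <-> In i (F k)) /\ sumL (u k) (F k) = 1) ->
  inc (concat (map F ks)) -> Schreier f (map (fun k => hd 0%nat (F k)) ks) ->
  (f + c <= n (2 * j))%nat -> sumL (fun k => rpow_abs (b k) q) ks <= 1 -> (1 <= m (2 * j))%nat ->
  NK q m n Nn j (fun i => sumL (fun k => b k * wvec q (m (2 * j) * V k)%nat (u k) i) ks).
Proof.
  intros Hq Hne Hk Hi HS Hf Hb Hm.
  (* [Gs] lists the pieces of all blocks and [Hs] their minima, grouped by block; the heads of [Hs]
     are the minima of the blocks. *)
  assert (HX : exists Gs gs zs Hs, length gs = length zs /\ Forall Nn zs /\ Forall2 suppon zs Gs /\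
     Forall (fun G => G <> []) Gs /\ concat Gs = concat (map F ks) /\ map (hd 0%nat) Gs = concat Hs /\
     map (hd 0%nat) Hs = map (fun k => hd 0%nat (F k)) ks /\
     Forall (fun H => H <> [] /\ Schreier c H) Hs /\
     lq_sum q gs = sumL (fun k => rpow_abs (b k) q) ks /\
     forall i, lc gs zs i = sumL (fun k => b k * wvec q (V k) (u k) i) ks).
  { clear Hb HS Hne. induction ks as [|k ks IH].
    - exists [], [], [], []. simpl. repeat split; auto.
    - simpl in Hi. apply inc_app in Hi as (Hi1 & Hi2 & _).
      destruct IH as (Gs & gs & zs & Hs & Hl & HNz & Hon & HGn & HG & HGH & HHs & HHS & Hlq & Hlc); auto.
      { intros; apply Hk; simpl; auto. }
      destruct (Hk k) as (HV & HR & HFS & HFn & Hu0 & Hus & Hu1); [simpl; auto|].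
      apply Schreier_decompose in HFS as (Fs & HFs & HFE & HFF & HFH); auto.
      assert (HFn' : Forall (fun G : list nat => G <> []) Fs).
      { eapply Forall_impl; [|exact HFF]; simpl; tauto. }
      destruct (realized_pieces Nn q (V k) (C k) Hq HV HR Fs (u k)) as (gs' & zs' & Hl' & HNz' & Hon' & Hlq' & Hlc'); auto.
      { rewrite <- HFE; auto. }
      { intros i Hin. rewrite <- HFE in Hin. apply Hus in Hin. specialize (Hu0 i). lra. }
      exists (Fs ++ Gs), (map (Rmult (b k)) gs' ++ gs), (zs' ++ zs), (map (hd 0%nat) Fs :: Hs).
      split; [rewrite !length_app, length_map; lia|].
      split; [apply Forall_app; auto|].
      split; [apply Forall2_app; auto|].
      split; [apply Forall_app; auto|].
      split; [rewrite concat_app; simpl; congruence|].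
      split; [rewrite map_app; simpl; congruence|].
      split; [simpl; rewrite hd_map_hd; auto; congruence|].
      split; [constructor; auto; split; auto; intros E; apply map_eq_nil in E; auto|].
      split.
      + rewrite lq_sum_app, lq_sum_scale, Hlq, Hlq', <- HFE, Hu1. simpl. ring.
      + intros i. rewrite lc_app; [|rewrite length_map; auto]. rewrite lc_scale, Hlc, Hlc', <- HFE.
        simpl. f_equal. destruct (in_dec Nat.eq_dec i (F k)) as [h|h]; auto.
        destruct (Req_dec (u k i) 0) as [E|E]; [|apply Hus in E; tauto].
        unfold wvec. rewrite E, rpow_abs_0. ring. }
  destruct HX as (Gs & gs & zs & Hs & Hl & HNz & Hon & HGn & HG & HGH & HHs & HHS & Hlq & Hlc).
  assert (HGne : Gs <> []).
  { intros ->. simpl in HGH. destruct ks as [|k ks]; [congruence|].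
    destruct (Hk k) as (_ & _ & _ & h & _); [simpl; auto|]. simpl in HG.
    symmetry in HG. apply app_eq_nil in HG. tauto. }
  exists gs, zs. split; [auto|]. split; [lra|]. split; [auto|]. split.
  - apply (admissible_of_suppon _ zs Gs); auto; [rewrite HG; auto|].
    apply (Schreier_le (f + c)); auto. rewrite HGH. apply Schreier_compose; auto.
    + rewrite HHs. auto.
    + rewrite <- HGH. apply inc_heads; auto. rewrite HG; auto.
  - intros i. rewrite Hlc, <- sumL_scal. apply sumL_ext. intros k Hkin.
    destruct (Hk k Hkin) as (HV & _). unfold wvec. rewrite mult_INR.
    field. split; apply not_0_INR; lia.
Qed.

(** A one-block instance of [wvec_group] with [f = 0]: all of [n (2 * j)] is spent inside the
    block. *)
Lemma realized_step q m n Nn j W C :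
  1 < q -> (forall f, NK q m n Nn j f -> Nn f) -> (1 <= m (2 * j))%nat ->
  (1 <= W)%nat -> realized Nn q W C -> realized Nn q (m (2 * j) * W)%nat (n (2 * j) + C)%nat.
Proof.
  intros Hq HN Hm HW HR F u HS Hne Hu0 Hus Hu1. apply HN.
  assert (E : wvec q (m (2 * j) * W)%nat u = fun i => sumL (fun k : nat => 1 * wvec q (m (2 * j) * W)%nat u i) [0%nat]).
  { apply functional_extensionality. intros i. unfold sumL, fold_right. ring. }
  rewrite E.
  apply (wvec_group q m n Nn j (n (2 * j)%nat) 0 [0%nat] (fun _ => F) (fun _ => u) (fun _ => W) (fun _ => C) (fun _ => 1));
    auto; try congruence; try lia.
  - intros k _. repeat split; auto; apply Hus.
  - simpl. rewrite app_nil_r. eapply Schreier_inc; eauto.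
  - simpl. right. exists (hd 0%nat F). split; auto. eapply Schreier_ge1; eauto. apply hd_In; auto.
  - simpl. rewrite rpow_abs_one. lra.
Qed.

Lemma realized_1 q Nn : 1 < q -> norming Nn -> realized Nn q 1 0.
Proof.
  intros Hq (_ & HN & _) F u HS Hne Hu0 Hus Hu1.
  destruct HS as [->|(j & Hj & ->)]; [congruence|]. simpl in Hu1. rewrite Rplus_0_r in Hu1.
  assert (E : wvec q 1 u = unitv j); [|rewrite E; auto].
  apply functional_extensionality. intros i. unfold wvec, unitv.
  destruct (i =? j)%nat eqn:Ei.
  - apply Nat.eqb_eq in Ei. subst i. rewrite Hu1, rpow_abs_one. simpl. field.
  - apply Nat.eqb_neq in Ei. destruct (Req_dec (u i) 0) as [E|E].
    + rewrite E, rpow_abs_0. ring.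
    + apply Hus in E. simpl in E. lia.
Qed.

(** * Arithmetic of the weights *)

Local Open Scope nat_scope.

Lemma sumn_to_ext f g k : (forall i, 1 <= i <= k -> f i = g i) -> sumn_to f k = sumn_to g k.
Proof. induction k as [|k IH]; simpl; intros H; auto. rewrite IH, H; auto; intros; try apply H; lia. Qed.

Lemma sumn_to_plus f g k : sumn_to (fun i => f i + g i) k = sumn_to f k + sumn_to g k.
Proof. induction k; simpl; lia. Qed.

Lemma sumn_to_single l c g k : 1 <= l <= k ->
  sumn_to (fun i => (if i =? l then c else 0) * g i) k = c * g l.
Proof.
  intros H. induction k as [|k IH]; [lia|]. cbn [sumn_to].
  destruct (S k =? l) eqn:E.
  - apply Nat.eqb_eq in E. subst l.
    rewrite (sumn_to_ext _ (fun _ => 0)).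
    + assert (Z : sumn_to (fun _ => 0) k = 0) by (clear; induction k; simpl; lia). lia.
    + intros i Hi. destruct (i =? S k) eqn:E; auto. apply Nat.eqb_eq in E. lia.
  - apply Nat.eqb_neq in E. rewrite IH; lia.
Qed.

(* [m (2 * k) = m 2 ^ expo s k] for [k >= 1]. *)
Fixpoint expo (s : nat -> nat) (k : nat) : nat :=
  match k with
  | O => O
  | S O => 1
  | S (S O as k') => s k'
  | S k' => expo s k' * S (s k')
  end.

(** The Schreier index spent along the factorisation of [m (2 * k)], one [n (2 * i)] for each factor
    [m (2 * i)]. *)
Definition cap (n s : nat -> nat) (k : nat) : nat := sumn_to (fun i => s i * n (2 * i)) (k - 1).

Lemma expo_S s k : 2 <= k -> expo s (S k) = expo s k * S (s k).
Proof. destruct k as [|[|k]]; try lia. reflexivity. Qed.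

Lemma cap_S n s k : 1 <= k -> cap n s (S k) = cap n s k + s k * n (2 * k).
Proof.
  intros H. unfold cap. destruct k as [|k]; [lia|]. 
  replace (S (S k) - 1) with (S k) by lia. replace (S k - 1) with k by lia. reflexivity.
Qed.

Record weights (m n s : nat -> nat) : Prop := {
  w_m : incr_pos m;
  w_m1 : 3 < m 1;
  w_m2 : m 2 = m 1 ^ 5;
  w_modd : forall j, 1 <= j -> m (2 * j + 1) = m (2 * j) ^ 5;
  w_s : incr_pos s;
  w_meven : forall j, 2 <= j -> m (2 * j) = prodn (fun i => m (2 * i) ^ s i) (j - 1);
  w_n : cond_ii m n }.

Lemma cond_weights m n : cond_i m -> cond_ii m n -> exists s, weights m n s.
Proof.
  intros (H1 & H2 & H3 & H4 & s & H5 & H6) H7. exists s. constructor; auto.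
Qed.

Section Radix.
Context (m n s : nat -> nat) (W : weights m n s).

Lemma m_lt i j : 1 <= i -> i < j -> m i < m j.
Proof.
  intros Hi H. destruct (w_m _ _ _ W) as [_ Hm]. induction H as [|j H IH]; [apply Hm; auto|].
  etransitivity; [exact IH|]. apply Hm; lia.
Qed.

Lemma n_pos i : 1 <= i -> 1 <= n i.
Proof. intros Hi. destruct (w_n _ _ _ W) as [[Hn _] _]. auto. Qed.

Lemma m_ge4 i : 1 <= i -> 4 <= m i.
Proof.
  intros Hi. assert (H1 := w_m1 _ _ _ W). destruct (Nat.eq_dec i 1) as [->|]; [lia|].
  assert (m 1 < m i) by (apply m_lt; lia). lia.
Qed.

(** From [k = 2] on, the product for [S k] is the product for [k] with one more factor. At [k = 1]
    the weight [m 2] is no such product, which is why [m4] is separate. *)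
Lemma meven_S k : 2 <= k -> m (2 * S k) = m (2 * k) * m (2 * k) ^ s k.
Proof.
  intros H. rewrite (w_meven _ _ _ W (S k)), (w_meven _ _ _ W k) at 1; try lia.
  replace (S k - 1) with (S (k - 1)) by lia. cbn [prodn].
  replace (S (k - 1)) with k by lia. reflexivity.
Qed.

Lemma m4 : m 4 = m 2 ^ s 1.
Proof. change 4 with (2 * 2). rewrite (w_meven _ _ _ W 2); simpl; lia. Qed.

Lemma m_expo k : 1 <= k -> m (2 * k) = m 2 ^ expo s k.
Proof.
  intros H. induction H as [|k H IH]; [simpl; lia|].
  destruct (Nat.eq_dec k 1) as [->|]; [apply m4|].
  rewrite meven_S, expo_S, IH by lia. rewrite <- Nat.pow_mul_r, <- Nat.pow_add_r. f_equal. lia.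
Qed.

Lemma expo_lt k k' : 1 <= k -> k < k' -> expo s k < expo s k'.
Proof.
  intros Hk H. assert (Hm : m (2 * k) < m (2 * k')) by (apply m_lt; lia).
  rewrite !m_expo in Hm by lia. apply Nat.pow_lt_mono_r_iff in Hm; auto.
  assert (4 <= m 2) by (apply m_ge4; lia). lia.
Qed.

Lemma expo_ge k : k <= expo s k.
Proof.
  induction k as [|k IH]; [lia|]. destruct k as [|k]; [simpl; lia|].
  assert (expo s (S k) < expo s (S (S k))) by (apply expo_lt; lia). lia.
Qed.

Lemma expo_le k k' : 1 <= k -> k <= k' -> expo s k <= expo s k'.
Proof. intros H H'. destruct (Nat.eq_dec k k') as [->|]; auto. apply Nat.lt_le_incl, expo_lt; lia. Qed.

Lemma s1_ge2 : 2 <= s 1.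
Proof. assert (expo s 1 < expo s 2) by (apply expo_lt; lia). simpl in *. lia. Qed.

Lemma expo_dvd k k' : 1 <= k -> k <= k' -> exists E, expo s k' = E * expo s k.
Proof.
  intros Hk H. induction H as [|k' H [E IH]]; [exists 1; lia|].
  destruct (Nat.eq_dec k' 1) as [->|].
  - assert (k = 1) by lia. subst k. exists (s 1). simpl. lia.
  - rewrite expo_S by lia. exists (E * S (s k')). rewrite IH. lia.
Qed.

Lemma prodn_expo rho k :
  prodn (fun i => m (2 * i) ^ rho i) k = m 2 ^ sumn_to (fun i => rho i * expo s i) k.
Proof.
  induction k as [|k IH]; [reflexivity|]. cbn [prodn sumn_to].
  rewrite IH, m_expo by lia. rewrite <- Nat.pow_mul_r, <- Nat.pow_add_r. f_equal. lia.
Qed.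

(** Condition (ii) without factors [m 1], read in exponents of [m 2]. *)
Lemma growth rho j : 2 <= j -> sumn_to (fun i => rho i * expo s i) (j - 1) < expo s j ->
  4 * sumn_to (fun i => rho i * n (2 * i)) (j - 1) < n (2 * j).
Proof.
  intros Hj H. destruct (w_n _ _ _ W) as (_ & Hn & _).
  specialize (Hn j Hj 0 rho). rewrite prodn_expo, m_expo in Hn by lia. apply Hn.
  simpl. rewrite Nat.add_0_r. apply Nat.pow_lt_mono_r; auto.
  assert (4 <= m 2) by (apply m_ge4; lia). lia.
Qed.

(** With [expo s i = E * expo s l], condition (ii) applies to [E - 1] copies of [m (2 * l)], and
    [2 * E <= 4 * (E - 1)] because [E >= 2]. *)
Lemma density l i : 1 <= l -> l < i -> 2 * n (2 * l) * expo s i <= n (2 * i) * expo s l.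
Proof.
  intros Hl H. destruct (expo_dvd l i) as [E HE]; try lia.
  assert (Hlt := expo_lt l i Hl H). assert (Hl0 := expo_ge l).
  assert (HE2 : 2 <= E) by nia.
  assert (G := growth (fun k => if k =? l then E - 1 else 0) i).
  rewrite (sumn_to_single l (E - 1) (expo s)), (sumn_to_single l (E - 1) (fun i => n (2 * i))) in G by lia.
  assert (4 * ((E - 1) * n (2 * l)) < n (2 * i)) by (apply G; nia).
  rewrite HE. nia.
Qed.

Lemma density_sum rho i k : k < i ->
  sumn_to (fun l => rho l * n (2 * l)) k * (2 * expo s i) <=
  n (2 * i) * sumn_to (fun l => rho l * expo s l) k.
Proof.
  induction k as [|k IH]; intros H; cbn [sumn_to]; [lia|].
  assert (D := density (S k) i). specialize (IH ltac:(lia)).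
  assert (2 * n (2 * S k) * expo s i <= n (2 * i) * expo s (S k)) by (apply D; lia).
  assert (rho (S k) * (2 * n (2 * S k) * expo s i) <= rho (S k) * (n (2 * i) * expo s (S k)))
    by (apply Nat.mul_le_mono_l; auto).
  lia.
Qed.

(* Mixed radix: the top index at which [rho] differs from [s] carries a smaller digit there,
   and the density [n (2 * l) / expo s l] at least doubles from one index to the next. *)
Lemma below_cap rho k : 2 <= k -> sumn_to (fun i => rho i * expo s i) (k - 1) < expo s k ->
  sumn_to (fun i => rho i * n (2 * i)) (k - 1) < cap n s k.
Proof.
  intros Hk. induction Hk as [|k Hk IH].
  - cbn. assert (1 <= n 2) by (apply n_pos; lia). intros. nia.
  - rewrite cap_S, expo_S by lia. replace (S k - 1) with (S (k - 1)) by lia.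
    cbn [sumn_to]. replace (S (k - 1)) with k by lia. intros H.
    assert (Hr : rho k <= s k).
    { destruct (Nat.le_gt_cases (rho k) (s k)); auto. exfalso.
      assert (expo s k * S (s k) <= expo s k * rho k) by (apply Nat.mul_le_mono_l; lia). lia. }
    destruct (Nat.eq_dec (rho k) (s k)) as [E|E].
    + rewrite E in *. assert (sumn_to (fun i => rho i * n (2 * i)) (k - 1) < cap n s k) by (apply IH; lia). lia.
    + assert (DS := density_sum rho k (k - 1) ltac:(lia)).
      set (Nn' := sumn_to (fun i => rho i * n (2 * i)) (k - 1)) in *.
      set (E' := sumn_to (fun i => rho i * expo s i) (k - 1)) in *.
      (* With [D] units missing at the top, the lower digits hold less than [D + 1] units of
         [expo s k], each at no more than half the price: they cost less than [(D + 1) / 2 <= D]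
         units of [n (2 * k)]. *)
      set (D := s k - rho k). assert (HD : s k = rho k + D) by lia. assert (1 <= D) by lia.
      rewrite HD in H |- *.
      assert (HE : E' < (D + 1) * expo s k) by lia.
      assert (Hn := n_pos (2 * k) ltac:(lia)). assert (He := expo_ge k).
      assert (Nn' * (2 * expo s k) < D * n (2 * k) * (2 * expo s k)).
      { eapply Nat.le_lt_trans; [exact DS|].
        assert (n (2 * k) * E' < n (2 * k) * ((D + 1) * expo s k)) by (apply Nat.mul_lt_mono_pos_l; lia).
        assert (n (2 * k) * ((D + 1) * expo s k) <= D * n (2 * k) * (2 * expo s k)); [|lia].
        replace (n (2 * k) * ((D + 1) * expo s k)) with ((n (2 * k) * expo s k) * (D + 1)) by lia.
        replace (D * n (2 * k) * (2 * expo s k)) with ((n (2 * k) * expo s k) * (2 * D)) by lia.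
        apply Nat.mul_le_mono_l. lia. }
      assert (Nn' < D * n (2 * k)) by (eapply Nat.mul_lt_mono_pos_r; [|eassumption]; lia).
      lia.
Qed.

(** The digits [s] reach [expo s k] exactly, so the strict bound of [below_cap] cannot extend to
    equality of exponents. *)
Lemma expo_sum k : 2 <= k -> sumn_to (fun i => s i * expo s i) (k - 1) = expo s k.
Proof.
  intros Hk. induction Hk as [|k Hk IH]; [simpl; lia|].
  rewrite expo_S by lia. replace (S k - 1) with (S (k - 1)) by lia. cbn [sumn_to].
  rewrite IH. replace (S (k - 1)) with k by lia. lia.
Qed.

Lemma cap_lt k : 2 <= k -> 2 * cap n s k < n (2 * k).
Proof.
  (* Condition (ii) needs a product strictly below [m (2 * k)], so one factor [m 2] is removed. As
     [s 1 >= 2], its cost [n 2] is at most half of [cap n s k]. *)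
  intros Hk. set (rho := fun i => if i =? 1 then s 1 - 1 else s i).
  assert (H2 := s1_ge2).
  assert (Hsum : forall g, sumn_to (fun i => s i * g i) (k - 1) = sumn_to (fun i => rho i * g i) (k - 1) + g 1).
  { intros g. rewrite <- (Nat.mul_1_l (g 1)), <- (sumn_to_single 1 1 g (k - 1)), <- sumn_to_plus by lia.
    apply sumn_to_ext. intros i Hi. unfold rho. destruct (i =? 1) eqn:E; [|lia].
    apply Nat.eqb_eq in E. subst i. nia. }
  assert (G := growth rho k Hk).
  assert (H1 := Hsum (expo s)). rewrite expo_sum in H1 by auto. change (expo s 1) with 1 in H1.
  assert (H3 := Hsum (fun i => n (2 * i))). cbn beta in H3. fold (cap n s k) in H3.
  assert (H4 : 2 * n (2 * 1) <= cap n s k).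
  { clear - Hk H2. induction Hk as [|k Hk IH]; [|rewrite cap_S by lia; lia].
    change (cap n s 2) with (s 1 * n (2 * 1)). apply Nat.mul_le_mono_r. auto. }
  specialize (G ltac:(lia)). lia.
Qed.

Lemma m_pow4 j : 1 <= j -> 4 ^ j <= m (2 * j).
Proof.
  intros H. induction H as [|j H IH].
  - change (4 <= m 2). apply m_ge4. lia.
  - assert (m (2 * j + 1) < m (2 * S j)) by (apply m_lt; lia).
    rewrite (w_modd _ _ _ W) in H0 by auto. assert (4 <= m (2 * j)) by (apply m_ge4; lia).
    assert (4 * m (2 * j) <= m (2 * j) ^ 5).
    { replace (m (2 * j) ^ 5) with (m (2 * j) ^ 4 * m (2 * j)) by (simpl; lia).
      apply Nat.mul_le_mono_r. apply Nat.le_trans with (m (2 * j) ^ 1); [rewrite Nat.pow_1_r; auto|].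
      apply Nat.pow_le_mono_r; lia. }
    rewrite Nat.pow_succ_r'. lia.
Qed.

(** Going from [k] to [S k] multiplies the weight by [m (2 * k)] exactly [s k] times, each time by
    [realized_step]. So [V] is the product of the factors of index at least [j], and [C] is their
    cost. *)
Lemma realized_tail q Nn j k : (1 < q)%R -> norming Nn ->
  (forall i f, 1 <= i -> NK q m n Nn i f -> Nn f) -> 2 <= j -> j <= k ->
  exists V C, 1 <= V /\ m (2 * k) = m (2 * j) * V /\ cap n s k = cap n s j + C /\ realized Nn q V C.
Proof.
  intros Hq HN HK Hj Hjk. induction Hjk as [|k Hjk (V & C & HV & HmV & HC & HR)].
  - exists 1, 0. repeat split; try lia. apply realized_1; auto.
  - assert (HX : forall r, exists V', 1 <= V' /\ V' = m (2 * k) ^ r * V /\ realized Nn q V' (r * n (2 * k) + C)).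
    { induction r as [|r (V' & HV' & E & HR')].
      - exists V. split; [auto|]. split; [simpl; lia|auto].
      - assert (4 <= m (2 * k)) by (apply m_ge4; lia).
        exists (m (2 * k) * V'). split; [nia|]. split; [rewrite E; simpl; lia|].
        replace (S r * n (2 * k) + C) with (n (2 * k) + (r * n (2 * k) + C)) by (simpl; lia).
        apply realized_step; auto; try lia. intros f. apply HK. lia. }
    destruct (HX (s k)) as (V' & HV' & E & HR'). exists V', (s k * n (2 * k) + C).
    split; auto. split; [|split; auto; rewrite cap_S, HC by lia; lia].
    rewrite meven_S by lia. rewrite E. rewrite HmV at 1. lia.
Qed.

End Radix.

Local Close Scope nat_scope.

(** * Tree decomposition of the norming functionals *)

(** [is_block] compares neighbours only, and a zero vector in between would break transitivity. Here
    each vector precedes all later ones; [block_sepb] obtains this from the existence of minima. *)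
Fixpoint sepb (xs : list vec) : Prop :=
  match xs with
  | [] => True
  | x :: xs' => (exists k, (forall i, (k < i)%nat -> x i = 0) /\
                  forall x', In x' xs' -> forall i, (i <= k)%nat -> x' i = 0) /\ sepb xs'
  end.

Lemma block_tail_zero x rest mu ms : is_block (x :: rest) -> Forall2 min_supp (x :: rest) (mu :: ms) ->
  forall x', In x' rest -> forall i, (i <= mu)%nat -> x' i = 0.
Proof.
  revert x mu ms. induction rest as [|x2 rest IH]; intros x mu ms Hb H2 x' Hx' i Hi; [destruct Hx'|].
  destruct Hb as [(k & Hk1 & Hk2) Hb].
  inversion H2 as [|? ? ? ? Hm H2']; subst. inversion H2' as [|? mu2 ? ms' Hm2 H2'']; subst.
  assert (Hmk : (mu <= k)%nat).
  { destruct (Nat.le_gt_cases mu k); auto. destruct Hm as [Hm _]. rewrite Hk1 in Hm; tauto. }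
  assert (Hkm2 : (k < mu2)%nat).
  { destruct (Nat.le_gt_cases mu2 k); auto. destruct Hm2 as [Hm2 _]. rewrite Hk2 in Hm2; tauto. }
  destruct Hx' as [<-|Hx']; [apply Hk2; lia|].
  apply (IH x2 mu2 ms'); auto; lia.
Qed.

Lemma block_sepb xs ms : is_block xs -> Forall2 min_supp xs ms -> Forall fin_supp xs -> sepb xs.
Proof.
  intros Hb H2. revert Hb. induction H2 as [|x1 mu1 xs ms Hm H2 IH]; intros Hb Hf; simpl; auto.
  apply Forall_cons_iff in Hf as [[B HB] Hf].
  destruct H2 as [|x2 mu2 xs ms Hm2 H2].
  - split; [|simpl; auto]. exists B. split; auto. simpl; tauto.
  - destruct Hb as [(k & Hk1 & Hk2) Hb]. split; [|apply IH; auto].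
    exists k. split; auto. intros x' [<-|Hx'] i Hi; auto.
    assert (Hkm2 : (k < mu2)%nat).
    { destruct (Nat.le_gt_cases mu2 k); auto. destruct Hm2 as [Hm2 _]. rewrite Hk2 in Hm2; tauto. }
    apply (block_tail_zero x2 xs mu2 ms); auto; lia.
Qed.

Lemma lq_sum_In q gs g : 0 < q -> lq_sum q gs <= 1 -> In g gs -> Rabs g <= 1.
Proof.
  intros Hq Hl Hg.
  assert (H : rpow_abs g q <= 1).
  { eapply Rle_trans; [|exact Hl]. clear Hl. induction gs as [|g' gs IH]; [destruct Hg|].
    unfold lq_sum in *; simpl. assert (H0 := rpow_abs_ge0 g' q).
    assert (0 <= fold_right (fun g acc => rpow_abs g q + acc) 0 gs).
    { clear. induction gs as [|g gs IH]; simpl; [lra|]. assert (H := rpow_abs_ge0 g q); lra. }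
    destruct Hg as [->|Hg]; [lra|]. apply IH in Hg. lra. }
  assert (H' : rpow_abs (rpow_abs g q) (1 / q) <= rpow_abs 1 (1 / q)).
  { apply rpow_abs_le; [apply Rlt_le, Rdiv_lt_0_compat; lra|].
    rewrite Rabs_R1, Rabs_pos_eq; auto. apply rpow_abs_ge0. }
  rewrite rpow_abs_rpow_abs, rpow_abs_one in H'.
  replace (q * (1 / q)) with 1 in H' by (field; lra). rewrite rpow_abs_1 in H'. auto.
Qed.

(** A functional [pv] with its l_q majorant [pa], its set [pP] of large coordinates, and a family
    [pQ] of simpler sets covering [pP]. *)
Record piece := mkPiece { pv : vec; pa : nat -> R; pP : nat -> Prop; pQ : nat -> nat -> Prop }.

(** Disjoint supports leave at most one active summand at each coordinate, with the same coefficient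
    for the value and for the majorant. *)
Lemma lc_pieces gs (ds : list piece) : length gs = length ds -> sepb (map pv ds) ->
  (forall d i, In d ds -> pv d i = 0 -> pa d i = 0) -> forall i,
  (lc gs (map pv ds) i = 0 /\ lc (map Rabs gs) (map pa ds) i = 0 /\ forall d, In d ds -> pv d i = 0) \/
  exists g d, In g gs /\ In d ds /\ pv d i <> 0 /\ lc gs (map pv ds) i = g * pv d i /\
     lc (map Rabs gs) (map pa ds) i = Rabs g * pa d i.
Proof.
  intros Hl Hs Ha i. revert gs Hl. induction ds as [|d ds IH]; intros gs Hl.
  - left. destruct gs; simpl in *; repeat split; auto; tauto.
  - destruct gs as [|g gs]; [discriminate|]. injection Hl as Hl.
    destruct Hs as [(k & Hk1 & Hk2) Hs].
    specialize (IH Hs (fun d' i' Hd => Ha d' i' (or_intror Hd)) gs Hl).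
    destruct (Req_dec (pv d i) 0) as [E|E].
    + assert (Ea : pa d i = 0) by (apply Ha; simpl; auto).
      destruct IH as [(H1 & H2 & H3)|(g' & d' & Hg' & Hd' & H0 & H1 & H2)].
      * left. cbn [lc map]. rewrite H1, H2, E, Ea. repeat split; try ring.
        intros d' [<-|Hd']; auto.
      * right. exists g', d'. cbn [lc map]. rewrite H1, H2, E, Ea. simpl. repeat split; auto; ring.
    + assert (Hi : (i <= k)%nat). { destruct (Nat.le_gt_cases i k); auto. rewrite Hk1 in E; tauto. }
      assert (Z : forall d', In d' ds -> pv d' i = 0).
      { intros d' Hd'. apply Hk2; auto. apply in_map; auto. }
      right. exists g, d. cbn [lc map]. destruct IH as [(H1 & H2 & H3)|(g' & d' & Hg' & Hd' & H0 & H1 & H2)].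
      * rewrite H1, H2. simpl. repeat split; auto; ring.
      * rewrite Z in H0; tauto.
Qed.

Lemma lq_pieces q gs (ds : list piece) L : length gs = length ds -> sepb (map pv ds) ->
  (forall d i, In d ds -> pv d i = 0 -> pa d i = 0) ->
  (forall d, In d ds -> sumL (fun i => rpow_abs (pa d i) q) (seq 0 L) <= 1) ->
  sumL (fun i => rpow_abs (lc (map Rabs gs) (map pa ds) i) q) (seq 0 L) <= lq_sum q gs.
Proof.
  revert gs. induction ds as [|d ds IH]; intros gs Hl Hs Ha H1.
  - destruct gs; [|discriminate]. simpl. rewrite sumL_zero; [lra|]. intros. apply rpow_abs_0.
  - destruct gs as [|g gs]; [discriminate|]. injection Hl as Hl.
    destruct Hs as [(k & Hk1 & Hk2) Hs].
    assert (IH' : sumL (fun i => rpow_abs (lc (map Rabs gs) (map pa ds) i) q) (seq 0 L) <= lq_sum q gs).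
    { apply IH; auto; intros; [apply Ha|apply H1]; simpl; auto. }
    rewrite (sumL_ext _ (fun i => rpow_abs g q * rpow_abs (pa d i) q
       + rpow_abs (lc (map Rabs gs) (map pa ds) i) q)).
    + rewrite sumL_plus, sumL_scal. unfold lq_sum in *. simpl.
      assert (sumL (fun i => rpow_abs (pa d i) q) (seq 0 L) <= 1) by (apply H1; simpl; auto).
      assert (H0 := rpow_abs_ge0 g q). nra.
    + intros i _. cbn [lc map]. destruct (Nat.le_gt_cases i k) as [Hi|Hi].
      * assert (E : lc (map Rabs gs) (map pa ds) i = 0).
        { destruct (lc_pieces gs ds Hl Hs (fun d' i' Hd => Ha d' i' (or_intror Hd)) i)
            as [(_ & E & _)|(g' & d' & _ & Hd' & H0 & _)]; auto.
          rewrite Hk2 in H0; auto; [tauto|]. apply in_map; auto. }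
        rewrite E, Rplus_0_r, rpow_abs_0, rpow_abs_mult, rpow_abs_Rabs. ring.
      * rewrite (Ha d i), rpow_abs_0; simpl; auto.
        rewrite Rmult_0_r, Rplus_0_l. ring.
Qed.

(** The last minimum not above a support point identifies the vector carrying that point; this
    supplies the cells of [cov_compose]. *)
Lemma pieces_min (ds : list piece) ms : sepb (map pv ds) ->
  Forall2 (fun d mu => min_supp (pv d) mu) ds ms ->
  forall mu, In mu ms -> exists d, In d ds /\ min_supp (pv d) mu /\
    forall d' i, In d' ds -> pv d' i <> 0 -> (mu <= i)%nat ->
      (forall mu', In mu' ms -> (mu' <= i)%nat -> (mu' <= mu)%nat) -> d' = d.
Proof.
  intros Hs H2. revert Hs. induction H2 as [|d0 mu0 ds ms Hm H2 IH]; intros Hs mu Hmu; [destruct Hmu|].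
  destruct Hs as [(k & Hk1 & Hk2) Hs].
  assert (Hmk : (mu0 <= k)%nat).
  { destruct (Nat.le_gt_cases mu0 k); auto. destruct Hm as [Hm _]. rewrite Hk1 in Hm; tauto. }
  assert (Htail : forall mu', In mu' ms -> (k < mu')%nat).
  { intros mu' Hmu'. clear - H2 Hk2 Hmu'. induction H2 as [|d mu ds ms Hm H2 IH]; [destruct Hmu'|].
    destruct Hmu' as [<-|Hmu']; [|apply IH; auto; intros; apply Hk2; simpl; auto].
    destruct (Nat.le_gt_cases mu k); auto. destruct Hm as [Hm _]. rewrite Hk2 in Hm; simpl; tauto. }
  assert (Hhave : forall d', In d' ds -> exists mu', In mu' ms /\ min_supp (pv d') mu').
  { clear - H2. induction H2 as [|d mu ds ms Hm H2 IH]; [simpl; tauto|].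
    intros d' [<-|Hd']; [exists mu; simpl; auto|]. destruct (IH d' Hd') as (mu' & ? & ?).
    exists mu'; simpl; auto. }
  destruct Hmu as [<-|Hmu].
  - exists d0. split; [simpl; auto|]. split; auto. intros d' i [<-|Hd'] Hi Hle Hlast; auto.
    exfalso. destruct (Hhave d' Hd') as (mu' & Hmu' & Hmm).
    assert (mu' <= i)%nat.
    { destruct (Nat.le_gt_cases mu' i); auto. destruct Hmm as [_ Hmm]. rewrite Hmm in Hi; tauto. }
    assert (mu' <= mu0)%nat by (apply Hlast; simpl; auto). apply Htail in Hmu'. lia.
  - destruct (IH Hs mu Hmu) as (d & Hd & Hdm & Hun). exists d. split; [simpl; auto|]. split; auto.
    intros d' i [<-|Hd'] Hi Hle Hlast.
    + exfalso. apply Htail in Hmu. apply Hi, Hk1. lia.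
    + apply (Hun d' i); auto. intros; apply Hlast; simpl; auto.
Qed.

Lemma cov_pieces N g (ds : list piece) ms B (R0 : piece -> nat -> Prop) :
  sepb (map pv ds) -> Forall2 (fun d mu => min_supp (pv d) mu) ds ms -> Schreier N ms -> ms <> [] ->
  (forall d i, In d ds -> R0 d i -> pv d i <> 0) ->
  (forall d i, In d ds -> pv d i <> 0 -> (i <= B)%nat) ->
  (forall d, In d ds -> cov g (R0 d)) ->
  cov (N + g) (fun i => exists d, In d ds /\ R0 d i).
Proof.
  intros Hs H2 HS Hne HR HB Hc. apply (cov_compose N g ms _ B); auto.
  - intros i (d & Hd & Hi). split; [|eauto].
    assert (Hmin : exists mu, In mu ms /\ min_supp (pv d) mu).
    { clear - H2 Hd. induction H2 as [|d0 mu ds ms Hm H2 IH]; [destruct Hd|].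
      destruct Hd as [<-|Hd]; [exists mu; simpl; auto|]. destruct (IH Hd) as (mu' & ? & ?).
      exists mu'; simpl; auto. }
    destruct Hmin as (mu & Hmu & Hmm). assert (Hh := inc_hd_le ms mu (Schreier_inc _ _ HS) Hmu).
    destruct (Nat.le_gt_cases mu i); [lia|]. exfalso. destruct Hmm as [_ Hmm].
    apply (HR d i Hd Hi), Hmm; auto.
  - intros mu Hmu. destruct (pieces_min ds ms Hs H2 mu Hmu) as (d & Hd & Hdm & Hun).
    eapply cov_sub; [|apply (Hc d Hd)]. intros i ((d' & Hd' & Hi) & Hle & Hlast).
    rewrite <- (Hun d' i); eauto.
Qed.

(** The [C] sets may interleave, unlike the pieces of [succU]: this suffices for bounding mass,
    though not for admissibility. *)
Definition covC (g C : nat) (P : nat -> Prop) (Q : nat -> nat -> Prop) : Prop :=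
  (forall c, cov g (Q c)) /\ forall i, P i -> exists c, (c < C)%nat /\ Q c i.

Lemma covC_union g C1 C2 P1 P2 Q1 Q2 : covC g C1 P1 Q1 -> covC g C2 P2 Q2 ->
  exists Q, covC g (C1 + C2) (fun i => P1 i \/ P2 i) Q.
Proof.
  intros [H1 H1'] [H2 H2'].
  exists (fun c => if (c <? C1)%nat then Q1 c else Q2 (c - C1)%nat). split.
  - intros c. destruct (c <? C1)%nat; auto.
  - intros i [Hi|Hi].
    + destruct (H1' i Hi) as (c & Hc & HQ). exists c. split; [lia|].
      replace (c <? C1)%nat with true; auto. symmetry; apply Nat.ltb_lt; auto.
    + destruct (H2' i Hi) as (c & Hc & HQ). exists (C1 + c)%nat. split; [lia|].
      replace (C1 + c <? C1)%nat with false; [|symmetry; apply Nat.ltb_ge; lia].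
      replace (C1 + c - C1)%nat with c by lia. auto.
Qed.

Lemma pieces_relevant g C (rel : nat -> bool) (ds : list piece) js :
  Forall2 (fun d j => (forall i, pP d i -> pv d i <> 0) /\ (rel j = false -> forall i, ~ pP d i) /\
     covC g C (pP d) (pQ d)) ds js ->
  exists Q, covC g (length (filter rel js) * C) (fun i => exists d, In d ds /\ pP d i) Q.
Proof.
  intros H2. induction H2 as [|d j ds js (Hsup & Hrel & HC) H2 IH].
  - exists (fun _ _ => False). split.
    + intros c. apply cov_empty. auto.
    + intros i (d & [] & _).
  - destruct IH as (Q & HQ). simpl. destruct (rel j) eqn:E.
    + destruct (covC_union _ _ _ _ _ _ _ HC HQ) as (Q' & H1 & H3).
      exists Q'. split; auto. intros i (d' & [<-|Hd'] & Hi); simpl; apply H3; eauto.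
    + exists Q. destruct HQ as [H1 H3]. split; auto. intros i (d' & [<-|Hd'] & Hi).
      * exfalso. eapply Hrel; eauto.
      * apply H3; eauto.
Qed.

(** The children are successive, so a cut just after each relevant one isolates its large
    coordinates; irrelevant children have none and take no cut. *)
Lemma succU_relevant g K (rel : nat -> bool) (ds : list piece) js :
  sepb (map pv ds) ->
  Forall2 (fun d j => (forall i, pP d i -> pv d i <> 0) /\ (rel j = false -> forall i, ~ pP d i) /\
     cov g (fun i => pP d i /\ (K <= i)%nat)) ds js ->
  succU (cov g) (length (filter rel js)) (fun i => (exists d, In d ds /\ pP d i) /\ (K <= i)%nat).
Proof.
  intros Hs H2. revert Hs. induction H2 as [|d j ds js (Hsup & Hrel & HC) H2 IH]; intros Hs.
  - simpl. intros i ((d & [] & _) & _).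
  - destruct Hs as [(k & Hk1 & Hk2) Hs]. specialize (IH Hs). simpl.
    assert (Hsub : forall d' i, In d' ds -> pP d' i -> pv d' i <> 0).
    { clear - H2. induction H2 as [|d j ds js (Hsup & _) H2 IH]; [simpl; tauto|].
      intros d' i [<-|Hd']; auto. }
    destruct (rel j) eqn:E.
    + exists (S k). split.
      * eapply cov_sub; [|exact HC]. intros i (((d' & [<-|Hd'] & Hi) & HK) & Hlt); auto.
        exfalso. apply (Hsub d' i Hd' Hi). apply Hk2; [apply in_map; auto|lia].
      * eapply succU_sub; [apply cov_sub| |exact IH].
        intros i (((d' & [<-|Hd'] & Hi) & HK) & Hlt); eauto.
        exfalso. apply (Hsup i Hi), Hk1. lia.
    + eapply succU_sub; [apply cov_sub| |exact IH].
      intros i ((d' & [<-|Hd'] & Hi) & HK); eauto. exfalso. eapply Hrel; eauto.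
Qed.

(** The analogue of f_j in condition (ii): [g] bounds the Schreier index spent by a product of even
    weights of index below [K] that stays below [m 2 ^ t]. *)
Definition budget (n s : nat -> nat) (K t g : nat) : Prop :=
  forall rho : nat -> nat, (sumn_to (fun i => rho i * expo s i) (K - 1) < t)%nat ->
    (sumn_to (fun i => rho i * n (2 * i)) (K - 1) <= g)%nat.

(* [y] is dominated by [a], and by [a / m 2 ^ t] off [P], up to [delta]; the set [P] of large
   coordinates has Schreier complexity [g] after splitting into [C] pieces, and its part beyond [K]
   has complexity [g2] without splitting. *)
Definition tame (q : R) (m2 t g C K g2 : nat) (delta : R) (d : piece) : Prop :=
  (forall i, 0 <= pa d i) /\ (forall i, pv d i = 0 -> pa d i = 0) /\
  (forall i, pP d i -> pv d i <> 0) /\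
  (forall L, sumL (fun i => rpow_abs (pa d i) q) (seq 0 L) <= 1) /\
  (forall i, Rabs (pv d i) <= pa d i + delta) /\
  (forall i, ~ pP d i -> Rabs (pv d i) <= pa d i / INR (m2 ^ t) + delta) /\
  covC g C (pP d) (pQ d) /\ cov g2 (fun i => pP d i /\ (K <= i)%nat).

(** Cutting [a] and [P] down to the support of [y] makes the support clauses of [tame] automatic. *)
Lemma tame_intro q m2 t g C K g2 delta y a P Q : 
  (1 <= m2)%nat -> 0 <= delta ->
  (forall i, 0 <= a i) ->
  (forall L, sumL (fun i => rpow_abs (a i) q) (seq 0 L) <= 1) ->
  (forall i, Rabs (y i) <= a i + delta) ->
  (forall i, ~ P i -> Rabs (y i) <= a i / INR (m2 ^ t) + delta) ->
  covC g C P Q -> cov g2 (fun i => P i /\ (K <= i)%nat) ->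
  exists d, pv d = y /\ tame q m2 t g C K g2 delta d /\ forall i, pP d i -> P i.
Proof.
  intros Hm Hd Ha Hs H1 H2 [HQ1 HQ2] Hc.
  assert (Hth : 0 < INR (m2 ^ t)). { apply lt_0_INR. apply Nat.neq_0_lt_0, Nat.pow_nonzero; lia. }
  exists (mkPiece y (fun i => if Req_EM_T (y i) 0 then 0 else a i) (fun i => P i /\ y i <> 0) Q).
  split; auto. split; [|simpl; tauto]. unfold tame; simpl.
  split; [intros i; destruct (Req_EM_T (y i) 0); auto; lra|].
  split; [intros i E; destruct (Req_EM_T (y i) 0); tauto|].
  split; [tauto|].
  split; [intros L; eapply Rle_trans; [|apply (Hs L)]; apply sumL_le; intros i _;
    destruct (Req_EM_T (y i) 0); [rewrite rpow_abs_0; apply rpow_abs_ge0|lra]|].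
  split; [intros i; destruct (Req_EM_T (y i) 0) as [E|E]; auto; rewrite E, Rabs_R0; lra|].
  split; [intros i Hi; destruct (Req_EM_T (y i) 0) as [E|E]; [rewrite E, Rabs_R0; unfold Rdiv; lra|apply H2; tauto]|].
  split; [split; auto; intros i [Hi _]; auto|].
  eapply cov_sub; [|exact Hc]. simpl; tauto.
Qed.

(** * Depth induction through even, odd and unit functionals *)

Section Tame.
Context (p q : R) (m n s : nat -> nat) (Nn : vec -> Prop).
Context (Hp : 1 < p) (Hq : 1 < q) (W : weights m n s) (HN : MNq_Schreier p q m n Nn).

Lemma N_norming : norming Nn. Proof. apply HN. Qed.
Lemma N_zero f : Nn f -> f 0%nat = 0. Proof. intros H. apply N_norming; auto. Qed.
Lemma N_fin f : Nn f -> fin_supp f. Proof. intros H. apply N_norming; auto. Qed.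
Lemma N_NK j f : (1 <= j)%nat -> NK q m n Nn j f -> Nn f. Proof. apply HN. Qed.
Lemma N_le1 f k : Nn f -> Rabs (f k) <= 1. Proof. intros H. apply N_norming; auto. Qed.

Lemma common_bound (xs : list vec) : Forall fin_supp xs -> exists B, forall x i, In x xs -> x i <> 0 -> (i <= B)%nat.
Proof.
  induction 1 as [|x xs [B HB] _ [B' IH]]; [exists 0%nat; simpl; tauto|].
  exists (Nat.max B B'). intros x' i [<-|Hx'] Hi.
  - destruct (Nat.le_gt_cases i B); [lia|]. rewrite HB in Hi; [tauto|auto].
  - assert (i <= B')%nat by eauto. lia.
Qed.

(** The weight [m (2 * j)] covers [expo s j] of the exponent [t], so the children answer only for
    the remainder; if nothing remains, no coordinate is large. Dividing by at least 4 more than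
    halves the error. The gains [K ^ (t - 1)] and [2 * g - 1] are what an odd parent will
    consume. *)
Lemma tame_NK h :
  (forall t g K y, (2 <= K)%nat -> (t <= expo s K)%nat -> budget n s K t g -> Nn y ->
     exists d, pv d = y /\ tame q (m 2%nat) t g (K ^ t) K (2 * g) ((/2) ^ h) d) ->
  forall t g K j y, (2 <= K)%nat -> (t <= expo s K)%nat -> budget n s K t g -> (1 <= j)%nat -> NK q m n Nn j y ->
     exists d, pv d = y /\ tame q (m 2%nat) t g (K ^ (t - 1)) K (2 * g - 1) ((/2) ^ (S h)) d /\
       ((t <= expo s j)%nat -> forall i, ~ pP d i).
Proof.
  intros IH t g K j y HK Ht Hb Hj HNK.
  assert (Hy := N_NK j y Hj HNK).
  destruct HNK as (gs & xs & Hl & Hlq & HNx & (Hne & Hblk & ms & Hms & HSch) & Hyi).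
  (* Truncated subtraction covers the case where the weight alone reaches the threshold: then
     [t' = 0], and a zero budget suffices. *)
  set (t' := (t - expo s j)%nat).
  set (g' := if (expo s j <? t)%nat then (g - n (2 * j))%nat else 0%nat).
  assert (Hj' : (expo s j < t)%nat -> (j < K)%nat).
  { intros H. destruct (Nat.lt_ge_cases j K) as [|HKj]; auto.
    assert (expo s K <= expo s j)%nat by (eapply expo_le; eauto; lia). lia. }
  assert (Hgn : (expo s j < t)%nat -> (n (2 * j) <= g)%nat).
  { intros H. specialize (Hj' H).
    specialize (Hb (fun k => if (k =? j)%nat then 1 else 0)%nat).
    rewrite (sumn_to_single j 1 (expo s)), (sumn_to_single j 1 (fun i => n (2 * i))%nat) in Hb by lia. lia. }
  assert (Hb' : budget n s K t' g').
  { unfold t', g'. destruct (expo s j <? t)%nat eqn:E.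
    - apply Nat.ltb_lt in E. specialize (Hj' E). intros rho Hr.
      specialize (Hb (fun k => rho k + if (k =? j)%nat then 1 else 0)%nat).
      assert (X : forall f, sumn_to (fun i => (rho i + if (i =? j)%nat then 1 else 0) * f i)%nat (K - 1)
        = (sumn_to (fun i => rho i * f i) (K - 1) + f j)%nat).
      { intros f. rewrite <- (Nat.mul_1_l (f j)), <- (sumn_to_single j 1 f (K - 1)), <- sumn_to_plus by lia.
        apply sumn_to_ext. intros; lia. }
      cbn beta in Hb. rewrite (X (expo s)), (X (fun i => n (2 * i))%nat) in Hb. lia.
    - apply Nat.ltb_ge in E. intros rho Hr. lia. }
  assert (HX : exists ds : list piece, Forall2 (fun x d => pv d = x /\
       tame q (m 2%nat) t' g' (K ^ t') K (2 * g') ((/2) ^ h) d) xs ds).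
  { apply Forall_ex_list. eapply Forall_impl; [|exact HNx]. intros x Hx. apply IH; auto. unfold t'; lia. }
  destruct HX as (ds & HX).
  assert (Exs : xs = map pv ds) by (clear - HX; induction HX as [|? ? ? ? [<- _]]; simpl; congruence).
  assert (Hds : Forall (tame q (m 2%nat) t' g' (K ^ t') K (2 * g') ((/2) ^ h)) ds)
    by (clear - HX; induction HX; constructor; tauto).
  clear HX. rewrite Forall_forall in Hds.
  assert (HxN : forall d, In d ds -> Nn (pv d)).
  { intros d Hd. rewrite Forall_forall in HNx. apply HNx. rewrite Exs. apply in_map; auto. }
  assert (Hfin : Forall fin_supp xs) by (eapply Forall_impl; [|exact HNx]; apply N_fin).
  assert (Hsep : sepb (map pv ds)) by (rewrite <- Exs; eapply block_sepb; eauto).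
  destruct (common_bound xs Hfin) as (B & HB).
  assert (HB' : forall d i, In d ds -> pv d i <> 0 -> (1 <= i <= B)%nat).
  { intros d i Hd Hi. split; [|apply (HB (pv d)); auto; rewrite Exs; apply in_map; auto].
    destruct i; [|lia]. rewrite N_zero in Hi; auto. tauto. }
  assert (Hms' : Forall2 (fun d mu => min_supp (pv d) mu) ds ms).
  { rewrite Exs in Hms. clear - Hms. revert ms Hms. induction ds; intros ms H; inversion H; subst; constructor; auto. }
  assert (Hmsne : ms <> []) by (intros ->; inversion Hms; subst; congruence).
  assert (Hl' : length gs = length ds) by (rewrite Hl, Exs, length_map; auto).
  assert (Ha0 : forall d i, In d ds -> pv d i = 0 -> pa d i = 0) by (intros d i Hd; apply (Hds d Hd)).
  assert (Hmge : 4 <= INR (m (2 * j)%nat)).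
  { replace 4 with (INR 4) by (simpl; lra). apply le_INR, (m_ge4 _ _ _ W). lia. }
  assert (Hm2 : (4 <= m 2)%nat) by (apply (m_ge4 _ _ _ W); lia).
  assert (Hpow : forall r, 0 < INR (m 2 ^ r)%nat).
  { intros r. apply lt_0_INR, Nat.neq_0_lt_0, Nat.pow_nonzero; lia. }
  assert (Hdl : 0 < (/2) ^ h) by (apply pow_lt; lra).
  set (a := lc (map Rabs gs) (map pa ds)).
  assert (Hpt : forall i, y i = 0 \/ exists gg d, Rabs gg <= 1 /\ In d ds /\ 
     Rabs (y i) = / INR (m (2 * j)%nat) * (Rabs gg * Rabs (pv d i)) /\ a i = Rabs gg * pa d i).
  { intros i. destruct (lc_pieces gs ds Hl' Hsep Ha0 i) as [(E & _ & _)|(gg & d & Hg & Hd & Hne' & E1 & E2)].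
    - left. rewrite Hyi, Exs, E. ring.
    - right. exists gg, d. split; [apply (lq_sum_In q gs); auto; lra|]. split; auto. split; auto.
      rewrite Hyi, Exs, E1, !Rabs_mult, (Rabs_pos_eq (/ _)); auto.
        left; apply Rinv_0_lt_compat; lra. }
  assert (Him : 0 < / INR (m (2 * j)%nat) <= / 4).
  { split; [apply Rinv_0_lt_compat; lra|apply Rinv_le_contravar; lra]. }
  assert (Ha : forall i, 0 <= a i).
  { intros i. unfold a. destruct (lc_pieces gs ds Hl' Hsep Ha0 i) as [(_ & E & _)|(gg & d & Hg & Hd & _ & _ & E2)].
    - rewrite E; lra.
    - rewrite E2. apply Rmult_le_pos; [apply Rabs_pos|apply (Hds d Hd)]. }
  (* The guard empties [P] when the weight alone makes every coordinate small. *)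
  set (P := fun i => (expo s j < t)%nat /\ exists d, In d ds /\ pP d i).
  set (Q := fun c i => (expo s j < t)%nat /\ exists d, In d ds /\ (pQ d c i /\ pv d i <> 0)).
  destruct (tame_intro q (m 2%nat) t g (K ^ (t - 1)) K (2 * g - 1) ((/2) ^ (S h)) y a P Q) as (d & Hd & Htame & HP).
  - lia.
  - simpl; lra.
  - auto.
  - intros L. eapply Rle_trans; [apply lq_pieces; auto|auto]. intros d Hd. apply (Hds d Hd).
  - intros i. destruct (Hpt i) as [E|(gg & d & Hg & Hd & E1 & E2)].
    + rewrite E, Rabs_R0. specialize (Ha i). simpl. lra.
    + rewrite E1, E2. destruct (Hds d Hd) as (H1 & _ & _ & _ & H2 & _). specialize (H1 i). specialize (H2 i).
      assert (H0 := Rabs_pos gg). assert (H3 := Rabs_pos (pv d i)).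
      replace ((/ 2) ^ S h) with (/2 * (/2) ^ h) by reflexivity.
      set (x := Rabs gg) in *. set (v := Rabs (pv d i)) in *.
      assert (0 <= (1 - x) * (/2) ^ h) by (apply Rmult_le_pos; lra).
      assert (x * v <= x * (pa d i + (/2) ^ h)) by (apply Rmult_le_compat_l; auto).
      assert (0 <= x * v) by (apply Rmult_le_pos; auto).
      assert (/ INR (m (2 * j)%nat) * (x * v) <= / 4 * (x * v)) by (apply Rmult_le_compat_r; tauto).
      assert (0 <= x * pa d i) by (apply Rmult_le_pos; auto). lra.
  - intros i HPi. destruct (Hpt i) as [E|(gg & d & Hg & Hd & E1 & E2)].
    + rewrite E, Rabs_R0. specialize (Ha i). specialize (Hpow t). simpl.
      assert (0 <= a i / INR (m 2 ^ t)%nat) by (apply Rmult_le_pos; auto; left; apply Rinv_0_lt_compat; auto). simpl in *. lra.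
    + rewrite E1, E2. destruct (Hds d Hd) as (H1 & _ & _ & _ & H2 & H2' & _). specialize (H1 i).
      assert (H4 : Rabs (pv d i) <= pa d i / INR (m 2 ^ t')%nat + (/2) ^ h).
      { destruct (Nat.lt_ge_cases (expo s j) t) as [Hc|Hc].
        - apply H2'. intros Hc'. apply HPi. split; eauto.
        - replace t' with 0%nat by (unfold t'; lia). simpl. unfold Rdiv. rewrite Rinv_1, Rmult_1_r. apply H2. }
      assert (H5 : / INR (m (2 * j)%nat) * / INR (m 2 ^ t')%nat <= / INR (m 2 ^ t)%nat).
      { rewrite <- Rinv_mult, <- mult_INR. apply Rinv_le_contravar; auto. apply le_INR.
        rewrite (m_expo _ _ _ W) by auto. rewrite <- Nat.pow_add_r. apply Nat.pow_le_mono_r; unfold t'; lia. }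
      assert (H0 := Rabs_pos gg). assert (H3 := Rabs_pos (pv d i)).
      set (x := Rabs gg) in *. set (v := Rabs (pv d i)) in *. set (im := / INR (m (2 * j)%nat)) in *.
      unfold Rdiv in *. set (it := / INR (m 2 ^ t)%nat) in *. set (it' := / INR (m 2 ^ t')%nat) in *.
      replace ((/ 2) ^ S h) with (/2 * (/2) ^ h) by reflexivity.
      set (dl := (/2) ^ h) in *.
      assert (x * v <= x * (pa d i * it' + dl)) by (apply Rmult_le_compat_l; auto).
      assert (im * (x * v) <= im * (x * (pa d i * it' + dl))) by (apply Rmult_le_compat_l; lra).
      assert (x * pa d i * (im * it') <= x * pa d i * it) by (apply Rmult_le_compat_l; auto; nra).
      assert (im * (x * dl) <= / 4 * dl).
      { apply Rmult_le_compat; try lra; nra. }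
      replace (im * (x * (pa d i * it' + dl))) with (x * pa d i * (im * it') + im * (x * dl)) in * by ring.
      lra.
  - split.
    + intros c. unfold Q. destruct (Nat.lt_ge_cases (expo s j) t) as [Hc|Hc]; [|apply cov_empty; lia].
      apply (cov_le (n (2 * j) + g') g _ B).
      * unfold g'. replace (expo s j <? t)%nat with true by (symmetry; apply Nat.ltb_lt; auto).
        specialize (Hgn Hc). lia.
      * intros i (_ & d & Hd & _ & Hi). eapply HB'; eauto.
      * eapply cov_sub; [|apply (cov_pieces (n (2 * j)) g' ds ms B (fun d i => pQ d c i /\ pv d i <> 0)); auto].
        -- intros i [_ Hi]; exact Hi.
        -- tauto.
        -- intros d i Hd Hi. eapply HB'; eauto.
        -- intros d Hd. destruct (Hds d Hd) as (_ & _ & _ & _ & _ & _ & [HQ _] & _).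
           eapply cov_sub; [|apply (HQ c)]. tauto.
    + intros i (Hc & d & Hd & Hi). destruct (Hds d Hd) as (_ & _ & HPs & _ & _ & _ & [_ HQ] & _).
      destruct (HQ i Hi) as (c & Hcc & HQc). exists c. split.
      * eapply Nat.lt_le_trans; [exact Hcc|]. apply Nat.pow_le_mono_r; [lia|].
        assert (He := expo_ge _ _ _ W j). unfold t'. lia.
      * split; auto. exists d. split; auto.
  - unfold P. destruct (Nat.lt_ge_cases (expo s j) t) as [Hc|Hc]; [|apply cov_empty; lia].
    apply (cov_le (n (2 * j) + 2 * g') (2 * g - 1) _ B).
    (* The level saved comes from [n (2 * j) + 2 * (g - n (2 * j)) <= 2 * g - 1], as
       [n (2 * j) >= 1]. *)
    + unfold g'. replace (expo s j <? t)%nat with true by (symmetry; apply Nat.ltb_lt; auto).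
      specialize (Hgn Hc). assert (Hn1 := n_pos _ _ _ W (2 * j)%nat ltac:(lia)). lia.
    + intros i ((_ & d & Hd & Hi) & _). destruct (Hds d Hd) as (_ & _ & HPs & _). eapply HB'; eauto.
    + eapply cov_sub; [|apply (cov_pieces (n (2 * j)) (2 * g') ds ms B (fun d i => pP d i /\ (K <= i)%nat)); auto].
      * intros i ((_ & d & Hd & Hi) & HKi). exists d; auto.
      * intros d i Hd [Hi _]. destruct (Hds d Hd) as (_ & _ & HPs & _). auto.
      * intros d i Hd Hi. eapply HB'; eauto.
      * intros d Hd. apply (Hds d Hd).
  - exists d. split; auto. split; auto. intros Hc i Hi. apply HP in Hi. destruct Hi; lia.
Qed.

Lemma lc_restrict a b gs xs i : lc gs (map (restrict a b) xs) i = restrict a b (lc gs xs) i.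
Proof.
  unfold restrict. revert xs. induction gs as [|g gs IH]; intros [|x xs]; cbn [lc map];
    try (destruct (_ && _)%bool; reflexivity).
  rewrite IH. destruct (_ && _)%bool; ring.
Qed.

Lemma relevant_count (rel : nat -> bool) js K : NoDup js ->
  (forall j, rel j = true -> (j < K)%nat) -> (length (filter rel js) <= K)%nat.
Proof.
  intros Hnd Hr. assert (H : (length (filter rel js) <= length (seq 0 K))%nat); [|rewrite length_seq in H; auto].
  apply NoDup_incl_length.
  - apply NoDup_filter; auto.
  - intros j Hj. apply filter_In in Hj as [_ Hj]. apply Hr in Hj. apply in_seq. lia.
Qed.

Lemma filter_nil_iff {A} (f : A -> bool) l : filter f l = [] <-> forall x, In x l -> f x = false.
Proof.
  induction l as [|a l IH]; simpl; [split; auto; tauto|]. destruct (f a) eqn:E.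
  - split; [discriminate|]. intros H. rewrite H in E; auto. discriminate.
  - rewrite IH. split; [intros H x [<-|Hx]; auto|auto].
Qed.

(* The children of an odd node have pairwise distinct weights, so fewer than [K] of them carry
   coordinates of size [1 / m 2 ^ t]: the node costs a factor [K] in the number of pieces and no
   complexity, or one level of complexity beyond [K]. *)
Lemma tame_Ninf h t g K y :
  (forall t g K y, (2 <= K)%nat -> (t <= expo s K)%nat -> budget n s K t g -> Nn y ->
     exists d, pv d = y /\ tame q (m 2%nat) t g (K ^ t) K (2 * g) ((/2) ^ h) d) ->
  (2 <= K)%nat -> (t <= expo s K)%nat -> budget n s K t g -> Nn y -> Ninf p q m n Nn y ->
  exists d, pv d = y /\ tame q (m 2%nat) t g (K ^ t) K (2 * g) ((/2) ^ (S h)) d.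
Proof.
  intros IH HK Ht Hb Hy (k & gs & xs & js & ra & rb & Hl & Hlq & (Hne & Hblk & ms & Hms & HSch) & HNKs & Hnd & Hyi).
  assert (HX : exists ds : list piece, xs = map pv ds /\ Forall2 (fun d j => Nn (pv d) /\ (1 <= j)%nat /\
       tame q (m 2%nat) t g (K ^ (t - 1)) K (2 * g - 1) ((/2) ^ (S h)) d /\
       ((t <= expo s j)%nat -> forall i, ~ pP d i)) ds js).
  { clear - IH HK Ht Hb HNKs W HN Hp Hq. induction HNKs as [|x j xs js [Hj Hx] _ (ds & -> & IHl)].
    - exists []. auto.
    - destruct (tame_NK h IH t g K j x HK Ht Hb Hj Hx) as (d & <- & Hd & Hd').
      exists (d :: ds). split; auto. constructor; auto. split; auto. apply (N_NK j); auto. }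
  destruct HX as (ds & -> & HX).
  assert (HxN : forall d, In d ds -> Nn (pv d)).
  { clear - HX. induction HX as [|d j ds js (? & _) _ IH]; [simpl; tauto|]. intros d' [<-|Hd]; auto. }
  assert (Hds : forall d, In d ds -> tame q (m 2%nat) t g (K ^ (t - 1)) K (2 * g - 1) ((/2) ^ (S h)) d).
  { clear - HX. induction HX as [|d j ds js (_ & _ & ? & _) _ IH]; [simpl; tauto|]. intros d' [<-|Hd]; auto. }
  assert (Hsep : sepb (map pv ds)).
  { eapply block_sepb; eauto. apply Forall_forall. intros x Hx. apply in_map_iff in Hx as (d & <- & Hd).
    apply N_fin; auto. }
  rewrite length_map in Hl.
  assert (Ha0 : forall d i, In d ds -> pv d i = 0 -> pa d i = 0) by (intros d i Hd; apply (Hds d Hd)).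
  assert (Hm2 : (4 <= m 2)%nat) by (apply (m_ge4 _ _ _ W); lia).
  assert (Hpow : forall r, 0 < INR (m 2 ^ r)%nat).
  { intros r. apply lt_0_INR, Nat.neq_0_lt_0, Nat.pow_nonzero; lia. }
  assert (Hdl : 0 < (/2) ^ (S h)) by (apply pow_lt; lra).
  set (dl := (/2) ^ (S h)) in *.
  (* An odd node need not halve the error: its children are even functionals, for which [tame_NK]
     already gives [(/2) ^ (S h)]. A total factor at most 1 suffices, and 2^{1/p} is below 2. *)
  assert (Hc : 0 < / INR (m (2 * k + 1)%nat) * Rpower 2 (1 / p) <= 1).
  { assert (4 <= INR (m (2 * k + 1)%nat)).
    { replace 4 with (INR 4) by (simpl; lra). apply le_INR, (m_ge4 _ _ _ W). lia. }
    assert (0 < / INR (m (2 * k + 1)%nat) <= / 4).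
    { split; [apply Rinv_0_lt_compat; lra|apply Rinv_le_contravar; lra]. }
    assert (0 < Rpower 2 (1 / p)) by apply exp_pos.
    assert (Rpower 2 (1 / p) <= Rpower 2 1).
    { apply Rle_Rpower; [lra|]. apply Rmult_le_reg_r with p; [lra|]. unfold Rdiv. 
      rewrite Rmult_assoc, Rinv_l; lra. }
    rewrite Rpower_1 in *; [|lra]. split; [apply Rmult_lt_0_compat; tauto|].
    apply Rle_trans with (/ 4 * 2); [apply Rmult_le_compat; lra|lra]. }
  set (cc := / INR (m (2 * k + 1)%nat) * Rpower 2 (1 / p)) in *.
  set (a := lc (map Rabs gs) (map pa ds)).
  assert (Ha : forall i, 0 <= a i).
  { intros i. unfold a. destruct (lc_pieces gs ds Hl Hsep Ha0 i) as [(_ & E & _)|(gg & d & Hg & Hd & _ & _ & E2)].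
    - rewrite E; lra.
    - rewrite E2. apply Rmult_le_pos; [apply Rabs_pos|apply (Hds d Hd)]. }
  assert (Hpt : forall i, y i = 0 \/ exists gg d, Rabs gg <= 1 /\ In d ds /\ 
     Rabs (y i) <= Rabs gg * Rabs (pv d i) /\ a i = Rabs gg * pa d i).
  { intros i. rewrite Hyi. rewrite (lc_scale (Rpower 2 (1 / p))), lc_restrict. unfold restrict.
    destruct (_ && _)%bool; [|left; ring].
    destruct (lc_pieces gs ds Hl Hsep Ha0 i) as [(E & _ & _)|(gg & d & Hg & Hd & Hne' & E1 & E2)].
    - left. rewrite E. ring.
    - right. exists gg, d. split; [apply (lq_sum_In q gs); auto; lra|]. split; auto. split; auto.
      rewrite E1, <- Rmult_assoc. fold cc. rewrite !Rabs_mult, (Rabs_pos_eq cc); [|lra].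
      assert (0 <= Rabs gg * Rabs (pv d i)) by (apply Rmult_le_pos; apply Rabs_pos). nra. }
  set (rel := fun j => (expo s j <? t)%nat).
  assert (Hrel : forall j, rel j = false -> (t <= expo s j)%nat) by (intros j Hj; apply Nat.ltb_ge; auto).
  assert (Hcount : (length (filter rel js) <= K)%nat).
  { apply relevant_count; auto. intros j Hj. apply Nat.ltb_lt in Hj.
    destruct (Nat.lt_ge_cases j K) as [|HKj]; auto.
    assert (expo s K <= expo s j)%nat by (eapply expo_le; eauto; lia). lia. }
  assert (Hgrel : forall j, (1 <= j)%nat -> rel j = true -> (1 <= g)%nat).
  { intros j Hj1 Hj. apply Nat.ltb_lt in Hj.
    assert (j < K)%nat.
    { destruct (Nat.lt_ge_cases j K) as [|HKj]; auto.
      assert (expo s K <= expo s j)%nat by (eapply expo_le; eauto; lia). lia. }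
    specialize (Hb (fun k => if (k =? j)%nat then 1 else 0)%nat).
    rewrite (sumn_to_single j 1 (expo s)), (sumn_to_single j 1 (fun i => n (2 * i))%nat) in Hb by lia.
    assert (Hn1 := n_pos _ _ _ W (2 * j)%nat ltac:(lia)). lia. }
  set (P := fun i => exists d, In d ds /\ pP d i).
  destruct (pieces_relevant g (K ^ (t - 1)) rel ds js) as (Q & HQ1 & HQ2).
  { eapply Forall2_impl; [|exact HX]. intros d j (_ & Hj & (_ & _ & HPs & _ & _ & _ & HQ & _) & Hirr).
    split; auto. }
  destruct (tame_intro q (m 2%nat) t g (K ^ t) K (2 * g) dl y a P Q) as (d & Hd & Htame & _).
  - lia.
  - lra.
  - auto.
  - intros L. eapply Rle_trans; [apply lq_pieces; auto|auto]. intros d Hd. apply (Hds d Hd).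
  - intros i. destruct (Hpt i) as [E|(gg & d & Hg & Hd & E1 & E2)].
    + rewrite E, Rabs_R0. specialize (Ha i). lra.
    + rewrite E2. destruct (Hds d Hd) as (H1 & _ & _ & _ & H2 & _). specialize (H1 i). specialize (H2 i).
      assert (H0 := Rabs_pos gg). assert (H3 := Rabs_pos (pv d i)).
      set (x := Rabs gg) in *. set (v := Rabs (pv d i)) in *.
      assert (x * v <= x * (pa d i + dl)) by (apply Rmult_le_compat_l; auto).
      assert (0 <= (1 - x) * dl) by (apply Rmult_le_pos; lra). lra.
  - intros i HPi. destruct (Hpt i) as [E|(gg & d & Hg & Hd & E1 & E2)].
    + rewrite E, Rabs_R0. specialize (Ha i). specialize (Hpow t).
      assert (0 <= a i / INR (m 2 ^ t)%nat) by (apply Rmult_le_pos; auto; left; apply Rinv_0_lt_compat; auto). lra.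
    + rewrite E2. destruct (Hds d Hd) as (H1 & _ & _ & _ & _ & H2 & _). specialize (H1 i).
      assert (H2' := H2 i (fun h => HPi (ex_intro _ d (conj Hd h)))).
      assert (H0 := Rabs_pos gg). assert (H3 := Rabs_pos (pv d i)).
      set (x := Rabs gg) in *. set (v := Rabs (pv d i)) in *. unfold Rdiv in *. 
      set (it := / INR (m 2 ^ t)%nat) in *.
      assert (x * v <= x * (pa d i * it + dl)) by (apply Rmult_le_compat_l; auto).
      assert (0 <= (1 - x) * dl) by (apply Rmult_le_pos; lra). lra.
  - split; auto. intros i Hi. destruct (HQ2 i Hi) as (c & Hcc & HQc). exists c. split; auto.
    eapply Nat.lt_le_trans; [exact Hcc|].
    (* For [t = 0] no child is relevant, so the truncated exponent in [K ^ (t - 1)] does no harm. *)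
    destruct t as [|t].
    + rewrite (proj2 (filter_nil_iff rel js)); [simpl; lia|]. intros j _. reflexivity.
    + replace (S t - 1)%nat with t by lia. rewrite Nat.pow_succ_r'. apply Nat.mul_le_mono_r; auto.
  - assert (HSU : succU (cov (2 * g - 1)) (length (filter rel js)) (fun i => P i /\ (K <= i)%nat)).
    { apply succU_relevant; auto. eapply Forall2_impl; [|exact HX].
      intros d j (_ & Hj & (_ & _ & HPs & _ & _ & _ & _ & HQ) & Hirr). split; auto. }
    (* A relevant child spends at least one unit, so a zero budget leaves no relevant child and no
       extra level is charged. *)
    destruct (Nat.eq_dec g 0) as [->|Hg].
    + apply cov_empty. replace (length (filter rel js)) with 0%nat in HSU; [exact HSU|].
      symmetry. rewrite (proj2 (filter_nil_iff rel js)); auto.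
      intros j Hj. destruct (rel j) eqn:E; auto.
      assert (1 <= j)%nat.
      { clear - HX Hj. induction HX as [|d j' ds js (_ & ? & _) _ IH]; [destruct Hj|]. destruct Hj as [<-|Hj]; auto. }
      specialize (Hgrel j H E). lia.
    (* Beyond [K] a Schreier set may have [K] pieces, which accommodates all relevant children at
       the cost of one level. *)
    + replace (2 * g)%nat with (S (2 * g - 1)) by lia. exists K. split; [tauto|].
      eapply succU_pad; eauto.
  - exists d. auto.
Qed.

(** Induction on the depth explored. At depth 0 the majorant is zero and the error 1 covers every
    functional of the norming set. *)
Lemma tame_N h : forall t g K y, (2 <= K)%nat -> (t <= expo s K)%nat -> budget n s K t g -> Nn y ->
     exists d, pv d = y /\ tame q (m 2%nat) t g (K ^ t) K (2 * g) ((/2) ^ h) d.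
Proof.
  assert (Hm2 : (4 <= m 2)%nat) by (apply (m_ge4 _ _ _ W); lia).
  assert (Hpow : forall r, 0 < INR (m 2 ^ r)%nat).
  { intros r. apply lt_0_INR, Nat.neq_0_lt_0, Nat.pow_nonzero; lia. }
  assert (HKt : forall K t, (2 <= K)%nat -> (1 <= K ^ t)%nat).
  { intros K t HK. assert (K ^ t <> 0)%nat by (apply Nat.pow_nonzero; lia). lia. }
  induction h as [|h IH]; intros t g K y HK Ht Hb Hy.
  - destruct (tame_intro q (m 2%nat) t g (K ^ t) K (2 * g) ((/2) ^ 0) y (fun _ => 0) (fun _ => False) (fun _ _ => False))
      as (d & Hd & Htame & _); try lia; try (simpl; lra).
    + intros _. lra.
    + intros L. rewrite sumL_zero; [lra|]. intros. apply rpow_abs_0.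
    + intros i. simpl. rewrite Rplus_0_l. apply N_le1; auto.
    + intros i _. simpl pow. unfold Rdiv. rewrite Rmult_0_l, Rplus_0_l. apply N_le1; auto.
    + split; [intros c; apply cov_empty; auto|tauto].
    + apply cov_empty. tauto.
    + exists d. auto.
  - destruct HN as (_ & _ & HN3). destruct (HN3 y Hy) as [(j & Hj & HNK)|[HNi|(k & Hk & Hyk)]].
    + destruct (tame_NK h IH t g K j y HK Ht Hb Hj HNK) as (d & Hd & (H1 & H2 & H3 & H4 & H5 & H6 & [H7 H7'] & H8) & _).
      exists d. split; auto. split; [auto|]. split; [auto|]. split; [auto|]. split; [auto|]. split; [auto|].
      split; [auto|]. split.
      * split; auto. intros i Hi. destruct (H7' i Hi) as (c & Hc & HQ). exists c. split; auto.
        eapply Nat.lt_le_trans; [exact Hc|]. apply Nat.pow_le_mono_r; lia.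
      * destruct (N_fin y Hy) as [B HB]. apply (cov_le (2 * g - 1) _ _ B); auto; [lia|].
        intros i [Hi HKi]. split; [lia|]. apply H3 in Hi. rewrite Hd in Hi.
        destruct (Nat.le_gt_cases i B); auto. rewrite HB in Hi; auto; tauto.
    + apply tame_Ninf; auto.
    + assert (Hab : forall i, Rabs (y i) = unitv k i).
      { intros i. unfold unitv in *. destruct Hyk as [E|E]; rewrite E; destruct (i =? k)%nat;
          rewrite ?Rabs_Ropp, ?Rabs_R1, ?Rabs_R0; auto. }
      assert (Hdl : 0 < (/2) ^ (S h)) by (apply pow_lt; lra).
      assert (Hu : forall i, 0 <= unitv k i) by (intros i; rewrite <- Hab; apply Rabs_pos).
      destruct (tame_intro q (m 2%nat) t g (K ^ t) K (2 * g) ((/2) ^ (S h)) y (unitv k) (fun i => i = k) (fun _ i => i = k))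
        as (d & Hd & Htame & _); try lia; try lra; auto.
      * intros L. destruct (in_dec Nat.eq_dec k (seq 0 L)) as [Hin|Hin].
        -- apply in_split in Hin as (l1 & l2 & E).
           assert (Hnd := seq_NoDup L 0). rewrite E in Hnd. apply NoDup_remove_2 in Hnd.
           rewrite E, sumL_app. simpl. rewrite !sumL_zero.
           ++ unfold unitv. rewrite Nat.eqb_refl, rpow_abs_one. lra.
           ++ intros i Hi. unfold unitv. replace (i =? k)%nat with false; [apply rpow_abs_0|].
              symmetry. apply Nat.eqb_neq. intros ->. apply Hnd, in_or_app; auto.
           ++ intros i Hi. unfold unitv. replace (i =? k)%nat with false; [apply rpow_abs_0|].
              symmetry. apply Nat.eqb_neq. intros ->. apply Hnd, in_or_app; auto.
        -- rewrite sumL_zero; [lra|]. intros i Hi. unfold unitv. replace (i =? k)%nat with false; [apply rpow_abs_0|].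
           symmetry. apply Nat.eqb_neq. intros ->. auto.
      * intros i. rewrite Hab. lra.
      * intros i Hi. rewrite Hab. specialize (Hpow t). 
        assert (0 <= unitv k i / INR (m 2 ^ t)%nat) by (apply Rmult_le_pos; auto; left; apply Rinv_0_lt_compat; auto).
        unfold unitv in *. replace (i =? k)%nat with false in *; [lra|]. symmetry. apply Nat.eqb_neq; auto.
      * split.
        -- intros c. apply (cov_le 0 g _ k); [lia|intros; lia|]. exists k. auto.
        -- intros i Hi. exists 0%nat. split; auto.
      * apply (cov_le 0 (2 * g) _ k); [lia|intros; lia|]. exists k. tauto.
      * exists d. auto.
Qed.

(* [delta] is removed by taking it below every nonzero [|y i|]. *)
Lemma tame_exact t g K y : (2 <= K)%nat -> (t <= expo s K)%nat -> budget n s K t g -> Nn y ->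
  exists a P Q, (forall i, 0 <= a i) /\ (forall L, sumL (fun i => rpow_abs (a i) q) (seq 0 L) <= 1) /\
    (forall i, Rabs (y i) <= 2 * a i) /\ (forall i, ~ P i -> Rabs (y i) <= 2 * (a i / INR (m 2 ^ t))) /\
    covC g (K ^ t) P Q /\ cov (2 * g) (fun i => P i /\ (K <= i)%nat).
Proof.
  intros HK Ht Hb Hy.
  (* With the error at most half of [|y i|], the bound [|y i| <= a i + delta] becomes
     [|y i| <= 2 * a i]; the bound off [P] doubles likewise. *)
  assert (Hh : exists h, forall i, y i <> 0 -> 2 * (/2) ^ h <= Rabs (y i)).
  { destruct (N_fin y Hy) as [B HB].
    assert (H : forall L, exists h, forall i, (i < L)%nat -> y i <> 0 -> 2 * (/2) ^ h <= Rabs (y i)).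
    { induction L as [|L (h & Hh)]; [exists 0%nat; lia|].
      destruct (Req_dec (y L) 0) as [E|E].
      - exists h. intros i Hi Hne. apply Hh; auto. destruct (Nat.eq_dec i L) as [->|]; [tauto|lia].
      - apply Rabs_pos_lt in E.
        destruct (pow_lt_1_zero (/2) ltac:(rewrite Rabs_pos_eq; lra) (Rabs (y L) / 2) ltac:(lra)) as (h' & Hh').
        exists (h + h')%nat. intros i Hi Hne.
        assert (D : forall r r', (/2) ^ (r + r') <= (/2) ^ r).
        { intros r r'. rewrite pow_add. assert (0 < (/2) ^ r) by (apply pow_lt; lra).
          assert ((/2) ^ r' <= 1). { rewrite <- (pow1 r'). apply pow_incr. lra. } nra. }
        destruct (Nat.eq_dec i L) as [->|].
        + specialize (Hh' h' (Nat.le_refl _)). rewrite Rabs_pos_eq in Hh'; [|left; apply pow_lt; lra].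
          specialize (D h' h). rewrite Nat.add_comm in D. lra.
        + specialize (D h h'). specialize (Hh i ltac:(lia) Hne). lra. }
    destruct (H (S B)) as (h & Hh). exists h. intros i Hne. apply Hh; auto.
    destruct (Nat.lt_ge_cases B i); [rewrite HB in Hne; auto; tauto|lia]. }
  destruct Hh as (h & Hh).
  destruct (tame_N h t g K y HK Ht Hb Hy) as (d & Hd & (H1 & H2 & H3 & H4 & H5 & H6 & H7 & H8)).
  assert (Hpow : 0 < INR (m 2 ^ t)%nat).
  { apply lt_0_INR, Nat.neq_0_lt_0, Nat.pow_nonzero. assert (4 <= m 2)%nat by (apply (m_ge4 _ _ _ W); lia). lia. }
  exists (pa d), (pP d), (pQ d). rewrite Hd in *. repeat split; auto; try apply H7.
  - intros i. destruct (Req_dec (y i) 0) as [E|E]; [rewrite E, Rabs_R0; specialize (H1 i); lra|].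
    specialize (Hh i E). specialize (H5 i). lra.
  - intros i Hi. destruct (Req_dec (y i) 0) as [E|E].
    + rewrite E, Rabs_R0. specialize (H1 i).
      assert (0 <= pa d i / INR (m 2 ^ t)%nat) by (apply Rmult_le_pos; auto; left; apply Rinv_0_lt_compat; auto). lra.
    + specialize (Hh i E). specialize (H6 i Hi). lra.
Qed.

End Tame.

(** * The block sequence and its operators *)

Definition holds (P : nat -> Prop) (i : nat) : bool :=
  if excluded_middle_informative (P i) then true else false.

Lemma holds_true P i : holds P i = true <-> P i.
Proof. unfold holds. destruct (excluded_middle_informative (P i)); split; auto; discriminate. Qed.

Lemma mass_covC g C u b P Q : (forall c, mass_le u (Q c) b) -> covC g C P Q -> mass_le u P (INR C * b).
Proof.
  intros HQ [_ HC]. revert P HC. induction C as [|C IH]; intros P HC G HG HGP.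
  - destruct G as [|i G]; [simpl; lra|]. destruct (HC i) as (c & Hc & _); [apply HGP; simpl; auto|lia].
  - rewrite (sumL_filter (holds (Q C))), S_INR.
    assert (sumL u (filter (holds (Q C)) G) <= b).
    { apply (HQ C); [apply NoDup_filter; auto|]. intros i Hi. apply filter_In in Hi as [_ Hi].
      apply holds_true; auto. }
    assert (sumL u (filter (fun k => negb (holds (Q C) k)) G) <= INR C * b).
    { apply (IH (fun i => P i /\ ~ Q C i)); [|apply NoDup_filter; auto|].
      - intros i [Hi Hn]. destruct (HC i Hi) as (c & Hc & HQc). exists c. split; auto.
        destruct (Nat.eq_dec c C) as [->|]; [tauto|lia].
      - intros i Hi. apply filter_In in Hi as [Hi Hn]. split; auto. rewrite <- holds_true.
        destruct (holds (Q C) i); [discriminate|auto]. }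
    lra.
Qed.

(** With [K = k + 2] and [M = m (2 * K)], the numerator is the mass [(1 / (4 M))^p] that
    [xvec_bound] can tolerate on the large set, and the denominator is the number [K ^ expo s K] of
    pieces into which that set splits. *)
Definition gap_eps (p : R) (m s : nat -> nat) (k : nat) : R :=
  rpow_abs (/ (4 * INR (m (2 * (k + 2))%nat))) p / INR ((k + 2) ^ expo s (k + 2)).

(** [b_first] puts [t_k] beyond every index [K <= k + 2], where the unsplit complexity bound of
    [tame] applies. [b_next] leaves the coordinate before each block outside all blocks, to be used
    as a kernel vector. *)
Record blocks (p : R) (m n s : nat -> nat) (F : nat -> list nat) (u : nat -> nat -> R) : Prop := {
  b_sch : forall k, Schreier (cap n s (k + 2)) (F k);
  b_ne : forall k, F k <> [];
  b_ge0 : forall k i, 0 <= u k i;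
  b_supp : forall k i, u k i <> 0 <-> In i (F k);
  b_sum : forall k, sumL (u k) (F k) = 1;
  b_small : forall k P, cov (cap n s (k + 2) - 1) P -> mass_le (u k) P (gap_eps p m s k);
  b_first : forall k i, In i (F k) -> (k + 3 <= i)%nat;
  b_next : forall k i, In i (F (S k)) -> (last (F k) 0 + 2 <= i)%nat }.

Section Blocks.
Context (p q : R) (m n s : nat -> nat) (Nn : vec -> Prop).
Context (Hp : 1 < p) (Hq : 1 < q) (Hpq : 1 / p + 1 / q = 1).
Context (W : weights m n s) (HN : MNq_Schreier p q m n Nn).

Lemma INR_m_ge4 i : (1 <= i)%nat -> 4 <= INR (m i).
Proof. intros Hi. replace 4 with (INR 4) by (simpl; lra). apply le_INR, (m_ge4 _ _ _ W); auto. Qed.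

Lemma cap_pos k : (2 <= k)%nat -> (1 <= cap n s k)%nat.
Proof.
  intros H. assert (X := below_cap _ _ _ W (fun _ => 0%nat) k H).
  assert (Z : forall f r, sumn_to (fun i => 0 * f i)%nat r = 0%nat) by (intros f; induction r as [|r IHr]; cbn [sumn_to]; lia).
  rewrite (Z (expo s)), (Z (fun i => n (2 * i)%nat)) in X.
  assert (k <= expo s k)%nat by (apply (expo_ge _ _ _ W)). specialize (X ltac:(lia)). lia.
Qed.

Lemma gap_eps_pos k : 0 < gap_eps p m s k.
Proof.
  unfold gap_eps. assert (4 <= INR (m (2 * (k + 2))%nat)) by (apply INR_m_ge4; lia).
  apply Rdiv_lt_0_compat.
  - apply rpow_abs_pos. apply Rinv_neq_0_compat. lra.
  - apply lt_0_INR, Nat.neq_0_lt_0, Nat.pow_nonzero. lia.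
Qed.

Lemma blocks_exist : exists F u, blocks p m n s F u.
Proof.
  assert (H : forall kN : nat * nat, exists Fu : list nat * (nat -> R),
    let k := fst kN in let N0 := snd kN in let F := fst Fu in let u := snd Fu in
    Schreier (cap n s (k + 2)) F /\ F <> [] /\ (forall i, In i F -> (N0 <= i)%nat) /\
    (forall i, 0 <= u i) /\ (forall i, u i <> 0 <-> In i F) /\ sumL u F = 1 /\
    small_on_lower (cap n s (k + 2)) (gap_eps p m s k) u).
  { intros (k & N0). destruct (averages (cap n s (k + 2)) N0 (gap_eps p m s k) (gap_eps_pos k)) as (F & u & HH).
    exists (F, u). exact HH. }
  apply choice_fun in H as (pick & Hpick).
  (* The starting points meet [b_first] and [b_next] at once: for block [S k'], [last + k' + 4]
     exceeds both [last + 2] and [k' + 3]. *)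
  set (B := fix B (k : nat) : list nat * (nat -> R) :=
    match k with
    | O => pick (0, 3)%nat
    | S k' => pick (S k', last (fst (B k')) 0 + k' + 4)%nat
    end).
  assert (HB : forall k, exists N0, B k = pick (k, N0) /\ (k + 3 <= N0)%nat /\
     forall k', k = S k' -> N0 = (last (fst (B k')) 0 + k' + 4)%nat).
  { intros [|k]; [exists 3%nat; simpl; repeat split; auto; intros; discriminate|].
    exists (last (fst (B k)) 0 + k + 4)%nat. split; [reflexivity|]. split; [lia|].
    intros k' E. injection E as <-. auto. }
  exists (fun k => fst (B k)), (fun k => snd (B k)).
  constructor; intros k; destruct (HB k) as (N0 & E & HN0 & HN1); destruct (Hpick (k, N0)) as (H1 & H2 & H3 & H4 & H5 & H6 & H7); rewrite <- E in *; simpl in *; auto.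
  - intros P HP. unfold small_on_lower in H7. destruct (cap n s (k + 2)) as [|c] eqn:Ec.
    + assert (1 <= cap n s (k + 2))%nat by (apply cap_pos; lia). lia.
    + apply H7. replace c with (S c - 1)%nat by lia. auto.
  - intros i Hi. apply H3 in Hi. lia.
  - intros i Hi. destruct (HB (S k)) as (N2 & E2 & _ & HN2). specialize (HN2 k eq_refl).
    destruct (Hpick (S k, N2)) as (_ & _ & H3' & _). rewrite <- E2 in H3'. simpl in H3'.
    change (In i (fst (B (S k)))) in Hi. apply H3' in Hi. lia.
Qed.

Context (F : nat -> list nat) (u : nat -> nat -> R) (HB : blocks p m n s F u).

Definition tk (k : nat) : nat := hd 0%nat (F k).
Definition xfun (k : nat) : vec := wvec q (m (2 * (k + 2))) (u k).
Definition xvec (k : nat) : vec := fun i => INR (m (2 * (k + 2))%nat) * rpow_abs (u k i) (1 / p).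
Definition act (k : nat) (v : vec) : R := pair (last (F k) 0%nat) (xfun k) v.

#[local] Instance blocks_norming : norming Nn := N_norming p q m n Nn HN.

Lemma F_inc k : inc (F k). Proof. eapply Schreier_inc, b_sch; eauto. Qed.

Lemma tk_In k : In (tk k) (F k). Proof. apply hd_In. eapply b_ne; eauto. Qed.

Lemma tk_ge k : (k + 3 <= tk k)%nat. Proof. eapply b_first; eauto. apply tk_In. Qed.

Lemma F_sep k k' i i' : (k < k')%nat -> In i (F k) -> In i' (F k') -> (i + 1 < i')%nat.
Proof.
  intros Hk Hi. revert i'. induction Hk as [|k' Hk IH]; intros i' Hi'.
  - apply (b_next _ _ _ _ _ _ HB) in Hi'. apply inc_le_last in Hi; [lia|apply F_inc].
  - apply (b_next _ _ _ _ _ _ HB) in Hi'.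
    assert (i + 1 < last (F k') 0)%nat by (apply IH, last_In; eapply b_ne; eauto). lia.
Qed.

Lemma tk_lt k k' : (k < k')%nat -> (tk k + 1 < tk k')%nat.
Proof. intros H. eapply F_sep; eauto; apply tk_In. Qed.

Lemma tk_inj k k' : tk k = tk k' -> k = k'.
Proof.
  intros E. destruct (Nat.lt_total k k') as [H|[H|H]]; auto; apply tk_lt in H; lia.
Qed.

Lemma F_concat_inc ks : inc ks -> inc (concat (map F ks)).
Proof.
  induction 1 as [|k ks Hks IH Hk]; simpl; [constructor|]. apply inc_app. split; [apply F_inc|]. split; auto.
  intros x y Hx Hy. apply in_concat in Hy as (G & HG & Hy). apply in_map_iff in HG as (k' & <- & Hk').
  rewrite Forall_forall in Hk. specialize (F_sep k k' x y (Hk _ Hk') Hx Hy). lia.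
Qed.

Lemma tk_map_inc ks : inc ks -> inc (map tk ks).
Proof.
  induction 1 as [|k ks Hks IH Hk]; simpl; constructor; auto. rewrite Forall_forall in *.
  intros x Hx. apply in_map_iff in Hx as (k' & <- & Hk'). apply Hk, tk_lt in Hk'. lia.
Qed.

Lemma xfun_supp k i : xfun k i <> 0 -> In i (F k).
Proof.
  intros H. apply (b_supp _ _ _ _ _ _ HB). intros E. apply H. unfold xfun, wvec. rewrite E, rpow_abs_0. ring.
Qed.

Lemma group_NK j f ks b : (2 <= j)%nat -> ks <> [] -> inc ks -> (forall k, In k ks -> (j <= k + 2)%nat) ->
  cov f (fun i => In i (map tk ks)) -> (f + cap n s j <= n (2 * j))%nat ->
  sumL (fun k => rpow_abs (b k) q) ks <= 1 ->
  NK q m n Nn j (fun i => sumL (fun k => b k * xfun k i) ks).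
Proof.
  intros Hj Hne Hks Hjk Hc Hf Hb.
  assert (HV : forall k, exists VC : nat * nat, (j <= k + 2)%nat -> (1 <= fst VC)%nat /\
     m (2 * (k + 2))%nat = (m (2 * j) * fst VC)%nat /\ cap n s (k + 2) = (cap n s j + snd VC)%nat /\
     realized Nn q (fst VC) (snd VC)).
  { intros k. destruct (Nat.le_gt_cases j (k + 2)) as [H|H]; [|exists (0, 0)%nat; lia].
    destruct (realized_tail m n s W q Nn j (k + 2)) as (V & C & HVC); auto.
    - apply (N_norming p q m n Nn HN).
    - apply (N_NK p q m n Nn HN).
    - exists (V, C). auto. }
  apply choice_fun in HV as (VC & HVC).
  assert (E : (fun i => sumL (fun k => b k * xfun k i) ks) =
     (fun i => sumL (fun k => b k * wvec q (m (2 * j) * fst (VC k))%nat (u k) i) ks)).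
  { apply functional_extensionality. intros i. apply sumL_ext. intros k Hk.
    destruct (HVC k (Hjk k Hk)) as (_ & Em & _). unfold xfun. rewrite Em. auto. }
  rewrite E. apply (wvec_group q m n Nn j (cap n s j) f ks F u _ (fun k => snd (VC k)) b); auto.
  - intros k Hk. destruct (HVC k (Hjk k Hk)) as (H1 & _ & H3 & H4). split; auto. split; auto.
    split; [rewrite <- H3; eapply b_sch; eauto|]. split; [eapply b_ne; eauto|].
    split; [eapply b_ge0; eauto|]. split; [eapply b_supp; eauto|eapply b_sum; eauto].
  - apply F_concat_inc; auto.
  - apply cov_Schreier; auto; [apply tk_map_inc; auto|].
    intros i Hi. apply in_map_iff in Hi as (k & <- & _). assert (H := tk_ge k). unfold tk in H. lia.
  - assert (4 <= m (2 * j))%nat by (apply (m_ge4 _ _ _ W); lia). lia.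
Qed.

Lemma xfun_N k : Nn (xfun k).
Proof.
  apply (N_NK p q m n Nn HN (k + 2)); [lia|].
  assert (E : xfun k = fun i => sumL (fun k => 1 * xfun k i) [k]).
  { apply functional_extensionality. intros i. unfold sumL, fold_right. ring. }
  rewrite E. apply (group_NK (k + 2) 0); try congruence; try lia.
  - repeat constructor.
  - intros k' [<-|[]]. lia.
  - exists (tk k). intros i [<-|[]]. auto.
  - assert (H := cap_lt _ _ _ W (k + 2) ltac:(lia)). lia.
  - simpl. rewrite rpow_abs_one. lra.
Qed.

Lemma xfun_supp_le k : supp_le (xfun k) (last (F k) 0%nat).
Proof.
  intros i Hi. destruct (Req_dec (xfun k i) 0) as [|E]; auto. apply xfun_supp, inc_le_last in E; [lia|apply F_inc].
Qed.

Lemma act_pair k K v : (last (F k) 0 <= K)%nat -> act k v = pair K (xfun k) v.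
Proof. intros H. unfold act. symmetry. apply pair_supp; auto. apply xfun_supp_le. Qed.

Lemma act_le k v c : nbound Nn v c -> Rabs (act k v) <= c.
Proof. apply pair_abs_le; [apply xfun_N|apply xfun_supp_le]. Qed.

Lemma group_act j f ks b v c : (2 <= j)%nat -> inc ks -> (forall k, In k ks -> (j <= k + 2)%nat) ->
  cov f (fun i => In i (map tk ks)) -> (f + cap n s j <= n (2 * j))%nat ->
  sumL (fun k => rpow_abs (b k) q) ks <= 1 -> nbound Nn v c ->
  sumL (fun k => b k * act k v) ks <= c.
Proof.
  intros Hj Hks Hjk Hc Hf Hb Hv.
  destruct ks as [|k0 ks0] eqn:Eks; [simpl; apply (nbound_ge0 v); auto|]. rewrite <- Eks in *.
  assert (HNf : Nn (fun i => sumL (fun k => b k * xfun k i) ks)).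
  { apply (N_NK p q m n Nn HN j); [lia|]. apply (group_NK j f); auto. subst; congruence. }
  destruct (list_bound (fun k => last (F k) 0%nat) ks) as (L & HL).
  assert (H := Hv _ L HNf). rewrite pair_sumL in H.
  rewrite (sumL_ext _ (fun k => sumL (fun i => b k * (xfun k i * v i)) (seq 0 (S L)))).
  - rewrite sumL_swap. rewrite (sumL_ext _ (fun i => sumL (fun k => b k * xfun k i) ks * v i)).
    + apply H. intros i Hi. apply sumL_zero. intros k Hk. rewrite xfun_supp_le; [ring|].
      specialize (HL k Hk). simpl in HL. lia.
    + intros i _. rewrite (Rmult_comm _ (v i)), <- sumL_scal. apply sumL_ext. intros; ring.
  - intros k Hk. rewrite sumL_scal, <- pair_sumL. f_equal. apply act_pair. apply HL; auto.
Qed.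

(** Dividing by [A] turns the coefficients into a vector dominated by the l_q majorant [a] at the
    distinct points [t_k], as [group_act] demands. *)
Lemma group_act_scaled j f ks r a A v c : (2 <= j)%nat -> inc ks -> (forall k, In k ks -> (j <= k + 2)%nat) ->
  cov f (fun i => In i (map tk ks)) -> (f + cap n s j <= n (2 * j))%nat -> 0 < A ->
  (forall k, In k ks -> Rabs (r k) <= A * a (tk k)) -> (forall i, 0 <= a i) ->
  (forall L, sumL (fun i => rpow_abs (a i) q) (seq 0 L) <= 1) -> nbound Nn v c ->
  sumL (fun k => r k * act k v) ks <= A * c.
Proof.
  intros Hj Hks Hjk Hc Hf HA Hr Ha Hs Hv.
  assert (H : sumL (fun k => r k / A * act k v) ks <= c).
  { apply (group_act j f); auto. 
    apply Rle_trans with (sumL (fun k => rpow_abs (a (tk k)) q) ks).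
    - apply sumL_le. intros k Hk. apply rpow_abs_le; [lra|]. rewrite (Rabs_pos_eq (a _)); auto.
      unfold Rdiv. rewrite Rabs_mult, Rabs_inv, (Rabs_pos_eq A); [|lra].
      apply Rmult_le_reg_l with A; auto. specialize (Hr k Hk).
      replace (A * (Rabs (r k) * / A)) with (Rabs (r k)) by (field; lra). auto.
    - destruct (list_bound tk ks) as (L & HL).
      assert (E : sumL (fun k => rpow_abs (a (tk k)) q) ks = sumL (fun i => rpow_abs (a i) q) (map tk ks))
        by (clear; induction ks; simpl; congruence).
      rewrite E. eapply Rle_trans; [|apply (Hs (S L))]. apply sumL_subset.
      + apply inc_NoDup, tk_map_inc; auto.
      + intros. apply rpow_abs_ge0.
      + intros i Hi _. apply in_map_iff in Hi as (k & <- & Hk). apply HL in Hk. apply in_seq. lia. }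
  rewrite (sumL_ext _ (fun k => A * (r k / A * act k v))); [|intros; field; lra].
  rewrite sumL_scal. apply Rmult_le_compat_l; lra.
Qed.

(** * Upper estimate for the combinations of block functionals *)

Lemma budget_cond_ii j : (2 <= j)%nat -> budget n s j (expo s j) ((n (2 * j) - 1) / 4).
Proof.
  intros Hj rho Hr. apply (growth _ _ _ W) in Hr; auto.
  apply Nat.div_le_lower_bound; lia.
Qed.

(** The doubled budget takes less than half of [n (2 * j)], by the factor 4 in condition (ii), and
    [cap] takes less than the other half. *)
Lemma room j : (2 <= j)%nat -> (2 * ((n (2 * j) - 1) / 4) + cap n s j <= n (2 * j))%nat.
Proof.
  intros Hj. assert (H := cap_lt _ _ _ W j Hj).
  assert (4 * ((n (2 * j) - 1) / 4) <= n (2 * j) - 1)%nat by (apply Nat.Div0.mul_div_le). lia.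
Qed.

Lemma m_pow2 j : (1 <= j)%nat -> INR (j + 1) * 2 ^ j <= INR (m (2 * j)%nat) /\ 2 ^ j <= INR (m (2 * j)%nat).
Proof.
  intros Hj. assert (H := m_pow4 _ _ _ W j Hj). apply le_INR in H. rewrite pow_INR in H.
  replace (INR 4) with (2 * 2) in H by (simpl; lra). rewrite Rpow_mult_distr in H.
  assert (H2 : INR (j + 1) <= 2 ^ j).
  { clear H. induction Hj as [|j Hj IH]; [simpl; lra|].
    replace (S j + 1)%nat with (S (j + 1)) by lia. rewrite S_INR.
    assert (1 <= INR (j + 1)) by (apply (le_INR 1); lia). rewrite <- tech_pow_Rmult. lra. }
  assert (1 <= INR (j + 1)) by (apply (le_INR 1); lia). split; nra.
Qed.

(** Induction on the number [d] of thresholds still to be passed. One step costs [(j + 1) * 2 * c /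
    m (2 * j) <= 2 * c / 2 ^ j], so the steps sum geometrically to the term with 4. What survives
    all of them is counted term by term, which gives the last term; it vanishes as [d] grows. *)
Lemma tail_estimate y r v c d : Nn y -> nbound Nn v c ->
  (forall k, Rabs (r k) <= Rabs (y (tk k))) ->
  forall j ks a, (2 <= j)%nat -> inc ks -> (forall i, 0 <= a i) ->
  (forall L, sumL (fun i => rpow_abs (a i) q) (seq 0 L) <= 1) ->
  (forall k, In k ks -> Rabs (y (tk k)) <= 2 * (a (tk k) / INR (m (2 * j)%nat))) ->
  sumL (fun k => r k * act k v) ks <= c * (4 / 2 ^ j) + c * (2 * INR (length ks) / 2 ^ (j + d)).
Proof.
  intros Hy Hv Hr.
  assert (Hc := nbound_ge0 v c Hv).
  (* A one-term bound, for what is left at [d = 0] and for the few blocks too early to be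
     grouped. *)
  assert (Hsingle : forall j a, (2 <= j)%nat -> (forall i, 0 <= a i) -> 
     (forall L, sumL (fun i => rpow_abs (a i) q) (seq 0 L) <= 1) -> forall k,
     Rabs (y (tk k)) <= 2 * (a (tk k) / INR (m (2 * j)%nat)) -> r k * act k v <= 2 / INR (m (2 * j)%nat) * c).
  { intros j a Hj Ha Hs k Hk.
    assert (Hm : 4 <= INR (m (2 * j)%nat)) by (apply INR_m_ge4; lia).
    assert (Ha1 : a (tk k) <= 1).
    { specialize (Hs (S (tk k))). rewrite seq_S, sumL_app in Hs. simpl in Hs.
      assert (0 <= sumL (fun i => rpow_abs (a i) q) (seq 0 (tk k))) by (apply sumL_ge0; intros; apply rpow_abs_ge0).
      assert (Hx : rpow_abs (a (tk k)) q <= 1) by lra.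
      rewrite <- (Rabs_pos_eq (a _)); auto. apply (lq_sum_In q [a (tk k)]); [lra| |simpl; auto].
      unfold lq_sum; simpl; lra. }
    assert (H1 := act_le k v c Hv). specialize (Hr k).
    apply Rle_trans with (Rabs (r k) * Rabs (act k v)); [rewrite <- Rabs_mult; apply Rle_abs|].
    apply Rmult_le_compat; auto using Rabs_pos.
    eapply Rle_trans; [exact Hr|]. eapply Rle_trans; [exact Hk|]. unfold Rdiv.
    assert (0 < / INR (m (2 * j)%nat)) by (apply Rinv_0_lt_compat; lra).
    apply Rmult_le_compat_l; [lra|]. rewrite <- (Rmult_1_l (/ _)) at 2. apply Rmult_le_compat_r; lra. }
  induction d as [|d IH]; intros j ks a Hj Hks Ha Hs Hk.
  - assert (Hm : 4 <= INR (m (2 * j)%nat)) by (apply INR_m_ge4; lia).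
    destruct (m_pow2 j ltac:(lia)) as [_ Hmj]. assert (H2 : 0 < 2 ^ j) by (apply pow_lt; lra).
    rewrite Nat.add_0_r.
    assert (H := sumL_const (fun k => r k * act k v) (2 / INR (m (2 * j)%nat) * c) ks
      (fun k Hin => Hsingle j a Hj Ha Hs k (Hk k Hin))).
    assert (Hinv : / INR (m (2 * j)%nat) <= / 2 ^ j) by (apply Rinv_le_contravar; auto).
    assert (Hl := pos_INR (length ks)).
    assert (INR (length ks) * (2 / INR (m (2 * j)%nat) * c) <= c * (2 * INR (length ks) / 2 ^ j)).
    { unfold Rdiv. replace (INR (length ks) * (2 * / INR (m (2 * j)%nat) * c)) with
        ((INR (length ks) * 2 * c) * / INR (m (2 * j)%nat)) by ring.
      replace (c * (2 * INR (length ks) * / 2 ^ j)) with ((INR (length ks) * 2 * c) * / 2 ^ j) by ring.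
      apply Rmult_le_compat_l; auto. apply Rmult_le_pos; lra. }
    assert (0 <= c * (4 / 2 ^ j)).
    { apply Rmult_le_pos; auto. apply Rlt_le, Rdiv_lt_0_compat; lra. }
    lra.
  - assert (Hm : 4 <= INR (m (2 * j)%nat)) by (apply INR_m_ge4; lia).
    (* Each threshold brings its own majorant: [a] still bounds the terms grouped now, and [a']
       those passed to the induction hypothesis. *)
    set (j1 := (j + 1)%nat).
    destruct (tame_exact p q m n s Nn Hp Hq W HN (expo s j1) ((n (2 * j1) - 1) / 4) j1 y) as
      (a' & P & Q & Ha' & Hs' & Hya & HyP & _ & Hcov); auto; [unfold j1; lia|apply budget_cond_ii; unfold j1; lia|].
    rewrite <- (m_expo _ _ _ W j1) in HyP by (unfold j1; lia).
    set (inP := fun k => holds P (tk k)).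
    rewrite (sumL_filter inP).
    assert (HI := IH j1 (filter (fun k => negb (inP k)) ks) a' ltac:(unfold j1; lia) (inc_filter _ _ Hks) Ha' Hs').
    assert (HI' : sumL (fun k => r k * act k v) (filter (fun k => negb (inP k)) ks) <=
      c * (4 / 2 ^ j1) + c * (2 * INR (length (filter (fun k => negb (inP k)) ks)) / 2 ^ (j1 + d))).
    { apply HI. intros k Hin. apply filter_In in Hin as [Hin HnP]. apply HyP.
      intros HP. apply holds_true in HP. unfold inP in HnP. rewrite HP in HnP. discriminate. }
    clear HI. rewrite (sumL_filter (fun k => k + 2 <? j1)%nat _ (filter inP ks)).
    (* Blocks with [k + 2 < j1] cannot be read at weight [m (2 * j1)]; there are at most [j] of
       them. *)
    set (kA := filter (fun k => k + 2 <? j1)%nat (filter inP ks)).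
    set (kB := filter (fun k => negb (k + 2 <? j1)%nat) (filter inP ks)).
    assert (HA : sumL (fun k => r k * act k v) kA <= INR j * (2 / INR (m (2 * j)%nat) * c)).
    { eapply Rle_trans; [apply (sumL_const _ (2 / INR (m (2 * j)%nat) * c))|].
      - intros k Hin. apply filter_In in Hin as [Hin _]. apply filter_In in Hin as [Hin _].
        apply (Hsingle j a); auto.
      - apply Rmult_le_compat_r.
        + apply Rmult_le_pos; auto. apply Rlt_le, Rdiv_lt_0_compat; lra.
        + apply le_INR. assert (Hlen : (length kA <= length (seq 0 j))%nat); [|rewrite length_seq in Hlen; auto].
          apply NoDup_incl_length; [apply inc_NoDup; repeat apply inc_filter; auto|].
          intros k Hin. apply filter_In in Hin as [_ Hlt]. apply Nat.ltb_lt in Hlt. apply in_seq. unfold j1 in *. lia. }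
    assert (HBd : sumL (fun k => r k * act k v) kB <= 2 / INR (m (2 * j)%nat) * c).
    { apply (group_act_scaled j1 (2 * ((n (2 * j1) - 1) / 4)) kB r a); auto.
      - unfold j1; lia.
      - repeat apply inc_filter; auto.
      - intros k Hin. apply filter_In in Hin as [_ Hlt]. apply Bool.negb_true_iff, Nat.ltb_ge in Hlt. auto.
      - eapply cov_sub; [|exact Hcov]. intros i Hi. apply in_map_iff in Hi as (k & <- & Hin).
        apply filter_In in Hin as [Hin Hlt]. apply filter_In in Hin as [Hin HP].
        apply Bool.negb_true_iff, Nat.ltb_ge in Hlt. split; [apply holds_true; auto|].
        assert (H := tk_ge k). lia.
      - apply room. unfold j1; lia.
      - apply Rdiv_lt_0_compat; lra.
      - intros k Hin. apply filter_In in Hin as [Hin _]. apply filter_In in Hin as [Hin _].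
        eapply Rle_trans; [apply Hr|]. eapply Rle_trans; [apply Hk; auto|]. unfold Rdiv. lra. }
    assert (Hlen : INR (length (filter (fun k => negb (inP k)) ks)) <= INR (length ks)).
    { apply le_INR. rewrite (filter_length_le). auto. }
    assert (Hj2 : INR (j + 1) * (2 / INR (m (2 * j)%nat)) <= 2 / 2 ^ j).
    { destruct (m_pow2 j ltac:(lia)) as [Hmj _]. assert (H2 : 0 < 2 ^ j) by (apply pow_lt; lra).
      apply Rmult_le_reg_r with (INR (m (2 * j)%nat) * 2 ^ j); [nra|].
      replace (INR (j + 1) * (2 / INR (m (2 * j)%nat)) * (INR (m (2 * j)%nat) * 2 ^ j)) with (2 * (INR (j + 1) * 2 ^ j)) by (field; lra).
      replace (2 / 2 ^ j * (INR (m (2 * j)%nat) * 2 ^ j)) with (2 * INR (m (2 * j)%nat)) by (field; lra). lra. }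
    rewrite plus_INR in Hj2. simpl (INR 1) in Hj2.
    assert (Hj3 : (INR j + 1) * (2 / INR (m (2 * j)%nat)) * c <= 2 / 2 ^ j * c) by (apply Rmult_le_compat_r; auto).
    assert (Hpj : 0 < 2 ^ j) by (apply pow_lt; lra).
    assert (EJ : 4 / 2 ^ j1 = 2 / 2 ^ j) by (unfold j1; rewrite pow_add, pow_1; field; lra).
    assert (EJd : 2 ^ (j1 + d) = 2 ^ (j + S d)) by (f_equal; unfold j1; lia).
    rewrite EJ, EJd in HI'.
    assert (Hpd : 0 < / 2 ^ (j + S d)) by (apply Rinv_0_lt_compat, pow_lt; lra).
    assert (c * (2 * INR (length (filter (fun k => negb (inP k)) ks)) / 2 ^ (j + S d)) <= c * (2 * INR (length ks) / 2 ^ (j + S d))).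
    { apply Rmult_le_compat_l; auto. unfold Rdiv. apply Rmult_le_compat_r; lra. }
    replace (4 / 2 ^ j) with (2 / 2 ^ j + 2 / 2 ^ j) by (field; lra). lra.
Qed.

(** The terms large at the first threshold form one group of weight [m 4], admitting every block
    since [2 <= k + 2], and give [2 * c]. The tail from [j = 2] gives [c], and its error another
    [c]. *)
Lemma sum_estimate y sg v c ks : Nn y -> nbound Nn v c -> inc ks -> (forall k, Rabs (sg k) <= 1) ->
  sumL (fun k => sg k * y (tk k) * act k v) ks <= 4 * c.
Proof.
  intros Hy Hv Hks Hsg. assert (Hc := nbound_ge0 v c Hv).
  set (r := fun k => sg k * y (tk k)).
  assert (Hr : forall k, Rabs (r k) <= Rabs (y (tk k))).
  { intros k. unfold r. rewrite Rabs_mult. specialize (Hsg k). assert (H := Rabs_pos (y (tk k))). nra. }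
  destruct (tame_exact p q m n s Nn Hp Hq W HN (expo s 2) ((n (2 * 2) - 1) / 4) 2 y) as
      (a & P & Q & Ha & Hs & Hya & HyP & _ & Hcov); auto; [apply budget_cond_ii; lia|].
  rewrite <- (m_expo _ _ _ W 2) in HyP by lia.
  set (inP := fun k => holds P (tk k)).
  rewrite (sumL_filter inP).
  assert (HA : sumL (fun k => r k * act k v) (filter inP ks) <= 2 * c).
  { apply (group_act_scaled 2 (2 * ((n (2 * 2) - 1) / 4)) _ r a); auto; try lra; try lia.
    - apply inc_filter; auto.
    - eapply cov_sub; [|exact Hcov]. intros i Hi. apply in_map_iff in Hi as (k & <- & Hin).
      apply filter_In in Hin as [Hin HP]. split; [apply holds_true; auto|].
      assert (H := tk_ge k). lia.
    - apply room. lia.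
    - intros k _. eapply Rle_trans; [apply Hr|apply Hya]. }
  set (ks' := filter (fun k => negb (inP k)) ks).
  (* The depth [d] is chosen by the number of terms, to make the leftover error at most [c]. *)
  destruct (Pow_x_infinity 2 ltac:(rewrite Rabs_pos_eq; lra) (2 * INR (length ks'))) as (d & Hd).
  specialize (Hd d (Nat.le_refl d)).
  assert (Hp2 : 0 < 2 ^ d) by (apply pow_lt; lra). rewrite Rabs_pos_eq in Hd; [|lra].
  assert (HT : sumL (fun k => r k * act k v) ks' <= c * (4 / 2 ^ 2) + c * (2 * INR (length ks') / 2 ^ (2 + d))).
  { apply (tail_estimate y r v c d Hy Hv Hr 2 ks' a); auto.
    - apply inc_filter; auto.
    - intros k Hin. apply filter_In in Hin as [Hin HnP]. apply HyP.
      intros HP. apply holds_true in HP. unfold inP in HnP. rewrite HP in HnP. discriminate. }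
  assert (2 * INR (length ks') / 2 ^ (2 + d) <= 1).
  { apply Rmult_le_reg_r with (2 ^ (2 + d)); [apply pow_lt; lra|].
    unfold Rdiv. rewrite Rmult_assoc, Rinv_l; [|apply pow_nonzero; lra].
    rewrite pow_add. replace (2 ^ 2) with 4 by (simpl; ring). lra. }
  assert (c * (2 * INR (length ks') / 2 ^ (2 + d)) <= c * 1) by (apply Rmult_le_compat_l; auto).
  replace (4 / 2 ^ 2) with 1 in HT by (simpl; field).
  rewrite Rmult_1_r in HT.
  unfold r, ks' in *. lra.
Qed.

(** Off the large set [P] the factor [1 / M] in [y] cancels [M] in [xvec k], and Young's inequality
    gives at most 2 + 2. On [P] the flatness of [u k] leaves at most 1 more; this requires the
    complexity [cap - 1], supplied by [below_cap]. *)
Lemma xvec_bound k : nbound Nn (xvec k) 5.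
Proof.
  intros y L Hy HL. rewrite pair_sumL.
  set (K := (k + 2)%nat). set (M := INR (m (2 * K)%nat)).
  assert (HM : 4 <= M) by (apply INR_m_ge4; unfold K; lia).
  destruct (tame_exact p q m n s Nn Hp Hq W HN (expo s K) (cap n s K - 1) K y) as
      (a & P & Q & Ha & Hs & Hya & HyP & HcC & _); auto; [unfold K; lia| |].
  { intros rho Hrho. apply (below_cap _ _ _ W) in Hrho; unfold K in *; lia. }
  rewrite <- (m_expo _ _ _ W K) in HyP by (unfold K; lia).
  (* The scale for Young's inequality on [P]: the uncancelled factor [M] moves into [1 / tau^p] in
     front of [u k], and the mass of [P], at most [tau^p], absorbs it. *)
  set (tau := / (4 * M)). assert (Htau : 0 < tau) by (apply Rinv_0_lt_compat; lra).
  set (ep := rpow_abs tau p). assert (Hep : 0 < ep) by (apply rpow_abs_pos; lra).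
  assert (Hmass : mass_le (u k) P ep).
  { assert (HKt : 0 < INR (K ^ expo s K)) by (apply lt_0_INR, Nat.neq_0_lt_0, Nat.pow_nonzero; unfold K; lia).
    replace ep with (INR (K ^ expo s K) * gap_eps p m s k).
    - eapply mass_covC; [|exact HcC]. intros c. apply (b_small _ _ _ _ _ _ HB). apply HcC.
    - unfold gap_eps. fold K. fold M. fold tau. fold ep. field. lra. }
  set (ind := fun i => if holds P i then u k i else 0).
  assert (Hi : forall i, y i * xvec k i <= 2 * rpow_abs (a i) q + 2 * u k i + / ep * ind i).
  { intros i. assert (Hu := b_ge0 _ _ _ _ _ _ HB k i).
    assert (Hpu := rpow_abs_ge0 (u k i) (1 / p)). set (pu := rpow_abs (u k i) (1 / p)) in *.
    assert (Epu : rpow_abs pu p = u k i).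
    { unfold pu. rewrite rpow_abs_rpow_abs. replace (1 / p * p) with 1 by (field; lra).
      rewrite rpow_abs_1, Rabs_pos_eq; auto. }
    assert (Hraq := rpow_abs_ge0 (a i) q). assert (Hai := Ha i).
    apply Rle_trans with (Rabs (y i) * (M * pu)).
    { change (xvec k i) with (M * pu). apply Rmult_le_compat_r; [nra|apply Rle_abs]. }
    assert (Hy0 := Rabs_pos (y i)). unfold ind.
    destruct (holds P i) eqn:EP.
    - specialize (Hya i).
      assert (HY := young p q (a i) (pu / tau) Hp Hq Hpq Hai ltac:(apply Rmult_le_pos; [lra|left; apply Rinv_0_lt_compat; lra])).
      unfold Rdiv in HY. rewrite (rpow_abs_mult pu), Epu in HY.
      assert (Eit : rpow_abs (/ tau) p = / ep).
      { apply Rmult_eq_reg_l with ep; [|lra]. unfold ep at 1. rewrite <- rpow_abs_mult, !Rinv_r, rpow_abs_one; lra. }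
      rewrite Eit in HY.
      assert (Rabs (y i) * (M * pu) <= 2 * a i * (M * pu)) by (apply Rmult_le_compat_r; nra).
      assert (E : 2 * a i * (M * pu) = / 2 * (a i * (pu * / tau))) by (unfold tau; field; lra).
      assert (0 < / ep) by (apply Rinv_0_lt_compat; auto). 
      assert (0 <= / ep * u k i) by (apply Rmult_le_pos; lra). lra.
    - assert (HnP : ~ P i) by (rewrite <- holds_true, EP; discriminate). specialize (HyP i HnP).
      assert (HY := young p q (a i) pu Hp Hq Hpq Hai Hpu). rewrite Epu in HY.
      assert (Rabs (y i) * (M * pu) <= 2 * (a i / M) * (M * pu)) by (apply Rmult_le_compat_r; auto; nra).
      replace (2 * (a i / M) * (M * pu)) with (2 * (a i * pu)) in * by (field; lra). lra. }
  eapply Rle_trans; [apply sumL_le; intros i _; apply Hi|].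
  rewrite !sumL_plus, !sumL_scal.
  assert (H1 := Hs (S L)).
  assert (H2 : sumL (u k) (seq 0 (S L)) <= 1).
  { rewrite <- (b_sum _ _ _ _ _ _ HB k). apply sumL_subset; [apply seq_NoDup|eapply b_ge0; eauto|].
    intros i _. apply (b_supp _ _ _ _ _ _ HB). }
  assert (H3 : sumL ind (seq 0 (S L)) <= ep).
  { assert (E : sumL ind (seq 0 (S L)) = sumL (u k) (filter (holds P) (seq 0 (S L)))).
    { generalize (seq 0 (S L)). intros l. unfold ind. induction l as [|i l IHl]; simpl; auto.
      destruct (holds P i); simpl; rewrite IHl; lra. }
    rewrite E. apply Hmass; [apply NoDup_filter, seq_NoDup|].
    intros i Hin. apply filter_In in Hin as [_ Hin]. apply holds_true; auto. }
  assert (/ ep * sumL ind (seq 0 (S L)) <= / ep * ep).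
  { apply Rmult_le_compat_l; auto. left; apply Rinv_0_lt_compat; auto. }
  rewrite Rinv_l in *; lra.
Qed.

Lemma act_xvec k : act k (xvec k) = 1.
Proof.
  unfold act. rewrite pair_sumL. 
  assert (HM : 4 <= INR (m (2 * (k + 2))%nat)) by (apply INR_m_ge4; lia).
  rewrite (sumL_ext _ (u k)).
  - apply Rle_antisym; rewrite <- (b_sum _ _ _ _ _ _ HB k); apply sumL_subset; try (eapply b_ge0; eauto).
    + apply seq_NoDup.
    + intros i _. apply (b_supp _ _ _ _ _ _ HB).
    + apply inc_NoDup, F_inc.
    + intros i Hi _. apply in_seq. apply inc_le_last in Hi; [lia|apply F_inc].
  - intros i _. unfold xfun, xvec, wvec.
    replace (/ INR (m (2 * (k + 2))%nat) * rpow_abs (u k i) (1 / q) * (INR (m (2 * (k + 2))%nat) * rpow_abs (u k i) (1 / p)))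
      with (rpow_abs (u k i) (1 / q) * rpow_abs (u k i) (1 / p)) by (field; lra).
    rewrite rpow_abs_plus. replace (1 / q + 1 / p) with 1 by lra. rewrite rpow_abs_1, Rabs_pos_eq; auto.
    eapply b_ge0; eauto.
Qed.

Lemma xvec_supp k i : xvec k i <> 0 -> In i (F k).
Proof.
  intros H. apply (b_supp _ _ _ _ _ _ HB). intros E. apply H. unfold xvec. rewrite E, rpow_abs_0. ring.
Qed.

(** * The diagonal operators *)

Lemma act_zero k v : (forall i, In i (F k) -> v i = 0) -> act k v = 0.
Proof.
  intros H. unfold act. rewrite pair_sumL. apply sumL_zero. intros i _.
  destruct (Req_dec (xfun k i) 0) as [E|E]; [rewrite E; ring|]. rewrite H; [ring|]. apply xfun_supp; auto.
Qed.

(** The series is finite at each coordinate: since [tk k >= k + 3], only terms with [k <= i] can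
    reach coordinate [i]. *)
Definition diag_op (sg : nat -> R) (a : vec) : vec :=
  fun i => sumL (fun k => sg k * act k a * unitv (tk k) i) (seq 0 (S i)).

Lemma diag_op_range sg a i L : (i <= L)%nat ->
  diag_op sg a i = sumL (fun k => sg k * act k a * unitv (tk k) i) (seq 0 (S L)).
Proof.
  intros H. unfold diag_op. induction H as [|L H IH]; auto. rewrite (seq_S (S L) 0), sumL_app, <- IH.
  rewrite sumL_1, unitv_other; [ring|]. assert (Hk := tk_ge (0 + S L)). lia.
Qed.

Lemma pair_diag_op sg a y L : supp_le y L ->
  pair L y (diag_op sg a) = sumL (fun k => sg k * y (tk k) * act k a) (seq 0 (S L)).
Proof.
  intros Hy. rewrite pair_sumL.
  rewrite (sumL_ext _ (fun i => sumL (fun k => sg k * act k a * (y i * unitv (tk k) i)) (seq 0 (S L)))).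
  - rewrite sumL_swap. apply sumL_ext. intros k _. rewrite sumL_scal, <- pair_sumL, pair_unitv by auto. ring.
  - intros i Hi. apply in_seq in Hi. rewrite (diag_op_range sg a i L) by lia. rewrite <- sumL_scal.
    apply sumL_ext. intros; ring.
Qed.

Lemma diag_op_at sg a k : diag_op sg a (tk k) = sg k * act k a.
Proof.
  rewrite <- (pair_unitv (tk k) (diag_op sg a) (tk k)) by auto. rewrite pair_comm, pair_diag_op.
  - assert (Hk := tk_ge k). 
    rewrite (sumL_ext _ (fun l => sg l * act l a * unitv k l)).
    + rewrite <- pair_sumL. rewrite pair_unitv; auto. right; lia.
    + intros l _. destruct (Nat.eq_dec l k) as [->|E]; [rewrite !unitv_same; ring|].
      rewrite (unitv_other l k), unitv_other; auto; [ring|]. intros E'. apply tk_inj in E'. auto.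
  - intros i Hi. apply unitv_other. lia.
Qed.

Lemma diag_op_off sg a i : (forall k, i <> tk k) -> diag_op sg a i = 0.
Proof. intros H. unfold diag_op. apply sumL_zero. intros k _. rewrite unitv_other; auto. ring. Qed.

Lemma diag_op_case i : (exists k, i = tk k) \/ (forall k, i <> tk k).
Proof.
  destruct (excluded_middle_informative (exists k, i = tk k)) as [H|H]; auto.
  right. intros k E. apply H. eauto.
Qed.

Lemma seq_inc a b : inc (seq a b).
Proof.
  revert a. induction b as [|b IH]; intros a; simpl; constructor; auto.
  apply Forall_forall. intros x Hx. apply in_seq in Hx. lia.
Qed.

Lemma diag_op_estimate y sg v c Mb L : Nn y -> nbound Nn v c -> (forall k, Rabs (sg k) <= Mb) ->
  sumL (fun k => sg k * y (tk k) * act k v) (seq 0 L) <= 4 * Mb * c.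
Proof.
  intros Hy Hv Hsg. assert (HM : 0 <= Mb) by (eapply Rle_trans; [apply Rabs_pos|apply (Hsg 0%nat)]).
  destruct (Req_dec Mb 0) as [->|HM0].
  - rewrite sumL_zero; [lra|]. intros k _. specialize (Hsg k).
    destruct (Req_dec (sg k) 0) as [E|E]; [rewrite E; ring|apply Rabs_pos_lt in E; lra].
  - rewrite (sumL_ext _ (fun k => Mb * (sg k / Mb * y (tk k) * act k v))); [|intros; field; lra].
    rewrite sumL_scal. assert (H : sumL (fun k => sg k / Mb * y (tk k) * act k v) (seq 0 L) <= 4 * c).
    { apply sum_estimate; auto; [apply seq_inc|]. intros k. unfold Rdiv. rewrite Rabs_mult, Rabs_inv, (Rabs_pos_eq Mb); auto.
      apply Rmult_le_reg_r with Mb; [lra|]. rewrite Rmult_assoc, Rinv_l; auto. specialize (Hsg k). lra. }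
    assert (Mb * sumL (fun k => sg k / Mb * y (tk k) * act k v) (seq 0 L) <= Mb * (4 * c)) by (apply Rmult_le_compat_l; auto).
    lra.
Qed.

Lemma diag_op_norm sg Mb : (forall k, Rabs (sg k) <= Mb) -> op_norm_le Nn (diag_op sg) (4 * Mb).
Proof. intros H a c _ Ha f L Hf HL. rewrite pair_diag_op; auto. apply diag_op_estimate; auto. Qed.

Lemma act_ext k v w : (forall i, In i (F k) -> v i = w i) -> act k v = act k w.
Proof.
  intros H. unfold act. rewrite !pair_sumL. apply sumL_ext. intros i _.
  destruct (Req_dec (xfun k i) 0) as [E|E]; [rewrite E; ring|]. rewrite H; auto. apply xfun_supp; auto.
Qed.

Lemma act_add k v w : act k (vadd v w) = act k v + act k w.
Proof. unfold act. rewrite !pair_sumL, <- sumL_plus. apply sumL_ext. intros; unfold vadd; ring. Qed.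

Lemma act_scale k r v : act k (vscale r v) = r * act k v.
Proof. unfold act. apply pair_scale. Qed.

(** A segment of the image is the image under truncated coefficients. The remaining [act k] look
    only beyond [a1], because [t_k] is the minimum of its block, so [a] can be replaced by a segment
    of small norm. *)
Lemma diag_op_inX sg a : bounded_seq sg -> inX Nn a -> inX Nn (diag_op sg a).
Proof.
  intros [Mb HM] [Ha0 Ha]. assert (HMb : 0 <= Mb) by (eapply Rle_trans; [apply Rabs_pos|apply (HM 0%nat)]).
  split; [apply diag_op_off; intros k E; assert (H := tk_ge k); lia|].
  intros eps He. assert (He' : 0 < eps / (4 * (Mb + 1))) by (apply Rdiv_lt_0_compat; lra).
  destruct (Ha _ He') as (n0 & Hn0). exists n0. intros a1 b1 Ha1 Hb1 y L Hy HL.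
  set (sg' := fun k => if ((a1 <? tk k)%nat && (tk k <=? b1)%nat)%bool then sg k else 0).
  destruct (list_bound (fun k => last (F k) 0%nat) (seq 0 (S L))) as (B & HBd).
  (* The bound [B] lies beyond every block in the finite sum; the maximum keeps the endpoints
     ordered. *)
  set (v := seg a1 (Nat.max a1 B) a).
  assert (HM' : forall k, Rabs (sg' k) <= Mb).
  { intros k. unfold sg'. destruct (_ && _)%bool; auto. rewrite Rabs_R0; auto. }
  assert (E1 : pair L y (seg a1 b1 (diag_op sg a)) = pair L y (diag_op sg' a)).
  { rewrite !pair_sumL. apply sumL_ext. intros i _. f_equal. unfold seg.
    destruct (diag_op_case i) as [(k & ->)|Hoff].
    - rewrite !diag_op_at. unfold sg'. destruct (_ && _)%bool; ring.
    - rewrite !diag_op_off by auto. destruct (_ && _)%bool; auto. }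
  rewrite E1, pair_diag_op by auto.
  rewrite (sumL_ext _ (fun k => sg' k * y (tk k) * act k v)).
  - eapply Rle_trans; [apply (diag_op_estimate y sg' v (eps / (4 * (Mb + 1))) Mb); auto; apply Hn0; auto; lia|].
    apply Rmult_le_reg_r with (4 * (Mb + 1)); [lra|].
    replace (4 * Mb * (eps / (4 * (Mb + 1))) * (4 * (Mb + 1))) with (4 * Mb * eps) by (field; lra). nra.
  - intros k Hk. unfold sg'. destruct (_ && _)%bool eqn:Eb; [|ring]. f_equal. apply act_ext. intros i Hi.
    apply andb_prop in Eb as [Eb _]. apply Nat.ltb_lt in Eb.
    assert (H1 := inc_hd_le _ i (F_inc k) Hi). assert (H2 := inc_le_last _ i (F_inc k) Hi).
    specialize (HBd k Hk). simpl in HBd. unfold v, seg.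
    replace (a1 <? i)%nat with true by (symmetry; apply Nat.ltb_lt; unfold tk in Eb; lia).
    replace (i <=? Nat.max a1 B)%nat with true by (symmetry; apply Nat.leb_le; lia). auto.
Qed.

Lemma diag_op_is_op sg : bounded_seq sg -> is_op Nn (diag_op sg).
Proof.
  intros Hs. split; [intros; apply diag_op_inX; auto|]. split; [|split].
  - intros a b _ _ i. unfold diag_op. rewrite <- sumL_plus. apply sumL_ext. intros. rewrite act_add. ring.
  - intros r a _ i. unfold diag_op. rewrite <- sumL_scal. apply sumL_ext. intros. rewrite act_scale. ring.
  - destruct Hs as [Mb HM]. exists (4 * Mb). apply diag_op_norm; auto.
Qed.

Lemma xvec_inX k : inX Nn (xvec k).
Proof.
  apply inX_fin.
  - destruct (Req_dec (xvec k 0%nat) 0) as [|E]; auto. apply xvec_supp, (b_first _ _ _ _ _ _ HB) in E. lia.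
  - exists (last (F k) 0%nat). intros i Hi. destruct (Req_dec (xvec k i) 0) as [|E]; auto.
    apply xvec_supp, inc_le_last in E; [lia|apply F_inc].
Qed.

Lemma diag_op_xvec sg k i : diag_op sg (xvec k) i = sg k * unitv (tk k) i.
Proof.
  destruct (diag_op_case i) as [(l & ->)|Hoff].
  - rewrite diag_op_at. destruct (Nat.eq_dec l k) as [->|E]; [rewrite act_xvec, unitv_same; ring|].
    rewrite unitv_other by (intros E'; apply tk_inj in E'; auto).
    rewrite act_zero; [ring|]. intros j Hj. destruct (Req_dec (xvec k j) 0) as [|Ex]; auto. apply xvec_supp in Ex.
    destruct (Nat.lt_total l k) as [H|[H|H]]; [|tauto|]; [specialize (F_sep l k j j H Hj Ex)|specialize (F_sep k l j j H Ex Hj)]; lia.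
  - rewrite diag_op_off, unitv_other; auto. ring.
Qed.

(** The lower constant comes from testing on [xvec k], of norm at most 5, whose image has the value
    [s_k] at coordinate [t_k]. *)
Lemma diag_op_embeds : linf_embeds Nn.
Proof.
  exists diag_op, (1 / 5), 4. split; [lra|]. split; [lra|]. split; [apply diag_op_is_op|]. split; [|split; [|split]].
  - intros s0 t a _ _ _ i. unfold diag_op. rewrite <- sumL_plus. apply sumL_ext. intros; ring.
  - intros r s0 a _ _ i. unfold diag_op. rewrite <- sumL_scal. apply sumL_ext. intros; ring.
  - apply diag_op_norm.
  - intros s0 Mb _ HM k. specialize (HM (xvec k) 5 (xvec_inX k) (xvec_bound k)).
    apply (nbound_coord _ _ (tk k)) in HM; [|assert (H := tk_ge k); lia].
    rewrite diag_op_xvec, unitv_same, Rmult_1_r in HM. lra.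
Qed.

(** The coordinate [t_k - 1] precedes block [k] and, by the gap of 2, lies strictly after the block
    before it. *)
Lemma hole_act k l : act l (unitv (tk k - 1)) = 0.
Proof.
  apply act_zero. intros i Hi. apply unitv_other. assert (Hk := tk_ge k). intros E.
  destruct (Nat.lt_total l k) as [H|[->|H]].
  - specialize (F_sep l k i (tk k) H Hi (tk_In k)). lia.
  - assert (H1 := inc_hd_le _ i (F_inc k) Hi). unfold tk in *. lia.
  - specialize (F_sep k l (tk k) i H (tk_In k) Hi). lia.
Qed.

Lemma diag_op_hole sg k i : diag_op sg (unitv (tk k - 1)) i = 0.
Proof. unfold diag_op. apply sumL_zero. intros l _. rewrite hole_act. ring. Qed.

Lemma hole_inX k : inX Nn (unitv (tk k - 1)).
Proof.
  assert (H := tk_ge k). apply inX_fin; [apply unitv_other; lia|].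
  exists (tk k). intros i Hi. apply unitv_other. lia.
Qed.

Definition unit_op : vec -> vec := diag_op (fun _ => 1).

Lemma unit_op_bounded : bounded_seq (fun _ => 1).
Proof. exists 1. intros _. rewrite Rabs_R1. lra. Qed.

(** On the holes [K] acts as [- lam], which forces [lam = 0]. Then [K] agrees with the operator,
    which sends the vectors [xvec k / 5] of the unit ball to [e_{t_k} / 5], again excluded by
    compactness. *)
Lemma unit_op_not_scalar_compact : ~ (exists (lam : R) (K : vec -> vec),
  compact_op Nn K /\ forall a, inX Nn a -> forall i, unit_op a i = lam * a i + K a i).
Proof.
  intros (lam & K & HK & HT).
  assert (Hlam : - lam = 0).
  { apply (compact_diagonal K (fun k => unitv (tk k - 1)) (fun k => tk k - 1)%nat); auto.
    - intros k. split; [apply hole_inX|apply nbound_unitv].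
    - intros k. assert (H := tk_ge k). lia.
    - intros k i. specialize (HT _ (hole_inX k) i). unfold unit_op in HT. rewrite diag_op_hole in HT. lra. }
  assert (Hlam0 : lam = 0) by lra. clear Hlam. subst lam.
  assert (Hx : / 5 = 0); [|lra].
  apply (compact_diagonal K (fun k => vscale (/ 5) (xvec k)) tk); auto.
  - intros k. split; [apply inX_scale, xvec_inX|].
    replace 1 with (Rabs (/ 5) * 5); [apply nbound_scale, xvec_bound|]. rewrite Rabs_pos_eq; lra.
  - intros k. assert (H := tk_ge k). lia.
  - intros k i. specialize (HT (vscale (/ 5) (xvec k)) ltac:(apply inX_scale, xvec_inX) i).
    assert (HJ : unit_op (vscale (/ 5) (xvec k)) i = / 5 * unit_op (xvec k) i).
    { apply (diag_op_is_op _ unit_op_bounded), xvec_inX. }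
    rewrite HJ in HT. unfold unit_op in HT. rewrite diag_op_xvec in HT. lra.
Qed.

Lemma unit_op_not_compact : ~ compact_op Nn unit_op.
Proof.
  intros H. apply unit_op_not_scalar_compact. exists 0, unit_op. split; auto. intros; ring.
Qed.

End Blocks.

Theorem mainTheorem1 (p q : R) (m n : nat -> nat) (Nn : vec -> Prop) :
  1 < p -> 1 < q -> 1 / p + 1 / q = 1 ->
  cond_i m -> cond_ii m n -> MNq_Schreier p q m n Nn ->
  (exists T : vec -> vec,
     is_op Nn T /\
     ~ (exists (lam : R) (K : vec -> vec),
          compact_op Nn K /\ forall a, inX Nn a -> forall i, T a i = lam * a i + K a i) /\
     (HI Nn -> strictly_singular Nn T /\ ~ compact_op Nn T)) /\
  linf_embeds Nn.
Proof.
  intros Hp Hq Hpq Hm Hn HN. destruct (cond_weights m n Hm Hn) as (s & W).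
  destruct (blocks_exist p m n s W) as (F & u & HB).
  assert (HNn : norming Nn) by apply HN.
  split; [|exact (diag_op_embeds p q m n s Nn Hp Hq Hpq W HN F u HB)].
  exists (unit_op q m F u).
  assert (Hop : is_op Nn (unit_op q m F u)).
  { apply (diag_op_is_op p q m n s Nn Hp Hq W HN F u HB), unit_op_bounded. }
  split; auto. split; [exact (unit_op_not_scalar_compact p q m n s Nn Hp Hq Hpq W HN F u HB)|].
  intros HHI. split; [|exact (unit_op_not_compact p q m n s Nn Hp Hq Hpq W HN F u HB)].
  apply HI_strictly_singular; auto.
  (* The holes in front of the blocks supply infinitely many basis vectors in the kernel. *)
  apply (inf_dim_unitv _ (fun k => tk F k - 1)%nat).
  - intros k l E. assert (Hk := tk_ge p m n s F u HB k). assert (Hl := tk_ge p m n s F u HB l).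
    apply (tk_inj p m n s F u HB). lia.
  - intros k. split; [eapply hole_inX; eauto|]. intros i. eapply diag_op_hole; eauto.
Qed.
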